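(* Let $P\subset\mathbb{R}^n$ be an $n$-dimensional simple lattice polytope. For $0\le p\le n$ let $\mathcal F_p(P)$ be the set of $p$-dimensional faces of $P$, and for a positive integer $i$ let $I_p(i)=\sum_{F\in\mathcal F_p(P)}\#\big(\mathrm{relint}(iF)\cap\mathbb{Z}^n\big)$. Let $$c(P)=\sum_{p=0}^n (-1)^{n-p}(p+1)\sum_{F\in \mathcal F_p(P)} \mathrm{Vol}_{\mathbb Z}(F).$$ If $n$ is odd and $m=(n+1)/2$, then $$c(P)=\sum_{p=m}^n\sum_{i=1}^{p+1-m}(-1)^{m-i}\binom{p+1}{m+i}\, 2\,i\, I_p(i).$$ If $n$ is even and $m=n/2$, then $$c(P)=\sum_{p=m}^n\sum_{i=1}^{p+1-m}(-1)^{m+1-i}\left(\binom{p+1}{m+i}-\binom{p+1}{m+i+1}\right) i\, I_p(i).$$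
   Context: A lattice polytope is a polytope all of whose vertices lie in $\mathbb{Z}^n$. An $n$-dimensional polytope is simple if every vertex lies on exactly $n$ edges (equivalently, on exactly $n$ facets). The faces of $P$ include $P$ itself, which is the only $n$-dimensional face. For a lattice polytope $F$ of dimension $p$, $\mathrm{Vol}_{\mathbb Z}(F)$ denotes its lattice volume: the $p$-dimensional volume on the affine span of $F$, normalized so that a fundamental parallelepiped of the lattice of integral points of the linear space parallel to that affine span has volume $p!$ (so the volume of a vertex is $1$). Equivalently, $\mathrm{Vol}_{\mathbb Z}(F)/p!$ is the coefficient of $t^p$ in the Ehrhart polynomial of $F$, the polynomial whose value at each non-negative integer $t$ is $\#(tF\cap\mathbb{Z}^n)$. $\mathrm{relint}$ denotes relative interior, and the relative interior of a point is the point itself. $\binom{a}{b}=0$ when $b>a\ge 0$. *)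

(* Defs.v *)
From HB Require Import structures.
From mathcomp Require Import all_boot all_order all_algebra finmap.
From mathcomp Require Import all_classical all_reals all_analysis.
Import Order.TTheory GRing.Theory Num.Theory.
Import numFieldNormedType.Exports.

Set Implicit Arguments.
Unset Strict Implicit.
Unset Printing Implicit Defensive.

Local Open Scope classical_set_scope.
Local Open Scope ring_scope.

Section LatticePolytopes.
Variable R : realType.

Definition convex_hull (n : nat) (S : set 'rV[R]_n) : set 'rV[R]_n :=
  [set x | exists (k : nat) (v : 'I_k -> 'rV[R]_n) (w : 'I_k -> R),
    [/\ forall i, S (v i), forall i, 0 <= w i, \sum_i w i = 1
      & x = \sum_i w i *: v i]].

Definition affine_hull (n : nat) (S : set 'rV[R]_n) : set 'rV[R]_n :=
  [set x | exists (k : nat) (v : 'I_k -> 'rV[R]_n) (w : 'I_k -> R),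
    [/\ forall i, S (v i), \sum_i w i = 1 & x = \sum_i w i *: v i]].

(* The linear space parallel to the affine span of [S]. *)
Definition direction (n : nat) (S : set 'rV[R]_n) : set 'rV[R]_n :=
  [set x - y | x in affine_hull S & y in affine_hull S].

Definition has_dim (n : nat) (S : set 'rV[R]_n) (p : nat) : Prop :=
  S !=set0 /\
  exists2 B : 'M[R]_(p, n), row_free B &
    direction S = [set c *m B | c in [set: 'rV[R]_p]].

Definition relint (n : nat) (S : set 'rV[R]_n) : set 'rV[R]_n :=
  [set x | S x /\ \forall y \near x, affine_hull S y -> S y].

Definition integral_points (n : nat) : set 'rV[R]_n :=
  [set x | forall j, x 0 j \is a Num.int].

(* Cardinality as a natural number; [fset_set] gives the empty set on infinite
   sets, but here it is only used on bounded sets of integral points. *)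
Definition lattice_count (n : nat) (S : set 'rV[R]_n) : nat :=
  #|` fset_set (S `&` @integral_points n)|%fset.

Definition polytope (n : nat) (P : set 'rV[R]_n) : Prop :=
  exists s : seq 'rV[R]_n, P = convex_hull [set` s].

(* [a = 0], [b = 0] gives [P] itself; the empty face may also arise, but it
   has no dimension, hence is in no [faces P p]. *)
Definition face (n : nat) (P F : set 'rV[R]_n) : Prop :=
  exists (a : 'rV[R]_n) (b : R),
    (forall x, P x -> \sum_j a 0 j * x 0 j <= b) /\
    F = [set x | P x /\ \sum_j a 0 j * x 0 j = b].

Definition faces (n : nat) (P : set 'rV[R]_n) (p : nat) :
    set (set 'rV[R]_n) :=
  [set F | face P F /\ has_dim F p].

Definition vertex (n : nat) (P : set 'rV[R]_n) (v : 'rV[R]_n) : Prop :=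
  face P [set v].

Definition lattice_polytope (n : nat) (P : set 'rV[R]_n) : Prop :=
  polytope P /\ forall v, vertex P v -> integral_points v.

(* To be used together with [has_dim P n]. *)
Definition simple_polytope (n : nat) (P : set 'rV[R]_n) : Prop :=
  forall v, vertex P v -> ([set E | faces P 1 E /\ E v] #= `I_n)%card.

Definition box (p : nat) (a b : 'rV[R]_p) : set 'rV[R]_p :=
  [set x | forall j, a 0 j <= x 0 j <= b 0 j].

(* Lebesgue outer measure on R^p, hence Lebesgue measure on polytopes. Covers
   are indexed by an arbitrary [D : set nat] so that finite ones are allowed:
   for p = 0 every box has volume 1. *)
Definition lebesgue_volume (p : nat) (A : set 'rV[R]_p) : \bar R :=
  ereal_inf [set s | exists (D : set nat) (a b : nat -> 'rV[R]_p),
    [/\ forall k j, a k 0 j <= b k 0 j,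
        A `<=` \bigcup_(k in D) box (a k) (b k)
      & s = (\esum_(k in D) (\prod_j (b k 0 j - a k 0 j))%:E)%E]].

(* The rows of [B] are a Z-basis of the integral points of [direction F]. *)
Definition lattice_basis (n p : nat) (F : set 'rV[R]_n) (B : 'M[R]_(p, n)) :
    Prop :=
  row_free B /\
  direction F `&` @integral_points n = [set c *m B | c in @integral_points p].

(* Volume of the p-dimensional [F] in the coordinates [x0 + c *m B] on its
   affine span, with [x0] in [F] and [B] a lattice basis, so that a fundamental
   parallelepiped has volume p!. The result does not depend on the choices:
   two lattice bases differ by a matrix of GL_p(Z). *)
Definition lattice_volume (n p : nat) (F : set 'rV[R]_n) : R :=
  let x0 := xget 0 F in
  let B := xget 0 [set B : 'M[R]_(p, n) | lattice_basis F B] in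
  (p`!)%:R * fine (lebesgue_volume [set c : 'rV[R]_p | F (x0 + c *m B)]).

Definition dilate (n : nat) (t : nat) (S : set 'rV[R]_n) : set 'rV[R]_n :=
  [set t%:R *: x | x in S].

Definition interior_count (n : nat) (P : set 'rV[R]_n) (p i : nat) : nat :=
  (\sum_(F \in faces P p) lattice_count (relint (dilate i F)))%N.

Definition c_invariant (n : nat) (P : set 'rV[R]_n) : R :=
  \sum_(0 <= p < n.+1)
    (-1) ^+ (n - p) * (p + 1)%:R * \sum_(F \in faces P p) lattice_volume p F.

End LatticePolytopes.

(* Main.v *)
(* Counting lattice points of the dilates of the faces gives polynomials
   E_p(t), the sum of the Ehrhart polynomials of the p-faces. Their coefficients
   of t^p are the volumes over p!, and reciprocity says that E_p(-i) is
   (-1)^p I_p(i). As every k-face of a simple polytope lies in C(n-k, p-k)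
   p-faces, E_p(i) is also the sum over k of C(n-k, p-k) I_k(i). Since t E_p(t)
   has degree p+1, its difference of order p+1 over the points
   m, m-1, ..., m-p-1 is (p+1)! times its top coefficient. In the alternating
   sum over p, the points of one sign contribute I_p(i) directly by
   reciprocity, and those of the other sign collapse, by an identity for
   alternating sums of products of binomials, to the same values I_k(i).

   Ehrhart polynomials and reciprocity come from a triangulation into half-open
   simplicial cones: complementing a half-open parallelepiped by x -> 1 - x
   exchanges the two half-open versions. The triangulation is the set of
   optimal bases of a linear program with generic costs. *)
Require Import Defs.
From mathcomp Require Import all_boot all_order all_algebra finmap.
From mathcomp Require Import all_classical all_reals all_analysis.
From mathcomp Require Import ring lra zify.
Import Order.TTheory GRing.Theory Num.Theory.
Import numFieldNormedType.Exports.
Set Implicit Arguments.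
Unset Strict Implicit.
Unset Printing Implicit Defensive.
Local Open Scope ring_scope.

(** * Gordan's alternative and cones *)

Section Alternatives.
Variable R : realFieldType.

(** The obstacle in a triangulation is the boundary: simplicial cones overlap along facets, while
    the closed cone and its interior must be counted by the same cells. Both counts come from one
    generic direction [q]: points pushed towards [q] detect the closed cone, points pushed away from
    it detect the interior, and reversing the push exchanges kept and removed facets. Two generic
    choices are made. The costs turn every cell into a simplex, and [q] avoids finitely many
    hyperplanes that contain all spans of deficient rank. The volume is an infimum over coverings by
    boxes, so it is compared with lattice counts of large dilates: a covering bounds the counts from
    above, and cubes indexed by lattice points bound the volume from above. Both comparisons are
    inequalities between polynomials at large integers and leave only top coefficients. Simplicity
    enters at a vertex: exactly [n] edges means that the edge directions form a basis, so that every
    set of them spans a face. *)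

Lemma small_perturbation (I : finType) (f g : I -> R) : (forall i, 0 < f i) ->
  exists2 e, 0 < e & forall e', 0 <= e' <= e -> forall i, 0 < f i + e' * g i.
Proof.
move=> f_gt0; pose s := \sum_i `|g i| / f i.
have t_ge0 i : 0 <= `|g i| / f i by rewrite divr_ge0 // ltW.
have s_ge0 : 0 <= s by apply: sumr_ge0.
exists (1 + s)^-1; first by rewrite invr_gt0; lra.
move=> e /andP[e_ge0 le_e] i.
have le_s : `|g i| / f i <= s.
  by rewrite /s (bigD1 i) //= lerDl sumr_ge0.
have lt1 : `|g i| < f i * (1 + s).
  rewrite ler_pdivrMr // in le_s.
  have := f_gt0 i; rewrite mulrDr mulr1 [f i * s]mulrC; lra.
have le2 : e * `|g i| <= (1 + s)^-1 * `|g i| by rewrite ler_wpM2r.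
have lt3 : (1 + s)^-1 * `|g i| < f i by rewrite mulrC ltr_pdivrMr //; lra.
have : - (e * `|g i|) <= e * g i.
  by rewrite -mulrN ler_wpM2l // lerNl -normrN ler_norm.
lra.
Qed.

Lemma row_mul_colE n (x : 'rV[R]_n) (a : 'cV[R]_n) :
  (x *m a) 0 0 = \sum_j x 0 j * a j 0.
Proof. by rewrite mxE. Qed.

Lemma sumr_gt0_exists (I : finType) (f : I -> R) (i : I) :
  (forall i, 0 <= f i) -> 0 < f i -> 0 < \sum_i f i.
Proof.
by move=> f0 fi; rewrite (bigD1 i) //= ltr_pwDl // sumr_ge0.
Qed.

(* Gordan's alternative modulo the row space of [T]. *)
Lemma gordan_alternative n N k (U : 'M[R]_(N, n)) (T : 'M[R]_(k, n)) :
  (exists2 a : 'cV_n, T *m a = 0 & forall i, (U *m a) i 0 < 0) \/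
  (exists c : 'rV_N, [/\ forall i, 0 <= c 0 i, c != 0 & (c *m U <= T)%MS]).
Proof.
elim: N => [|N IH] in k U T *.
  by left; exists 0 => [|[]//]; rewrite mulmx0.
rewrite -[N.+1]/(1 + N)%N in U *.
rewrite -[U]vsubmxK; set u := usubmx U; set U' := dsubmx U.
case: (IH _ U' T) => [[a Ta Ua]|[c [c0 c1 cU]]]; last first.
  right; exists (row_mx 0 c); split.
  - by move=> i; rewrite mxE; case: splitP => j _ //; rewrite mxE.
  - apply: contra c1 => /eqP H; apply/eqP.
    by rewrite -[c](row_mxKr (0 : 'M[R]_(1, 1))) H linear0.
  - by rewrite mul_row_col mul0mx add0r.
have [ua|ua] := ltP ((u *m a) 0 0) 0.
  left; exists a => // i; rewrite mul_col_mx mxE; case: splitP => j _ //.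
  by rewrite ord1.
have [uT|uT] := boolP (u <= T)%MS.
  right; exists (row_mx 1%:M 0); split.
  - by move=> i; rewrite mxE; case: splitP => j _; rewrite !mxE // ler0n.
  - apply/eqP => /(congr1 lsubmx); rewrite row_mxKl => /matrixP/(_ 0 0).
    by rewrite !mxE eqxx; apply/eqP; rewrite oner_eq0.
  - by rewrite mul_row_col mul1mx mul0mx addr0.
have [b Tb ub] : exists2 b : 'cV_n, T *m b = 0 & (u *m b) 0 0 < 0.
  move: uT; rewrite submxE => /rV0Pn[j uj].
  have Tc : T *m col j (cokermx T) = 0.
    by rewrite colE mulmxA mulmx_coker mul0mx.
  have uc : (u *m col j (cokermx T)) 0 0 = (u *m cokermx T) 0 j.
    by rewrite colE mulmxA -colE mxE.
  have [lt0|gt0] := ltP ((u *m cokermx T) 0 j) 0.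
    by exists (col j (cokermx T)) => //; rewrite uc.
  exists (- col j (cokermx T)); first by rewrite mulmxN Tc oppr0.
  by rewrite mulmxN mxE uc oppr_lt0 lt_def uj.
(* With [u] among the equations, a solution [a'] has value 0 under [u], and a small multiple of [b]
   makes that sign strict without spoiling the others. Otherwise [c *m U'] is a multiple [d] of [u]
   modulo [T], and the sign of [d] decides. *)
case: (IH _ U' (col_mx u T)) => [[a' /eqP]|[c [c0 c1]]].
  rewrite mul_col_mx col_mx_eq0 => /andP[/eqP ua' /eqP Ta'] Ua'.
  have [e e0 He] := @small_perturbation _ (fun i => - (U' *m a') i 0)
    (fun i => - (U' *m b) i 0) (fun i => etrans (oppr_gt0 _) (Ua' i)).
  left; exists (a' + e *: b).
    by rewrite mulmxDr -scalemxAr Tb Ta' scaler0 addr0.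
  move=> i; rewrite mul_col_mx mxE; case: splitP => j _.
    rewrite ord1 mulmxDr -scalemxAr ua' add0r mxE.
    by rewrite pmulr_rlt0.
  have := He e; rewrite lexx ltW // => /(_ isT j).
  by rewrite mulmxDr -scalemxAr !mxE; lra.
rewrite -addsmxE => /sub_addsmxP[[d x] /= E].
have Ed : d = (d 0 0)%:M by apply/matrixP=> i j; rewrite !ord1 mxE.
have [d0|d0] := leP (d 0 0) 0.
  right; exists (row_mx (- d) c); split.
  - move=> i; rewrite mxE; case: splitP => j _ //.
    by rewrite !ord1 mxE oppr_ge0.
  - apply: contra c1 => /eqP H; apply/eqP.
    by rewrite -[c](row_mxKr (- d)) H linear0.
  - rewrite mul_row_col E mulNmx addrA addNr add0r submxMl //.
(* A positive [d] is impossible: at [a] the right side is nonnegative, as [u] is, while the left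
   side is a nonzero nonnegative combination of negative numbers. *)
have /(congr1 (fun m => (m *m a) 0 0)) := E.
rewrite mulmxDl -!mulmxA Ta mulmx0 addr0 Ed mul_scalar_mx [RHS]mxE => F.
have : 0 <= (c *m (U' *m a)) 0 0 by rewrite F mulr_ge0 // ltW.
case/rV0Pn: c1 => j cj; rewrite leNgt; case/negP.
rewrite row_mul_colE -oppr_gt0 -sumrN.
apply: (@sumr_gt0_exists _ _ j) => [i|]; rewrite -mulrN.
  by rewrite mulr_ge0 // oppr_ge0 ltW.
by rewrite mulr_gt0 ?oppr_gt0 // lt_def cj c0.
Qed.

Definition supported N (J : {set 'I_N}) (c : 'rV[R]_N) :=
  forall i, i \notin J -> c 0 i = 0.

Definition nonneg N (c : 'rV[R]_N) := forall i, 0 <= c 0 i.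

(** Keeping zero rows gives all subsets [J] the same matrix type; the row space of [mask J *m G] is
    the span of the rows of [G] indexed by [J]. *)
Definition mask N (J : {set 'I_N}) : 'M[R]_N :=
  diag_mx (\row_i (i \in J)%:R).

Definition cone_on n N (G : 'M[R]_(N, n)) (J : {set 'I_N}) (x : 'rV[R]_n) :=
  exists c, [/\ nonneg c, supported J c & x = c *m G].

Lemma mul_mask N (J : {set 'I_N}) (c : 'rV[R]_N) i :
  (c *m mask J) 0 i = c 0 i * (i \in J)%:R.
Proof. by rewrite mul_mx_diag !mxE. Qed.

Lemma mask_supported N (J : {set 'I_N}) (c : 'rV[R]_N) :
  supported J (c *m mask J).
Proof. by move=> i /negPf iJ; rewrite mul_mask iJ mulr0. Qed.

Lemma supported_mask N (J : {set 'I_N}) (c : 'rV[R]_N) :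
  supported J c -> c *m mask J = c.
Proof.
move=> cJ; apply/rowP => i; rewrite mul_mask.
by have [|/cJ->] := boolP (i \in J); rewrite ?mulr1 ?mulr0.
Qed.

Lemma submx_maskP n N (G : 'M[R]_(N, n)) (J : {set 'I_N}) (x : 'rV[R]_n) :
  reflect (exists2 c, supported J c & x = c *m G) (x <= mask J *m G)%MS.
Proof.
apply: (iffP submxP) => [[c ->]|[c cJ ->]].
  by exists (c *m mask J); [exact: mask_supported|rewrite mulmxA].
by exists c; rewrite mulmxA supported_mask.
Qed.

Lemma mask_mul n N (J : {set 'I_N}) (A : 'M[R]_(N, n)) i j :
  (mask J *m A) i j = (i \in J)%:R * A i j.
Proof. by rewrite mul_diag_mx mxE mxE. Qed.

Lemma mask_mul_eq0 n N (G : 'M[R]_(N, n)) (J : {set 'I_N}) (a : 'cV[R]_n) :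
  mask J *m G *m a = 0 <-> forall i, i \in J -> (G *m a) i 0 = 0.
Proof.
rewrite -mulmxA; split => [E i iJ|E].
  by have /matrixP/(_ i 0) := E; rewrite mask_mul iJ mul1r => ->; rewrite mxE.
apply/matrixP => i j; rewrite ord1 mask_mul [RHS]mxE.
by have [/E->|_] := boolP (i \in J); rewrite ?mulr0 ?mul0r.
Qed.

Lemma supported_mul N n (c : 'rV[R]_N) (J : {set 'I_N}) (G : 'M[R]_(N, n))
    (a : 'cV[R]_n) : supported J c ->
  (c *m G *m a) 0 0 = \sum_(i in J) c 0 i * (G *m a) i 0.
Proof.
move=> cJ; rewrite -mulmxA row_mul_colE [LHS](bigID (mem J)) /=.
by rewrite [X in _ + X]big1 ?addr0 // => i /cJ->; rewrite mul0r.
Qed.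

Lemma supported_row1 N n (G : 'M[R]_(N, n)) i (c : 'rV[R]_N) :
  supported [set i] c -> c *m G = c 0 i *: row i G.
Proof.
move=> ci; rewrite mulmx_sum_row (bigD1 i) //= big1 ?addr0 // => j ji.
by rewrite ci ?inE // scale0r.
Qed.

(** The source of supporting hyperplanes: the form has to vanish on the generators in [J] and be
    negative on those in [A], and the obstruction is a relation among the generators. *)
Lemma gordan_set n N (G : 'M[R]_(N, n)) (A J : {set 'I_N}) :
  (exists2 a : 'cV_n, (forall i, i \in J -> (G *m a) i 0 = 0)
                    & (forall i, i \in A -> (G *m a) i 0 < 0)) \/
  (exists c d : 'rV_N, [/\ nonneg c, supported A c, c != 0, supported J d
                         & c *m G = d *m G]).
Proof.
case: (gordan_alternative (rowsub (@enum_val _ (mem A)) G) (mask J *m G)).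
  move=> [a /mask_mul_eq0 Ja Aa]; left; exists a => // i iA.
  suff <- : (rowsub (@enum_val _ (mem A)) G *m a) (enum_rank_in iA i) 0
    = (G *m a) i 0 by exact: Aa.
  by rewrite !mxE; apply: eq_bigr => j _; rewrite mxE enum_rankK_in.
move=> [c [c0 c1]]; rewrite rowsubE mulmxA => /submx_maskP[d dJ E]; right.
have cE i : (c *m rowsub (@enum_val _ (mem A)) 1%:M) 0 i =
    \sum_j c 0 j * (enum_val j == i)%:R.
  by rewrite mxE; apply: eq_bigr => j _; rewrite !mxE.
exists (c *m rowsub (@enum_val _ (mem A)) 1%:M), d; split => //.
- by move=> i; rewrite cE; apply: sumr_ge0 => j _; rewrite mulr_ge0 ?ler0n.
- move=> i iA; rewrite cE big1 // => j _; case: eqP => [ji|_]; rewrite ?mulr0 //.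
  by rewrite -ji enum_valP in iA.
- case/rV0Pn: c1 => j cj; apply/rV0Pn; exists (enum_val j); rewrite cE.
  rewrite (bigD1 j) //= eqxx mulr1 big1 ?addr0 // => k kj.
  by rewrite (inj_eq enum_val_inj) (negPf kj) mulr0.
Qed.

Lemma sum_nonneg_gt0 N (c : 'rV[R]_N) (A : {set 'I_N}) (f : 'I_N -> R) :
  nonneg c -> supported A c -> c != 0 -> (forall i, i \in A -> 0 < f i) ->
  0 < \sum_(i in A) c 0 i * f i.
Proof.
move=> c0 cA /rV0Pn[i ci] fA.
have iA : i \in A by apply: contraNT ci => /cA->.
rewrite (bigD1 i) //= ltr_pwDl ?mulr_gt0 ?fA //.
  by rewrite lt_def ci c0.
by apply: sumr_ge0 => j /andP[jA _]; rewrite mulr_ge0 // ltW // fA.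
Qed.

(** An inclusion-minimal generating set works. If no form exposed [i], some nonnegative combination
    of the other generators would be a multiple of [row i G]; evaluating [h], which is positive on
    all generators, shows that this multiple is positive, so [i] could be dropped. *)
Lemma minimal_generators n N (G : 'M[R]_(N, n)) (D : {set 'I_N}) (h : 'cV_n) :
  (forall i, i \in D -> 0 < (G *m h) i 0) ->
  exists I : {set 'I_N}, [/\ I \subset D,
    forall j, j \in D -> cone_on G I (row j G) &
    forall i, i \in I -> exists2 a : 'cV_n, (G *m a) i 0 = 0 &
      forall j, j \in I -> j != i -> (G *m a) j 0 < 0].
Proof.
move=> h0.
pose P (I : {set 'I_N}) := (I \subset D) && `[< forall j, j \in D -> cone_on G I (row j G) >].
have PD : P D.
  rewrite /P subxx; apply/asboolP => j jD; exists (delta_mx 0 j); split.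
  - by move=> i; rewrite mxE /= ler0n.
  - move=> i iD; rewrite mxE /=; case: eqP => // ij.
    by rewrite ij jD in iD.
  - by rewrite rowE.
have [I minI ID] := minset_exists PD; exists I.
have /andP[_ /asboolP gI] := minsetp minI; split => // i iI.
case: (gordan_set G (I :\ i) [set i]) => [[a ai aI]|].
  exists a => [|j jI ji]; first by apply: ai; rewrite inE.
  by apply: aI; rewrite !inE ji.
move=> [c [d [c0 cA c1 di E]]].
have sub : I :\ i \subset D by exact: (fintype.subset_trans (finset.subsetDl _ _) ID).
have: 0 < (c *m G *m h) 0 0.
  rewrite (supported_mul _ _ cA) sum_nonneg_gt0 // => j /(fintype.subsetP sub); exact: h0.
rewrite E (supported_mul _ _ di) big_set1 pmulr_lgt0; last first.
  by apply: h0; exact: (fintype.subsetP ID).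
move=> d0; suff PI : P (I :\ i).
  have /setP/(_ i) := minsetinf minI PI (finset.subsetDl _ _).
  by rewrite !inE eqxx iI.
rewrite /P sub; apply/asboolP => j /gI[b [b0 bI bE]].
exists (b - b 0 i *: delta_mx 0 i + (b 0 i / d 0 i) *: c); split.
- move=> k; rewrite !mxE /=; have [->|_] := eqVneq k i.
    by rewrite mulr1 subrr add0r mulr_ge0 // divr_ge0 // ltW.
  by rewrite mulr0 subr0 addr_ge0 // mulr_ge0 // divr_ge0 // ltW.
- move=> k kI; rewrite !mxE /= (cA k kI) mulr0 addr0.
  move: kI; rewrite !inE; have [->|_] := eqVneq k i; first by rewrite mulr1 subrr.
  by move/bI->; rewrite mulr0 subr0.
- rewrite bE mulmxDl mulmxBl -!scalemxAl -rowE E (supported_row1 _ di).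
  by rewrite scalerA mulfVK ?gt_eqF // subrK.
Qed.

Lemma generic_positive_vector N (s : seq 'rV[R]_N) : (forall a, a \in s -> a != 0) ->
  exists2 w : 'cV[R]_N, (forall i, 0 < w i 0)
    & forall a, a \in s -> (a *m w) 0 0 != 0.
Proof.
move=> s0; pose p := \prod_(a <- s) rVpoly a.
have p0 : p != 0.
  rewrite /p; elim: s s0 {p} => [|a s IH] s0; first by rewrite big_nil oner_eq0.
  rewrite big_cons mulf_neq0 ?IH // => [|b bs]; last by rewrite s0 // inE bs orbT.
  apply: contra (s0 a (mem_head _ _)) => /eqP a0.
  by rewrite -[a]rVpolyK a0 linear0.
have [x [x0 px]] : exists x : R, 0 < x /\ ~~ root p x.
  apply: contrapT => /forallNP H.
  pose r : seq R := [seq i.+1%:R | i <- iota 0 (size p)].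
  have ur : uniq r.
    rewrite map_inj_uniq ?iota_uniq // => i j /eqP.
    by rewrite eqr_nat eqSS => /eqP.
  have rr : all (root p) r.
    apply/allP => _ /mapP[i _ ->]; apply: contrapT => /negP nr.
    by apply: (H i.+1%:R); split.
  by have := max_poly_roots p0 rr ur; rewrite size_map size_iota ltnn.
(* On the moment curve a nonzero linear form is a nonzero polynomial in [x]. *)
exists (\col_i x ^+ i) => [i|a as_]; first by rewrite mxE exprn_gt0.
have -> : (a *m \col_i x ^+ i) 0 0 = (rVpoly a).[x].
  rewrite row_mul_colE (horner_coef_wide _ (size_poly _ _)).
  by apply: eq_bigr => i _; rewrite coef_rVpoly_ord mxE.
apply: contra px => /eqP ax; rewrite rootE /p horner_prod (big_rem a) //= ax.
by rewrite mul0r.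
Qed.

(** Ties [a i = 0] are broken by the sign of [b i]. This is the origin of the rule by which a
    half-open cone keeps or drops a facet. *)
Lemma sign_perturbation (I : finType) (a b : I -> R) : (forall i, b i != 0) ->
  exists2 e, 0 < e & forall e', 0 < e' <= e -> forall i,
    a i + e' * b i != 0 /\
    (0 <= a i + e' * b i) = (0 < a i) || (a i == 0) && (0 < b i).
Proof.
move=> b0; pose f i := if a i == 0 then 1 else `|a i|.
have f0 i : 0 < f i by rewrite /f; case: eqP => [_|/eqP]; rewrite ?normr_gt0.
have [e e0 He] := @small_perturbation _ f (fun i => - `|b i|) f0.
exists e => // e' /andP[e'0 le_e] i.
have := He e'; rewrite ltW // le_e => /(_ isT i); rewrite /f.
have [->|ai] := eqVneq (a i) 0.
  move=> _; rewrite add0r pmulr_rge0 // ltxx le0r (negPf (b0 i)).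
  by split=> //; rewrite mulf_neq0 // gt_eqF.
rewrite mulrN -[X in X * `|_|]gtr0_norm // -normrM.
have := ler_norm (e' * b i); have := ler_norm (- (e' * b i)).
rewrite normrN orbF => H1 H2.
have [a0|a0] := ltP 0 (a i).
  rewrite [ `|a i| ]gtr0_norm // => H3; have H4 : 0 < a i + e' * b i by lra.
  by rewrite gt_eqF // ltW.
rewrite [ `|a i| ]ler0_norm // => H3; have H4 : a i + e' * b i < 0 by lra.
by rewrite lt_eqF // leNgt H4.
Qed.

Lemma mxrank_mask n N (G : 'M[R]_(N, n)) (J : {set 'I_N}) :
  (mask J *m G <= rowsub (@enum_val _ (mem J)) G)%MS.
Proof.
apply/row_subP => i; have [iJ|iJ] := boolP (i \in J).
  have <- : row (enum_rank_in iJ i) (rowsub (@enum_val _ (mem J)) G) =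
      row i (mask J *m G).
    apply/rowP => j; rewrite [RHS]mxE mask_mul iJ mul1r.
    by rewrite row_rowsub mxE enum_rankK_in.
  exact: row_sub.
suff -> : row i (mask J *m G) = 0 by exact: sub0mx.
by apply/rowP => j; rewrite mxE mask_mul (negPf iJ) mul0r mxE.
Qed.

(** * Coordinates in a basis of generators *)

Definition basis_at N d (V : 'M[R]_(N, d)) (J : {set 'I_N}) (f : 'I_d -> 'I_N) :=
  [/\ injective f, (f @: 'I_d)%SET = J & rowsub f V \in unitmx].

Section Basis.
Variables (N d : nat) (V : 'M[R]_(N, d)).

Lemma rank_basis (J : {set 'I_N}) : #|J| = d -> \rank (mask J *m V) = d ->
  exists f, basis_at V J f.
Proof.
move=> cJ rJ; exists (fun l => @enum_val _ (mem J) (cast_ord (esym cJ) l)); split.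
- by move=> l l' /enum_val_inj /cast_ord_inj.
- apply/setP => i; apply/imsetP/idP => [[l _ ->]|iJ]; first exact: enum_valP.
  exists (cast_ord cJ (enum_rank_in iJ i)); first by [].
  by rewrite cast_ordK enum_rankK_in.
- rewrite -row_full_unit /row_full -[X in _ == X]rJ.
  have sub : (rowsub (@enum_val _ (mem J)) V <=
     rowsub (fun l => @enum_val _ (mem J) (cast_ord (esym cJ) l)) V)%MS.
    apply/row_subP => i; rewrite row_rowsub -(cast_ordK cJ i).
    by rewrite -(row_rowsub (fun l => enum_val (cast_ord (esym cJ) l))) row_sub.
  have := mxrankS (submx_trans (mxrank_mask V J) sub).
  by rewrite eqn_leq rJ => ->; rewrite rank_leq_row.
Qed.

Variables (J : {set 'I_N}) (f : 'I_d -> 'I_N).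
Hypothesis Jf : basis_at V J f.

Lemma basis_mem l : f l \in J.
Proof. by case: Jf => _ <- _; apply/imsetP; exists l. Qed.

Lemma basis_mul_supported (c : 'rV[R]_N) : supported J c ->
  c *m V = colsub f c *m rowsub f V.
Proof.
case: Jf => injf <- _ cJ; rewrite !mulmx_sum_row.
rewrite (bigID (mem (f @: 'I_d)%SET)) /= [X in _ + X]big1 ?addr0.
  by rewrite big_imset /=; [apply: eq_bigr => l _; rewrite row_rowsub mxE|
    move=> ? ? _ _; exact: injf].
by move=> i /cJ->; rewrite scale0r.
Qed.

Lemma basis_coord (c : 'rV[R]_N) : supported J c ->
  colsub f c = (c *m V) *m invmx (rowsub f V).
Proof. by case: Jf => _ _ u cJ; rewrite basis_mul_supported // mulmxK. Qed.

Lemma basis_supported_inj (c c' : 'rV[R]_N) : supported J c -> supported J c' ->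
  c *m V = c' *m V -> c = c'.
Proof.
move=> cJ cJ' E; apply/rowP => i; have [iJ|iJ] := boolP (i \in J); last first.
  by rewrite cJ // cJ'.
move: iJ; case: (Jf) => _ <- _ /imsetP[l _ ->].
have := basis_coord cJ; rewrite E -basis_coord // => /rowP/(_ l).
by rewrite !mxE.
Qed.

Lemma basis_expand (a : 'rV[R]_d) :
  exists c, [/\ supported J c, colsub f c = a & c *m V = a *m rowsub f V].
Proof.
case: (Jf) => injf imf _; exists (a *m rowsub f 1%:M).
have E i : (a *m rowsub f 1%:M) 0 i = \sum_l a 0 l * (f l == i)%:R.
  by rewrite mxE; apply: eq_bigr => l _; rewrite !mxE.
split; last by rewrite -mulmxA -rowsubE.
- move=> i; rewrite -imf => iJ; rewrite E big1 // => l _.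
  by case: eqP => [fl|]; rewrite ?mulr0 //; case/imsetP: iJ; exists l.
- apply/rowP => l; rewrite mxE E (bigD1 l) //= eqxx mulr1 big1 ?addr0 // => k kl.
  by rewrite (inj_eq injf) (negPf kl) mulr0.
Qed.

Lemma basis_coneP (x : 'rV[R]_d) :
  cone_on V J x <-> forall l, 0 <= (x *m invmx (rowsub f V)) 0 l.
Proof.
split=> [[c [c0 cJ ->]] l|x0]; first by rewrite -basis_coord // mxE.
have [c [cJ ca cV]] := basis_expand (x *m invmx (rowsub f V)).
exists c; split => //; last by rewrite cV mulmxKV //; case: Jf.
move=> i; have [iJ|/cJ->//] := boolP (i \in J).
move: iJ; case: (Jf) => _ <- _ /imsetP[l _ ->].
by have /rowP/(_ l) := ca; rewrite mxE => ->.
Qed.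

End Basis.

End Alternatives.

(** * Half-open triangulation of a cone *)

Section Triangulation.
Variables (R : realFieldType) (N d : nat) (V : 'M[R]_(N, d)) (h : 'cV[R]_d).
Hypothesis Vh : forall i, (V *m h) i 0 = 1.
Hypothesis rankV : \rank V = d.

(** A proper subspace lies in a hyperplane. One normal for each of the finitely many subsets turns
    genericity into finitely many nonvanishing conditions. *)
Lemma degenerate_normals : exists nrm : {set 'I_N} -> 'cV[R]_d, forall J,
  (\rank (mask R J *m V) < d)%N ->
  nrm J != 0 /\ mask R J *m V *m nrm J = 0.
Proof.
suff /choice[f Hf] : forall J, exists a : 'cV[R]_d,
    (\rank (mask R J *m V) < d)%N -> a != 0 /\ mask R J *m V *m a = 0.
  by exists f.
move=> J; have [_|lt_J] := leqP d (\rank (mask R J *m V)).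
  by exists 0.
have : cokermx (mask R J *m V) != 0.
  by rewrite -mxrank_eq0 mxrank_coker subn_eq0 -ltnNge.
case/matrix0Pn => i [j cij]; exists (col j (cokermx (mask R J *m V))) => _.
split; last by rewrite colE mulmxA mulmx_coker mul0mx.
by apply/matrix0Pn; exists i, 0; rewrite mxE.
Qed.

Variable nrm : {set 'I_N} -> 'cV[R]_d.
Hypothesis nrmP : forall J, (\rank (mask R J *m V) < d)%N ->
  nrm J != 0 /\ mask R J *m V *m nrm J = 0.

Definition generic (z : 'rV[R]_d) := forall J : {set 'I_N},
  (\rank (mask R J *m V) < d)%N -> (z *m nrm J) 0 0 != 0.

Lemma generic_rank z (J : {set 'I_N}) c : generic z -> supported J c ->
  z = c *m V -> \rank (mask R J *m V) = d.
Proof.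
move=> gz cJ zE; apply/eqP; rewrite eqn_leq rank_leq_col leqNgt /=.
apply/negP => lt_d; have := gz J lt_d; have [_ E] := nrmP lt_d.
by rewrite zE -[c](supported_mask cJ) -(mulmxA c) -mulmxA E mulmx0 mxE eqxx.
Qed.

Lemma rank_mask_leq (J : {set 'I_N}) : (\rank (mask R J *m V) <= #|J|)%N.
Proof. exact: leq_trans (mxrankS (mxrank_mask V J)) (rank_leq_row _). Qed.

Lemma generic_basis z (J : {set 'I_N}) c : generic z -> #|J| = d ->
  supported J c -> z = c *m V -> exists f, basis_at V J f.
Proof.
by move=> gz cd cJ zE; apply: rank_basis => //; exact: (generic_rank gz cJ zE).
Qed.

(** A vanishing coordinate would place [z] in the span of [d - 1] generators. *)
Lemma generic_coord_neq0 z (J : {set 'I_N}) c : generic z -> #|J| = d ->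
  supported J c -> z = c *m V -> forall i, i \in J -> c 0 i != 0.
Proof.
move=> gz cd cJ zE i iJ; apply/negP => /eqP ci.
have cJi : supported (J :\ i) c.
  move=> j; rewrite !inE negb_and negbK => /orP[/eqP->//|]; exact: cJ.
have := rank_mask_leq (J :\ i); rewrite (generic_rank gz cJi zE).
by move: cd; rewrite (cardsD1 i) iJ => <-; rewrite ltnn.
Qed.

Lemma generic_interior : exists2 c : 'rV[R]_N,
  (forall i, 0 < c 0 i) & generic (c *m V).
Proof.
pose s := [seq (V *m nrm J)^T | J <- enum {set 'I_N} &
             (\rank (mask R J *m V) < d)%N].
have [a|w w0 Hw] := @generic_positive_vector _ _ s.
  case/mapP => J; rewrite mem_filter => /andP[lt_d _] ->.
  rewrite trmx_eq0; have [n0 _] := nrmP lt_d; apply: contra n0 => /eqP E.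
  have fV : row_full V by rewrite /row_full rankV.
  by rewrite -[nrm J]mul1mx -(mulVpmx fV) -mulmxA E mulmx0.
exists w^T => [i|J lt_d]; first by rewrite mxE.
have /Hw : (V *m nrm J)^T \in s.
  by apply: (map_f (fun J => (V *m nrm J)^T)); rewrite mem_filter lt_d mem_enum.
apply: contra => /eqP E; apply/eqP; rewrite -[RHS]E.
suff -> : (V *m nrm J)^T *m w = (w^T *m V *m nrm J)^T by rewrite mxE.
by rewrite -mulmxA [RHS]trmx_mul trmxK.
Qed.

Lemma exists_row_neq0 m n (A : 'M[R]_(m, n)) : ~~ row_free A ->
  exists2 u : 'rV_m, u != 0 & u *m A = 0.
Proof.
rewrite -kermx_eq0 => /rowV0Pn[u uk u0]; exists u => //.
exact/sub_kermxP.
Qed.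

Definition feasible z (J : {set 'I_N}) := #|J| = d /\ cone_on V J z.

(** Carathéodory's argument. If the rows of a minimal support were dependent, moving along the
    dependency would remove an index. Since [h] is 1 on every row, the coefficients of the
    dependency sum to 0, so one of them is positive and the ratio test applies. *)
Lemma generic_feasible z : generic z -> cone_on V [set: 'I_N]%SET z ->
  exists J, feasible z J.
Proof.
move=> gz zT; pose P (J : {set 'I_N}) := `[< cone_on V J z >].
have PT : P [set: 'I_N]%SET by apply/asboolP.
have [J minJ _] := minset_exists PT; exists J.
have /asboolP[c [c0 cJ zE]] := minsetp minJ.
split; last by exists c.
apply/eqP; rewrite eqn_leq -{2}(generic_rank gz cJ zE) rank_mask_leq andbT.
rewrite leqNgt; apply/negP => lt_d.
have [|u u0 uV] := @exists_row_neq0 _ _ (rowsub (@enum_val _ (mem J)) V).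
  by rewrite /row_free ltn_eqF // (leq_ltn_trans (rank_leq_col _)).
pose e : 'rV_N := u *m rowsub (@enum_val _ (mem J)) 1%:M.
have eE i : e 0 i = \sum_j u 0 j * (enum_val j == i)%:R.
  by rewrite mxE; apply: eq_bigr => j _; rewrite !mxE.
have eV : e *m V = 0 by rewrite /e -mulmxA -rowsubE.
clearbody e.
have eJ : supported J e.
  move=> i iJ; rewrite eE big1 // => j _; case: eqP => [ji|_]; rewrite ?mulr0 //.
  by rewrite -ji enum_valP in iJ.
have e0 : e != 0.
  case/rV0Pn: u0 => j uj; apply/rV0Pn; exists (enum_val j); rewrite eE.
  rewrite (bigD1 j) //= eqxx mulr1 big1 ?addr0 // => k kj.
  by rewrite (inj_eq enum_val_inj) (negPf kj) mulr0.
have sum_e : \sum_i e 0 i = 0.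
  have := congr1 (fun m => (m *m h) 0 0) eV; rewrite mul0mx [RHS]mxE -mulmxA.
  by rewrite row_mul_colE => E; rewrite -[RHS]E; apply: eq_bigr => i _; rewrite Vh mulr1.
have [k ek] : exists k, 0 < e 0 k.
  apply: contrapT => /forallNP H; case/rV0Pn: e0 => i; case/eqP.
  have le0 j : true -> 0 <= - e 0 j.
    by move=> _; rewrite oppr_ge0 leNgt; apply/negP/H.
  have /psumr_eq0P : \sum_i - e 0 i = 0 by rewrite sumrN sum_e oppr0.
  by move=> /(_ le0 i isT) /eqP; rewrite oppr_eq0 => /eqP.
have [l el minl] := @arg_minP _ _ _ k (fun i => 0 < e 0 i)
  (fun i => c 0 i / e 0 i) ek.
pose t := c 0 l / e 0 l.
have t0 : 0 <= t by rewrite divr_ge0 // ltW.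
have PJ : P (J :\ l).
  apply/asboolP; exists (c - t *: e); split.
  - move=> i; rewrite !mxE subr_ge0; have [ei|ei] := ltP 0 (e 0 i).
      by rewrite -ler_pdivlMr //; exact: minl.
    by apply: (le_trans _ (c0 i)); rewrite mulr_ge0_le0.
  - move=> i; rewrite !inE negb_and negbK !mxE => /orP[/eqP->|iJ].
      by rewrite divfK ?subrr // gt_eqF.
    by rewrite cJ // eJ // mulr0 subr0.
  - by rewrite mulmxBl -scalemxAl eV scaler0 subr0.
have := minsetinf minJ PJ (finset.subsetDl _ _) => /setP/(_ l).
rewrite !inE eqxx /= => lJ; have := eJ l; rewrite -lJ => /(_ isT) el0.
by rewrite el0 ltxx in el.
Qed.

Variable w : 'cV[R]_N.

(** Lift generator [i] to height [w i]: [y] is a hyperplane that touches the lifted generators from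
    below exactly over [J]. The condition does not involve the point to be represented, so the same
    bases triangulate the whole cone, as a regular triangulation. *)
Definition dual_feasible (J : {set 'I_N}) := exists y : 'cV[R]_d,
  (forall i, i \in J -> (V *m y) i 0 = w i 0) /\
  (forall i, i \notin J -> (V *m y) i 0 < w i 0).

Lemma dual_optimal z (J : {set 'I_N}) (y : 'cV[R]_d) c : supported J c ->
  z = c *m V -> (forall i, i \in J -> (V *m y) i 0 = w i 0) ->
  (z *m y) 0 0 = (c *m w) 0 0.
Proof.
move=> cJ zE yJ; rewrite zE -mulmxA !row_mul_colE; apply: eq_bigr => i _.
by have [/yJ->|/cJ->] := boolP (i \in J); rewrite ?mul0r.
Qed.

Lemma dual_feasible_le (J : {set 'I_N}) (y : 'cV[R]_d) :
  (forall i, i \in J -> (V *m y) i 0 = w i 0) ->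
  (forall i, i \notin J -> (V *m y) i 0 < w i 0) ->
  forall i, (V *m y) i 0 <= w i 0.
Proof. by move=> E L i; have [/E->//|/L/ltW] := boolP (i \in J). Qed.

(** Complementary slackness: both bases attain the same optimal cost, so the coefficients of one
    vanish wherever the dual solution of the other is not tight; genericity makes them positive on
    their whole basis. *)
Lemma dual_feasible_uniq z (J J' : {set 'I_N}) : generic z ->
  dual_feasible J -> dual_feasible J' -> feasible z J -> feasible z J' ->
  J = J'.
Proof.
wlog suff H : J J' / generic z ->
  dual_feasible J -> dual_feasible J' -> feasible z J -> feasible z J' ->
  J' \subset J.
  move=> gz dJ dJ' fJ fJ'; apply/eqP.
  by rewrite finset.eqEsubset !H.
move=> gz [y [yJ yN]] [y' [yJ' yN']] [cJ [c [c0 cs zE]]] [cJ' [c' [c0' cs' zE']]].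
have le1 := dual_feasible_le yJ yN; have le1' := dual_feasible_le yJ' yN'.
have le2 (e : 'rV[R]_N) (v : 'cV[R]_d) : nonneg e -> (forall i, (V *m v) i 0 <= w i 0) ->
    (e *m V *m v) 0 0 <= (e *m w) 0 0.
  move=> e0 Hv; rewrite -mulmxA !row_mul_colE; apply: ler_sum => i _.
  by rewrite ler_wpM2l.
have E : (c' *m V *m y) 0 0 = (c' *m w) 0 0.
  apply/eqP; rewrite eq_le le2 //= -zE' (dual_optimal cs zE yJ).
  by rewrite -(dual_optimal cs' zE' yJ') zE le2.
apply/fintype.subsetP => i iJ'; apply/negPn/negP => iJ.
have ci' : 0 < c' 0 i.
  by rewrite lt_def c0' (generic_coord_neq0 gz cJ' cs' zE').
have : 0 < \sum_i c' 0 i * (w i 0 - (V *m y) i 0).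
  apply: (@sumr_gt0_exists _ _ _ i) => [j|]; first by rewrite mulr_ge0 // subr_ge0.
  by rewrite mulr_gt0 // subr_gt0 yN.
under eq_bigr => j _ do rewrite mulrBr.
by rewrite sumrB -!row_mul_colE mulmxA E subrr ltxx.
Qed.

(** No generator outside a basis is tight for the dual solution of that basis, so the cells of the
    lifting are simplices. *)
Definition generic_weights := forall (J : {set 'I_N}) f, basis_at V J f ->
  forall j, j \notin J -> forall a : 'rV[R]_N, supported J a ->
  a *m V = row j V -> (a *m w) 0 0 != w j 0.

(* A feasible basis of minimal cost is dual feasible: otherwise a simplex pivot
   would decrease the cost. *)
Lemma dual_feasible_exists z : generic_weights -> generic z ->
  cone_on V [set: 'I_N]%SET z ->
  exists J, feasible z J /\ dual_feasible J.
Proof.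
move=> gw gz zT.
pose rep J := [set c : 'rV[R]_N | [/\ nonneg c, supported J c & z = c *m V]]%classic.
pose cost J := (xget 0 (rep J) *m w) 0 0.
have repP J : feasible z J -> rep J (xget 0 (rep J)).
  by move=> [_ [c Hc]]; exact: (@xgetPex _ 0 (rep J) (ex_intro _ c Hc)).
have costE J c : feasible z J -> rep J c -> cost J = (c *m w) 0 0.
  move=> fJ [c0 cJ zE]; have [_ cJ' zE'] := repP J fJ.
  have [f Jf] := generic_basis gz fJ.1 cJ zE.
  by rewrite /cost (basis_supported_inj Jf cJ' cJ) // -zE' -zE.
have [J0 fJ0] := generic_feasible gz zT.
have [J /asboolP fJ minJ] := @arg_minP _ _ _ J0 (fun J => `[< feasible z J >])
  cost (asboolT fJ0).
exists J; split => //.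
have [c0 cJ zE] := repP J fJ; move: c0 cJ zE (costE J _ fJ (repP J fJ)).
move: (xget _ _) => c c0 cJ zE costc.
have [f Jf] := generic_basis gz fJ.1 cJ zE; have [injf imf uf] := Jf.
pose y := invmx (rowsub f V) *m rowsub f w.
have yJ i : i \in J -> (V *m y) i 0 = w i 0.
  rewrite -imf => /imsetP[l _ ->].
  have : rowsub f V *m y = rowsub f w by rewrite mulKVmx.
  by rewrite mul_rowsub_mx => /matrixP/(_ l 0); rewrite !mxE.
clearbody y; exists y; split => // j jJ; rewrite ltNge; apply/negP => le_wj.
have [a [aJ _]] := basis_expand Jf (row j V *m invmx (rowsub f V)).
rewrite mulmxKV // => aV.
have aw : (a *m w) 0 0 = (V *m y) j 0.
  by rewrite -(dual_optimal aJ (esym aV) yJ) -row_mul mxE.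
have lt_wj : w j 0 < (a *m w) 0 0.
  by rewrite lt_def (gw _ _ Jf) //= aw.
(* All rows have value 1 under [h], so the coefficients of [row j V] sum to 1 and one of them is
   positive: some index can leave the basis. *)
have sum_a : \sum_i a 0 i = 1.
  have := congr1 (fun m => (m *m h) 0 0) aV.
  rewrite -row_mul [RHS]mxE Vh -mulmxA row_mul_colE => E; rewrite -[RHS]E.
  by apply: eq_bigr => i _; rewrite Vh mulr1.
have [k ak] : exists k, 0 < a 0 k.
  apply: contrapT => /forallNP H.
  have : \sum_i a 0 i <= 0.
    by apply: sumr_le0 => i _; rewrite leNgt; apply/negP/H.
  by rewrite sum_a ler10.
have [l al minl] := @arg_minP _ _ _ k (fun i => 0 < a 0 i)
  (fun i => c 0 i / a 0 i) ak.
have lJ : l \in J by apply: contraTT al => /aJ->; rewrite ltxx.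
have lj : l != j by apply: contraTneq lJ => ->.
pose t := c 0 l / a 0 l.
have t0 : 0 < t.
  by rewrite divr_gt0 // lt_def c0 (generic_coord_neq0 gz fJ.1 cJ zE).
pose J' := j |: (J :\ l).
(* The pivot trades [t] times the expansion [a] of [row j V] for [t] times the row itself. The ratio
   [t] is the largest that keeps the coefficients nonnegative, and it removes [l]. *)
pose c' := c - t *: a + t *: delta_mx 0 j.
have c'V : z = c' *m V.
  by rewrite mulmxDl mulmxBl -!scalemxAl aV -rowE subrK.
have rc' : rep J' c'.
  split => // i.
    rewrite !mxE addr_ge0 //; last by rewrite mulr_ge0 ?ler0n ?ltW.
    rewrite subr_ge0; have [ai|ai] := ltP 0 (a 0 i).
      by rewrite -ler_pdivlMr //; exact: minl.
    by apply: (le_trans _ (c0 i)); rewrite mulr_ge0_le0 // ltW.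
  rewrite !inE negb_or negb_and negbK => /andP[ij il].
  rewrite !mxE /= (negPf ij) mulr0 addr0.
  case/orP: il => [/eqP->|iJ]; first by rewrite divfK ?subrr // gt_eqF.
  by rewrite cJ // aJ // mulr0 subr0.
have fJ' : feasible z J'.
  split; last by exists c'.
  rewrite /J' cardsU1 !inE eq_sym (negPf jJ) andbF /= -fJ.1.
  by rewrite [RHS](cardsD1 l) lJ.
have := minJ J' (asboolT fJ'); rewrite costc (costE _ _ fJ' rc').
apply/negP; rewrite -ltNge.
have -> : (c' *m w) 0 0 = (c *m w) 0 0 - t * (a *m w) 0 0 + t * w j 0.
  rewrite !row_mul_colE mulr_sumr -sumrB /c' -[w j 0](_ : \sum_i (i == j)%:R * w i 0 = _).
    rewrite mulr_sumr -big_split; apply: eq_bigr => i _ /=; rewrite !mxE /=; ring.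
  by rewrite (bigD1 j) //= eqxx mul1r big1 ?addr0 // => i /negPf->; rewrite mul0r.
have : t * w j 0 < t * (a *m w) 0 0 by rewrite ltr_pM2l.
lra.
Qed.

End Triangulation.

(** Each condition is the nonvanishing of the form [delta_mx 0 j - a] at [w]. Its coefficient at [j]
    is 1 because [a] vanishes outside [J], and also when no [a] exists and [xget] returns 0. *)
Lemma generic_weights_exist (R : realFieldType) N d (V : 'M[R]_(N, d)) :
  exists w, generic_weights V w.
Proof.
pose A J j := [set a : 'rV[R]_N | supported J a /\ a *m V = row j V]%classic.
pose s := [seq delta_mx 0 (p : {set 'I_N} * 'I_N).2 - xget 0 (A p.1 p.2)
  | p <- enum [pred p : {set 'I_N} * 'I_N | p.2 \notin p.1]].
have [a|w _ Hw] := @generic_positive_vector _ _ s.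
  case/mapP => -[J j]; rewrite mem_enum inE /= => jJ ->.
  apply/rV0Pn; exists j; rewrite !mxE !eqxx /=.
  suff -> : xget 0 (A J j) 0 j = 0 by rewrite subr0 oner_eq0.
  have [Aa|nA] := pselect (exists a, A J j a).
    by have [+ _] := xgetPex 0 Aa; apply.
  by rewrite xgetPN ?mxE // => b Ab; apply: nA; exists b.
exists w => J f Jf j jJ a aJ aV.
have /Hw : delta_mx 0 j - xget 0 (A J j) \in s.
  apply: (map_f (fun p : {set 'I_N} * 'I_N => delta_mx 0 p.2 - xget 0 (A p.1 p.2))
    (x := (J, j))).
  by rewrite mem_enum inE.
have [xJ xV] := xgetPex 0 (ex_intro (A J j) a (conj aJ aV)).
rewrite (basis_supported_inj Jf xJ aJ) ?xV //.
by rewrite mulmxBl -rowE [X in X != 0 -> _]mxE [X in X + _]mxE [X in _ + X]mxE subr_eq0 eq_sym.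
Qed.

Lemma count_unique (T : eqType) (P : pred T) (s : seq T) : uniq s ->
  {in s &, forall x y, P x -> P y -> x = y} -> count P s = has P s.
Proof.
move=> us H; case: hasP => [[x xs Px]|nP].
  have <- : count_mem x s = nat_of_bool true by rewrite count_uniq_mem // xs.
  apply: eq_in_count => y ys /=; apply/idP/eqP => [Py|->//].
  exact: H.
apply/eqP; rewrite -leqn0 leqNgt -has_count; apply/hasP => -[x xs Px].
by apply: nP; exists x.
Qed.

Definition halfopen_cone (R : realFieldType) d (M : 'M[R]_d)
    (tau : {ffun 'I_d -> bool}) (x : 'rV[R]_d) :=
  [forall l, (0 < (x *m invmx M) 0 l)
          || ((x *m invmx M) 0 l == 0) && tau l].

(* For a generic interior point [q] and small [e > 0], the point [x + e q] lies in
   exactly one cone of the triangulation, and the signs of the coordinates of [q]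
   decide which facets of that cone are kept; [x - e q] gives the complementary
   choice. *)
Lemma halfopen_decomposition (R : realFieldType) N d (V : 'M[R]_(N, d))
    (h : 'cV[R]_d) : (forall i, (V *m h) i 0 = 1) -> \rank V = d ->
  exists T : seq ('M[R]_d * {ffun 'I_d -> bool}),
    [/\ forall p, p \in T -> p.1 \in unitmx /\
          forall l, exists i, row l p.1 = row i V,
        forall x, count (fun p : 'M[R]_d * {ffun 'I_d -> bool} => halfopen_cone p.1 p.2 x) T
          = `[< cone_on V [set: 'I_N]%SET x >] &
        forall x, count (fun p : 'M[R]_d * {ffun 'I_d -> bool} => halfopen_cone p.1 [ffun l => ~~ p.2 l] x) T
          = `[< exists2 c : 'rV_N, forall i, 0 < c 0 i & x = c *m V >]].
Proof.
move=> Vh rankV; have [nrm nrmP] := degenerate_normals V.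
have [w gw] := generic_weights_exist V.
have [cq cq0 gq] := generic_interior rankV nrmP; set q := cq *m V in gq.
have [M MP] : exists M : {set 'I_N} -> 'M[R]_d, forall J,
    (exists f, basis_at V J f) -> exists2 f, basis_at V J f & M J = rowsub f V.
  suff /choice[M HM] : forall J, exists M : 'M[R]_d,
    (exists f, basis_at V J f) -> exists2 f, basis_at V J f & M = rowsub f V.
    by exists M.
  move=> J; have [[f Jf]|] := pselect (exists f, basis_at V J f).
    by exists (rowsub f V) => _; exists f.
  by exists 0.
pose TJ := [seq J <- enum {set 'I_N} |
  `[< dual_feasible V w J /\ exists f, basis_at V J f >]].
have uTJ : uniq TJ by rewrite filter_uniq // enum_uniq.
pose sgn J : {ffun 'I_d -> bool} := [ffun l => 0 < (q *m invmx (M J)) 0 l].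
have MJ J : J \in TJ -> exists2 f, basis_at V J f & M J = rowsub f V.
  by rewrite mem_filter => /andP[/asboolP[_ /MP]].
have qJ J l : J \in TJ -> (q *m invmx (M J)) 0 l != 0.
  case/MJ => f Jf ->; have [injf imf uf] := Jf.
  have [c [cJ ca cV]] := basis_expand Jf (q *m invmx (rowsub f V)).
  rewrite mulmxKV // in cV.
  have cd : #|J| = d by rewrite -imf card_imset // card_ord.
  rewrite -ca mxE; apply: (generic_coord_neq0 nrmP gq cd cJ (esym cV)).
  exact: basis_mem Jf l.
have count_cone z : generic V nrm z ->
    count (fun J => `[< cone_on V J z >]) TJ = `[< cone_on V [set: 'I_N]%SET z >].
  move=> gz; rewrite count_unique //.
    congr nat_of_bool; apply/hasP/asboolP => [[J _ /asboolP[c [c0 cJ zE]]]|zT].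
      by exists c; split => // i; rewrite inE.
    have [J [fJ dJ]] := dual_feasible_exists Vh nrmP gw gz zT.
    have [cd [c [c0 cJ zE]]] := fJ.
    exists J; last by apply/asboolP; exists c.
    rewrite mem_filter mem_enum andbT; apply/asboolP; split => //.
    exact: (generic_basis nrmP gz cd cJ zE).
  move=> J J'; rewrite !mem_filter => /andP[/asboolP[dJ [f Jf]] _].
  move=> /andP[/asboolP[dJ' [f' Jf']] _] /asboolP zJ /asboolP zJ'.
  have card K g : basis_at V K g -> #|K| = d.
    by move=> [injg <- _]; rewrite card_imset // card_ord.
  by apply: (dual_feasible_uniq nrmP gz dJ dJ'); split;
    rewrite ?(card _ _ Jf) ?(card _ _ Jf').
(* The factor [s] will be 1 or -1, so that pushes towards [q] and away from it are treated
   together. *)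
have perturb x (s : R) : s != 0 -> exists2 e, 0 < e & forall e', 0 < e' <= e ->
   generic V nrm (x + (e' * s) *: q) /\
   forall J, J \in TJ ->
    (`[< cone_on V J (x + (e' * s) *: q) >] =
     [forall l, (0 < (x *m invmx (M J)) 0 l) || ((x *m invmx (M J)) 0 l == 0)
        && (0 < s * (q *m invmx (M J)) 0 l)]).
  move=> s0.
  (* [sign_perturbation] wants a nonzero value at every index; 1 is a filler where no condition is
     imposed. *)
  pose b1 (J : {set 'I_N}) :=
    if (\rank (mask R J *m V) < d)%N then s * (q *m nrm J) 0 0 else 1.
  have b1n J : b1 J != 0.
    by rewrite /b1; case: ifP => [/gq qn|_]; rewrite ?oner_eq0 // mulf_neq0.
  pose b2 (p : {set 'I_N} * 'I_d) :=
    if p.1 \in TJ then s * (q *m invmx (M p.1)) 0 p.2 else 1.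
  have b2n p : b2 p != 0.
    by rewrite /b2; case: ifP => [/(qJ p.1 p.2) qn|_]; rewrite ?oner_eq0 // mulf_neq0.
  have [e1 e10 H1] := @sign_perturbation R _ (fun J => (x *m nrm J) 0 0) b1 b1n.
  have [e2 e20 H2] := @sign_perturbation R _
    (fun p => (x *m invmx (M p.1)) 0 p.2) b2 b2n.
  exists (Num.min e1 e2); first by rewrite lt_min e10.
  move=> e /andP[e0]; rewrite le_min => /andP[le1 le2]; split.
    move=> J lt_d; have [+ _] := H1 e (introT andP (conj e0 le1)) J.
    by rewrite /b1 lt_d mulmxDl -scalemxAl => H; rewrite mxE [(e * s *: (q *m _)) 0 0]mxE -mulrA.
  move=> J JT; have [f Jf MJE] := MJ J JT.
  apply/asboolP/forallP => [/(basis_coneP Jf) + l|H].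
    move=> /(_ l); rewrite -MJE mulmxDl -scalemxAl mxE [(e * s *: (q *m _)) 0 l]mxE -mulrA.
    have [_ +] := H2 e (introT andP (conj e0 le2)) (J, l).
    by rewrite /b2 /= JT => ->.
  apply/(basis_coneP Jf) => l; rewrite -MJE mulmxDl -scalemxAl.
  rewrite mxE [(e * s *: (q *m _)) 0 l]mxE -mulrA; have := H l.
  have [_ +] := H2 e (introT andP (conj e0 le2)) (J, l).
  by rewrite /b2 /= JT => ->.
exists [seq (M J, sgn J) | J <- TJ]; split.
- move=> _ /mapP[J /MJ[f [injf _ uf] ME] ->] /=; rewrite ME; split=> // l.
  by exists (f l); rewrite row_rowsub.
- move=> x; rewrite count_map.
  have [e e0 /(_ e)] := perturb x 1 (oner_neq0 R).
  rewrite e0 lexx => /(_ isT)[gx Hx]; rewrite mulr1 in gx Hx.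
  transitivity (count (fun J => `[< cone_on V J (x + e *: q) >]) TJ).
    apply: eq_in_count => J JT /=; rewrite Hx //.
    by apply: eq_forallb => l; rewrite ffunE mul1r.
  rewrite count_cone //; congr nat_of_bool; apply/asboolP/asboolP; last first.
    move=> [c [c0 cT ->]]; exists (c + e *: cq); split.
    + by move=> i; rewrite !mxE addr_ge0 // mulr_ge0 // ltW.
    + by move=> i; rewrite inE.
    + by rewrite mulmxDl -scalemxAl.
  move=> zT; have := count_cone _ gx; rewrite asboolT // => cnt.
  (* Closedness of the cone comes from the cell that contains the pushed point: by the tie rule [x]
     has nonnegative coordinates in the same basis. *)
  have /hasP[J JT] : has (fun J => `[< cone_on V J (x + e *: q) >]) TJ.
    by rewrite has_count cnt.
  rewrite Hx // => /forallP H; have [f Jf MJE] := MJ J JT.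
  have /(basis_coneP Jf)[c [c0 cJ xE]] :
      forall l, 0 <= (x *m invmx (rowsub f V)) 0 l.
    by move=> l; have := H l; rewrite MJE le0r => /orP[->|/andP[->]//]; rewrite orbT.
  by exists c; split => // i; rewrite inE.
- move=> x; rewrite count_map.
  have m10 : -1 != 0 :> R by rewrite oppr_eq0 oner_eq0.
  have [e1 e10 H1] := perturb x (-1) m10.
  (* An interior point stays in the cone after a small step against [q]; conversely, adding back a
     multiple of the positive coefficients [cq] makes all coefficients positive. The step is shrunk
     below [e1] only when [x] is interior. *)
  have [e [e0 le1 He]] : exists e, [/\ 0 < e, e <= e1 &
      cone_on V [set: 'I_N]%SET (x + (e * -1) *: q) <->
      exists2 c : 'rV_N, forall i, 0 < c 0 i & x = c *m V].
    have back e : 0 < e -> cone_on V [set: 'I_N]%SET (x + (e * -1) *: q) ->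
        exists2 c : 'rV_N, forall i, 0 < c 0 i & x = c *m V.
      move=> e0 [c [c0 _ E]]; exists (c + e *: cq) => [i|].
        by rewrite !mxE ltr_wpDl // mulr_gt0.
      by rewrite mulmxDl -scalemxAl -E mulrN1 scaleNr subrK.
    have [[c c0 xE]|nx] := pselect
        (exists2 c : 'rV_N, forall i, 0 < c 0 i & x = c *m V); last first.
      by exists e1; split => //; split => [/(back _ e10)|].
    have [e2 e20 H2] := @small_perturbation _ _ (fun i => c 0 i)
      (fun i => - cq 0 i) c0.
    exists (Num.min e1 e2); split; rewrite ?lt_min ?e10 ?ge_min ?lexx //.
    split=> [|_]; first by apply: back; rewrite lt_min e10.
    exists (c - Num.min e1 e2 *: cq); split.
    + move=> i; have := H2 (Num.min e1 e2).
      rewrite ge_min lexx orbT le_min ltW //= ltW // => /(_ isT i).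
      by rewrite !mxE mulrN => /ltW.
    + by move=> i; rewrite inE.
    + by rewrite mulmxBl -scalemxAl xE mulrN1 scaleNr.
  have [gx Hx] := H1 e (introT andP (conj e0 le1)).
  transitivity (count (fun J => `[< cone_on V J (x + (e * -1) *: q) >]) TJ).
    apply: eq_in_count => J JT /=; rewrite Hx //.
    (* No coordinate of [q] vanishes, so reversing the direction negates each facet choice
       exactly. *)
    apply: eq_forallb => l; rewrite !ffunE mulN1r oppr_gt0 -leNgt.
    by rewrite le_eqVlt (negPf (qJ J l JT)).
  by rewrite count_cone //; congr nat_of_bool; apply/asboolP/asboolP => /He.
Qed.

(** * Lattice points of half-open simplicial cones *)

Section Enumeration.
Variable R : realType.

Definition integral n (x : 'rV[R]_n) := forall j, x 0 j \is a Num.int.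

(** A duplicate-free list witnesses finiteness and carries the cardinality as its size, so counts
    are compared through bijections of lists. *)
Definition enumerates n (A : 'rV[R]_n -> Prop) (s : seq 'rV[R]_n) :=
  uniq s /\ forall x, x \in s <-> integral x /\ A x.

Lemma bounded_enumerates n (A : 'rV[R]_n -> Prop) (b : nat) :
  (forall x, integral x -> A x -> forall j, `|x 0 j| <= b%:R) ->
  exists s, enumerates A s.
Proof.
move=> Ab; pose r := [seq \row_j ((g : {ffun 'I_n -> 'I_(b + b).+1}) j)%:R - const_mx b%:R
  | g <- enum {ffun 'I_n -> 'I_(b + b).+1}] : seq 'rV[R]_n.
exists (undup [seq x <- r | `[< integral x /\ A x >]]); split => [|x].
  exact: undup_uniq.
rewrite mem_undup mem_filter; split=> [/andP[/asboolP//]|[ix Ax]].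
apply/andP; split; first exact/asboolP.
have Hk j : exists k : 'I_(b + b).+1, x 0 j = k%:R - b%:R.
  have := Ab x ix Ax j; rewrite ler_norml => /andP[lo up].
  have /natrP[k Ek] : x 0 j + b%:R \is a Num.nat.
    by rewrite natrEint rpredD ?natr_int ?ix //=; lra.
  have lt_k : (k < (b + b).+1)%N.
    by rewrite ltnS -(ler_nat R) -Ek natrD; lra.
  by exists (Ordinal lt_k); rewrite /= -Ek addrK.
have [k kE] := choice Hk.
apply/mapP; exists [ffun j => k j]; first by rewrite mem_enum.
by apply/rowP => j; rewrite !mxE ffunE.
Qed.

Lemma combinations_enumerates N n (V : 'M[R]_(N, n)) (A : 'rV[R]_n -> Prop)
    (t : R) :
  (forall x, A x -> exists c : 'rV_N,
    [/\ nonneg c, \sum_i c 0 i = t & x = c *m V]) ->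
  exists s, enumerates A s.
Proof.
move=> AV; pose B := \sum_i \sum_j `|V i j| * `|t|.
apply: (@bounded_enumerates _ _ (Num.truncn B).+1) => x _ /AV[c [c0 ct ->]] j.
apply: (le_trans _ (ltW (truncnS_gt B))).
rewrite mxE; apply: (le_trans (ler_norm_sum _ _ _)); apply: ler_sum => i _.
rewrite [leRHS](bigD1 j) //= normrM [ `|c 0 i| ]ger0_norm // mulrC.
rewrite ler_wpDr //; first by apply: sumr_ge0 => k _; exact: mulr_ge0.
rewrite ler_wpM2l //; apply: (le_trans _ (ler_norm _)).
by rewrite -ct (bigD1 i) //= lerDl sumr_ge0.
Qed.

(** Weak compositions of [m] into [e + 1] parts; no part exceeds [m], which makes the index type
    finite. *)
Definition nat_vectors e (m : nat) : seq 'rV[R]_e.+1 :=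
  [seq \row_l (tnth k l : nat)%:R | k : e.+1.-tuple 'I_m.+1 <-
     enum [set k : e.+1.-tuple 'I_m.+1 | (\sum_(i <- k) i == m)%N]%SET].

Lemma size_nat_vectors e m : size (nat_vectors e m) = 'C(m + e, e).
Proof. by rewrite size_map -cardE card_ord_partitions addnC. Qed.

Lemma uniq_nat_vectors e m : uniq (nat_vectors e m).
Proof.
rewrite map_inj_uniq ?enum_uniq // => k k' /rowP E.
apply: eq_from_tnth => l; apply/val_inj/eqP; rewrite /= -(eqr_nat R).
by have := E l; rewrite !mxE => ->.
Qed.

Lemma mem_nat_vectors e m (v : 'rV[R]_e.+1) :
  reflect ((forall l, v 0 l \is a Num.nat) /\ \sum_l v 0 l = m%:R)
    (v \in nat_vectors e m).
Proof.
apply: (iffP mapP) => [[k + ->]|[vn vm]].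
  rewrite mem_enum inE big_tuple => /eqP km; split=> [l|]; first by rewrite mxE natr_nat.
  rewrite -[RHS](congr1 (fun j => j%:R) km) natr_sum; apply: eq_bigr => l _; by rewrite mxE.
have Hk l : exists k : 'I_m.+1, v 0 l = k%:R.
  have /natrP[k Ek] := vn l.
  have lt_k : (k < m.+1)%N.
    rewrite ltnS -(ler_nat R) -Ek -vm (bigD1 l) //= lerDl.
    by apply: sumr_ge0 => i _; exact: natr_ge0.
  by exists (Ordinal lt_k).
have [k kE] := choice Hk.
exists [tuple k l | l < e.+1].
  rewrite mem_enum inE big_tuple; apply/eqP/eqP; rewrite -(eqr_nat R) natr_sum -vm.
  by apply/eqP; apply: eq_bigr => l _; rewrite tnth_mktuple kE.
by apply/rowP => l; rewrite mxE tnth_mktuple kE.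
Qed.

End Enumeration.

Section BinomialPolynomial.
Variable R : realType.

(** The binomial coefficient of [X + e] over [e], which is the Ehrhart polynomial of the standard
    simplex of dimension [e]. *)
Definition binomial_poly (e : nat) : {poly R} :=
  (e`!%:R^-1)%:P * \prod_(i < e) ('X + i.+1%:R%:P).

Lemma size_binomial_poly e : (size (binomial_poly e) <= e.+1)%N.
Proof.
rewrite /binomial_poly mul_polyC (leq_trans (size_scale_leq _ _)) //.
under eq_bigr => i _ do rewrite -[i.+1%:R%:P]opprK -polyCN.
by rewrite size_prod_XsubC [index_enum _]unlock -enumT size_enum_ord.
Qed.

Lemma binomial_poly_nat e m : (binomial_poly e).[m%:R] = 'C(m + e, e)%:R.
Proof.
rewrite /binomial_poly hornerM hornerC horner_prod.
have f0 : e`!%:R != 0 :> R by rewrite pnatr_eq0 -lt0n fact_gt0.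
apply: (mulfI f0); rewrite mulrA divff // mul1r -natrM mulnC bin_ffact.
rewrite ffact_prod natr_prod (reindex_inj rev_ord_inj) /=.
apply: eq_bigr => i _; rewrite !hornerE -natrD; congr _%:R.
by have := ltn_ord i; lia.
Qed.

(** Reciprocity for the standard simplex. For [m < e] the value is 0: these are the zeros -1, ...,
    -e. *)
Lemma binomial_poly_neg e m :
  (binomial_poly e).[- m.+1%:R] = (-1) ^+ e * 'C(m, e)%:R.
Proof.
rewrite /binomial_poly hornerM hornerC horner_prod.
have f0 : e`!%:R != 0 :> R by rewrite pnatr_eq0 -lt0n fact_gt0.
apply: (mulfI f0); rewrite mulrA divff // mul1r mulrCA -natrM [(e`! * _)%N]mulnC.
rewrite bin_ffact ffact_prod natr_prod.
have E (i : 'I_e) : ('X + i.+1%:R%:P).[- m.+1%:R] = -1 * (m%:R - i%:R) :> R.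
  by rewrite !hornerE -[m.+1%:R]natr1 -[i.+1%:R]natr1; ring.
rewrite (eq_bigr _ (fun i _ => E i)) big_split /= prodr_const card_ord.
congr (_ * _); have [le_em|lt_me] := leqP e m.
  by apply: eq_bigr => i _; rewrite (natrB R (ltnW (leq_trans (ltn_ord i) le_em))).
by rewrite (bigD1 (Ordinal lt_me)) // [RHS](bigD1 (Ordinal lt_me)) //= subrr subnn !mul0r.
Qed.

End BinomialPolynomial.

(** * Counting in a single half-open simplicial cone *)

Section HalfopenCount.
Variables (R : realType) (e : nat) (M : 'M[R]_e.+1) (h : 'cV[R]_e.+1).
Hypothesis uM : M \in unitmx.
Hypothesis intM : forall i j, M i j \is a Num.int.
Hypothesis inth : forall j, h j 0 \is a Num.int.
Hypothesis Mh : forall l, (M *m h) l 0 = 1.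
Implicit Types (x : 'rV[R]_e.+1) (tau : {ffun 'I_e.+1 -> bool}).

Local Notation coord x := (x *m invmx M).
Local Notation height x := ((x *m h) 0 0).

(** A half-open unit interval, closed at 0 if [b] (the facet is kept) and at 1 otherwise. Each
    admissible coordinate is then a residue plus a natural number in exactly one way. *)
Definition residue (b : bool) (r : R) :=
  ((0 < r) || (r == 0) && b) && ((r < 1) || (r == 1) && ~~ b).

Lemma residueT r : residue true r = (0 <= r < 1).
Proof. by rewrite /residue andbT andbF orbF orbC eq_sym -le_eqVlt. Qed.

Lemma residueF r : residue false r = (0 < r <= 1).
Proof. by rewrite /residue andbT andbF orbF orbC -le_eqVlt. Qed.

Lemma residue_exists b a : (0 < a) || (a == 0) && b ->
  exists k : nat, residue b (a - k%:R).
Proof.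
move=> Ha; have a0 : 0 <= a by case/orP: Ha => [/ltW//|/andP[/eqP->]].
have /andP[lo] := truncn_itv a0; rewrite -natr1 => up.
move: lo up Ha; set m := Num.truncn a => lo up; case: b => Ha.
  by exists m; rewrite residueT; lra.
rewrite andbF orbF in Ha.
have [am|am] := eqVneq a m%:R; last first.
  by exists m; rewrite residueF subr_gt0 lt_neqAle eq_sym am lo /=; lra.
exists m.-1; rewrite residueF am; rewrite am ltr0n in Ha.
by rewrite -[X in X%:R - _](prednK Ha) -natr1 addrC addKr ltr01 lexx.
Qed.

Lemma residue_uniq b r r' (k k' : nat) : residue b r -> residue b r' ->
  r + k%:R = r' + k'%:R -> k = k'.
Proof.
have le b0 s s' (j j' : nat) : residue b0 s -> residue b0 s' ->
    s + j%:R = s' + j'%:R -> (j <= j')%N.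
  move=> H H' E; rewrite leqNgt; apply/negP; rewrite -(ler_nat R) -natr1 => lt_j.
  by case: b0 H H'; rewrite ?residueT ?residueF; lra.
move=> H H' E; apply/eqP; rewrite eqn_leq (le b r r') //.
by rewrite (le b r' r).
Qed.

Definition fundamental tau x := forall l, residue (tau l) (coord x 0 l).

Lemma coordK x : coord x *m M = x. Proof. by rewrite mulmxKV. Qed.

Lemma heightE x : height x = \sum_l coord x 0 l.
Proof.
rewrite -{1}[x]coordK -mulmxA row_mul_colE.
by apply: eq_bigr => l _; rewrite Mh mulr1.
Qed.

Lemma integral_height x : integral x -> height x \is a Num.int.
Proof.
by move=> ix; rewrite row_mul_colE rpred_sum // => j _; rewrite rpredM ?ix.
Qed.

Lemma integral_mulM (v : 'rV[R]_e.+1) : integral v -> integral (v *m M).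
Proof. by move=> iv j; rewrite mxE rpred_sum // => l _; rewrite rpredM ?iv. Qed.

Lemma residue_itv b r : residue b r -> 0 <= r <= 1.
Proof. by case: b; rewrite ?residueT ?residueF; lra. Qed.

Lemma fundamental_enumerates tau : exists s, enumerates (fundamental tau) s.
Proof.
pose B := \sum_j \sum_l `|M l j|.
apply: (@bounded_enumerates _ _ _ (Num.truncn B).+1) => x _ Fx j.
have le_B : \sum_l `|M l j| <= B.
  by rewrite /B [leRHS](bigD1 j) //= lerDl sumr_ge0 // => k _; exact: sumr_ge0.
apply: (le_trans _ (ltW (truncnS_gt B))); apply: (le_trans _ le_B).
rewrite -[x]coordK mxE; apply: (le_trans (ler_norm_sum _ _ _)).
apply: ler_sum => l _; have /andP[r0 r1] := residue_itv (Fx l).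
by rewrite normrM ger0_norm // ler_piMl.
Qed.

Definition height_nat x := Num.truncn (height x).

Lemma fundamental_height tau x : integral x -> fundamental tau x ->
  height x = (height_nat x)%:R /\ (height_nat x <= e.+1)%N.
Proof.
move=> ix Fx; have h0 : 0 <= height x.
  by rewrite heightE sumr_ge0 // => l _; have /andP[] := residue_itv (Fx l).
have E : height x = (height_nat x)%:R.
  by rewrite truncnK // natrEint integral_height.
split=> //; rewrite -(ler_nat R) -E heightE.
have -> : e.+1%:R = \sum_(l < e.+1) 1 :> R by rewrite sumr_const card_ord.
by apply: ler_sum => l _; have /andP[] := residue_itv (Fx l).
Qed.

Definition shifted_vectors (t : nat) x : seq 'rV[R]_e.+1 :=
  if (height_nat x <= t)%N then nat_vectors R e (t - height_nat x) else [::].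

(** Heights reach [e + 1], whereas the binomial polynomial vanishes only at -1, ..., -e. As [t] is
    positive, [t] minus the height is at least -e, so the polynomial also counts the empty list. *)
Lemma size_shifted_vectors tau t x : (0 < t)%N ->
  integral x -> fundamental tau x ->
  (size (shifted_vectors t x))%:R
    = (binomial_poly R e).[t%:R - (height_nat x)%:R].
Proof.
move=> t0 ix Fx; have [_ le_h] := fundamental_height ix Fx.
rewrite /shifted_vectors; have [le_t|lt_t] := leqP (height_nat x) t.
  by rewrite size_nat_vectors -natrB // binomial_poly_nat.
have -> : t%:R - (height_nat x)%:R = - (height_nat x - t.+1).+1%:R :> R.
  by rewrite -subSn // subSS natrB ?opprB // ltnW.
by rewrite binomial_poly_neg bin_small ?mulr0 //; lia.
Qed.

(** The cone is tiled by translates of its half-open parallelepiped under natural combinations of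
    the rows of [M]. These rows are integral of height 1, so a translation raises the height by the
    sum of its coefficients. *)
Lemma halfopen_enumerates tau t s : enumerates (fundamental tau) s ->
  exists2 s', enumerates (fun x => halfopen_cone M tau x /\ height x = t%:R) s'
    & size s' = (\sum_(x <- s) size (shifted_vectors t x))%N.
Proof.
move=> [us sP]; exists [seq x + v *m M | x <- s, v <- shifted_vectors t x]; last first.
  by rewrite size_allpairs_dep sumnE big_map.
have Fcoord x v : coord (x + v *m M) = coord x + v by rewrite mulmxDl mulmxK.
split.
  apply: allpairs_uniq_dep => //.
    by move=> x _; rewrite /shifted_vectors; case: ifP => // _; exact: uniq_nat_vectors.
  move=> p q /allpairsPdep[x [v [/sP[_ Fx] vx ->]]].
  move=> /allpairsPdep[x' [v' [/sP[_ Fx'] vx' ->]]] /= E.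
  have Ev : v = v'.
    apply/rowP => l; move: vx vx'; rewrite /shifted_vectors.
    case: ifP => // _ /mem_nat_vectors[/(_ l)/natrP[k vk] _].
    case: ifP => // _ /mem_nat_vectors[/(_ l)/natrP[k' vk'] _].
    have /rowP/(_ l) := congr1 (mulmxr (invmx M)) E; rewrite /=.
    rewrite !Fcoord mxE [RHS]mxE vk vk' => /(residue_uniq (Fx l) (Fx' l)).
    by move=> ->.
  have Ex : x = x' by move: E; rewrite Ev => /addIr.
  by rewrite Ex Ev in vx *.
move=> y; split.
  case/allpairsPdep => x [v [/sP[ix Fx] vx ->]].
  have [hx _] := fundamental_height ix Fx.
  move: vx; rewrite /shifted_vectors; case: ifP => // le_t.
  move=> /mem_nat_vectors[vn vs]; split.
    move=> j; rewrite mxE rpredD ?ix //; apply: integral_mulM => l.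
    by have := vn l; rewrite natrEint => /andP[].
  split.
    apply/forallP => l; rewrite Fcoord mxE.
    have /andP[+ _] := Fx l; have := natr_ge0 (vn l).
    move=> v0 /orP[r0|/andP[/eqP-> ->]]; first by rewrite ltr_wpDr.
    by rewrite add0r andbT orbC eq_sym -le_eqVlt.
  rewrite heightE Fcoord.
  have -> : \sum_l (coord x + v) 0 l = \sum_l coord x 0 l + \sum_l v 0 l.
    by rewrite -big_split; apply: eq_bigr => l _; rewrite mxE.
  by rewrite -heightE hx vs -natrD subnKC.
move=> [iy [/forallP Hy hy]].
have /choice[k kP] : forall l, exists k : nat, residue (tau l) (coord y 0 l - k%:R).
  by move=> l; apply: residue_exists; exact: Hy.
pose v : 'rV[R]_e.+1 := \row_l (k l)%:R.
have iv : integral v by move=> l; rewrite mxE natr_int.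
apply/allpairsPdep; exists (y - v *m M), v; split; last by rewrite subrK.
  apply/sP; split.
    by move=> j; rewrite !mxE rpredB ?iy //; have := integral_mulM iv j; rewrite mxE.
  by move=> l; rewrite mulmxBl mulmxK // mxE [X in _ + X]mxE [v _ _]mxE; exact: kP.
have Fx : fundamental tau (y - v *m M).
  by move=> l; rewrite mulmxBl mulmxK // mxE [X in _ + X]mxE [v _ _]mxE; exact: kP.
have ix : integral (y - v *m M).
  by move=> j; rewrite !mxE rpredB ?iy //; have := integral_mulM iv j; rewrite mxE.
have [hx _] := fundamental_height ix Fx.
have E : height (y - v *m M) + \sum_l v 0 l = t%:R.
  rewrite -hy !heightE -big_split; apply: eq_bigr => l _ /=.
  by rewrite mulmxBl mulmxK // mxE [X in _ + X + _]mxE subrK.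
have le_t : (height_nat (y - v *m M) <= t)%N.
  rewrite -(ler_nat R) -hx -E lerDl sumr_ge0 // => l _.
  by rewrite mxE ler0n.
rewrite /shifted_vectors le_t; apply/mem_nat_vectors; split.
  by move=> l; rewrite mxE natr_nat.
by rewrite natrB // -hx -E addrC addKr.
Qed.

Definition opposite_point x : 'rV[R]_e.+1 := const_mx 1 *m M - x.

Lemma opposite_enumerates tau s : enumerates (fundamental tau) s ->
  enumerates (fundamental [ffun l => ~~ tau l]) [seq opposite_point x | x <- s].
Proof.
have ione : integral (const_mx 1 *m M : 'rV[R]_e.+1).
  by apply: integral_mulM => l; rewrite mxE.
have iopp x : integral x -> integral (opposite_point x).
  by move=> ix j; rewrite /opposite_point [X in X \is a _]mxE rpredD ?ione // mxE rpredN ix.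
have Fopp t x : fundamental t x -> fundamental [ffun l => ~~ t l] (opposite_point x).
  move=> Fx l; have := Fx l; rewrite /opposite_point mulmxBl mulmxK // ffunE.
  have -> : (const_mx 1 - coord x) 0 l = 1 - coord x 0 l by rewrite !mxE.
  by case: (t l); rewrite ?residueT ?residueF; lra.
have invo : involutive opposite_point.
  by move=> x; rewrite /opposite_point subKr.
move=> [us sP]; split.
  by rewrite map_inj_uniq //; exact: inv_inj.
move=> x; split=> [/mapP[y /sP[iy Fy] ->]|[ix Fx]]; first by split; auto.
apply/mapP; exists (opposite_point x); last by rewrite invo.
apply/sP; split; first exact: iopp.
have -> : tau = [ffun l => ~~ [ffun l => ~~ tau l] l] :> {ffun 'I_e.+1 -> bool}.
  by apply/ffunP => l; rewrite !ffunE negbK.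
exact: Fopp.
Qed.

Lemma opposite_height tau x : integral x -> fundamental tau x ->
  integral (opposite_point x) ->
  fundamental [ffun l => ~~ tau l] (opposite_point x) ->
  (height_nat (opposite_point x) + height_nat x)%N = e.+1.
Proof.
move=> ix Fx ox Fo; apply/eqP; rewrite -(eqr_nat R) natrD.
have [<- _] := fundamental_height ix Fx; have [<- _] := fundamental_height ox Fo.
rewrite !heightE -big_split /= (eq_bigr (fun=> 1)).
  by rewrite sumr_const card_ord.
by move=> l _; rewrite mulmxBl mulmxK // mxE [X in _ + X + _]mxE mxE subrK.
Qed.

Theorem halfopen_count tau : exists phi : {poly R},
  [/\ (size phi <= e.+1)%N,
   forall t, (0 < t)%N -> exists2 s,
     enumerates (fun x => halfopen_cone M tau x /\ height x = t%:R) s &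
     phi.[t%:R] = (size s)%:R &
   forall t, (0 < t)%N -> exists2 s,
     enumerates (fun x => halfopen_cone M [ffun l => ~~ tau l] x
                          /\ height x = t%:R) s &
     phi.[- t%:R] = (-1) ^+ e * (size s)%:R].
Proof.
have [F FP] := fundamental_enumerates tau.
pose phi := \sum_(x <- F) (binomial_poly R e \Po ('X - (height_nat x)%:R%:P)).
have phiE a : phi.[a] = \sum_(x <- F) (binomial_poly R e).[a - (height_nat x)%:R].
  by rewrite horner_sum; apply: eq_bigr => x _; rewrite horner_comp !hornerE.
exists phi; split.
- apply: (leq_trans (size_sum _ _ _)); apply/bigmax_leqP_seq => x _ _.
  by rewrite size_comp_poly2 ?size_XsubC ?size_binomial_poly.
- move=> t t0; have [s sP sz] := halfopen_enumerates t FP; exists s => //.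
  rewrite phiE sz natr_sum; apply: eq_big_seq => x /(FP.2 x)[ix Fx].
  by rewrite (size_shifted_vectors t0 ix Fx).
- move=> t t0; have FP' := opposite_enumerates FP.
  have [s sP sz] := halfopen_enumerates t FP'; exists s => //.
  rewrite phiE sz natr_sum big_map mulr_sumr; apply: eq_big_seq => x xF.
  have [ix Fx] := (FP.2 x).1 xF.
  have [ox Fo] := (FP'.2 _).1 (map_f opposite_point xF).
  have E := opposite_height ix Fx ox Fo.
  rewrite (size_shifted_vectors t0 ox Fo).
  have -> : - t%:R - (height_nat x)%:R = - (t + height_nat x).-1.+1%:R :> R.
    by rewrite prednK ?addn_gt0 ?t0 // natrD opprD.
  rewrite binomial_poly_neg; congr (_ * _).
  (* Opposite heights add up to [e + 1], so both sides are ['C(t + h - 1, e)] with [h] the height of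
     [x]; if the opposite height exceeds [t], both vanish. *)
  have [le_t|lt_t] := leqP (height_nat (opposite_point x)) t.
    rewrite -natrB // binomial_poly_nat; congr ('C(_, e))%:R; lia.
  have -> : t%:R - (height_nat (opposite_point x))%:R
      = - (height_nat (opposite_point x) - t.+1).+1%:R :> R.
    by rewrite -subSn // subSS natrB ?opprB // ltnW.
  by rewrite binomial_poly_neg !bin_small ?mulr0 //; lia.
Qed.

End HalfopenCount.

(** * Ehrhart polynomials of cones and lattice bases *)

Section ConeEhrhart.
Variables (R : realType) (N e : nat) (V : 'M[R]_(N, e.+1)) (h : 'cV[R]_e.+1).
Hypothesis intV : forall i j, V i j \is a Num.int.
Hypothesis inth : forall j, h j 0 \is a Num.int.
Hypothesis Vh : forall i, (V *m h) i 0 = 1.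
Hypothesis rankV : \rank V = e.+1.
Local Notation height x := ((x *m h) 0 0).

Lemma cone_height (c : 'rV[R]_N) : height (c *m V) = \sum_i c 0 i.
Proof.
by rewrite -mulmxA row_mul_colE; apply: eq_bigr => i _; rewrite Vh mulr1.
Qed.

Lemma cone_slice_enumerates (A : 'rV[R]_e.+1 -> Prop) (t : nat) :
  (forall x, A x -> cone_on V [set: 'I_N]%SET x) ->
  exists s, enumerates (fun x => A x /\ height x = t%:R) s.
Proof.
move=> AK; apply: (combinations_enumerates (V := V) (t := t%:R)).
by move=> _ [/AK[c [c0 _ ->]]]; rewrite cone_height => ct; exists c.
Qed.

Lemma count_slices (I : eqType) (T : seq I) (P : I -> pred 'rV[R]_e.+1)
    (A : 'rV[R]_e.+1 -> Prop) (t : nat) (s : seq 'rV[R]_e.+1) (k : I -> nat) :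
  (forall x, count (fun p => P p x) T = `[< A x >]) ->
  enumerates (fun x => A x /\ height x = t%:R) s ->
  (forall p, p \in T -> exists2 s',
    enumerates (fun x => P p x /\ height x = t%:R) s' & k p = size s') ->
  size s = (\sum_(p <- T) k p)%N.
Proof.
move=> cT [us sP] kP.
transitivity (\sum_(p <- T) count (P p) s)%N.
  under eq_bigr => p _ do rewrite -sum1_count big_mkcond /=.
  rewrite exchange_big /= -sum1_size; apply: eq_big_seq => x /sP[_ [Ax _]].
  by rewrite -big_mkcond sum1_count cT asboolT.
apply: eq_big_seq => p pT; have [s' [us' sP'] ->] := kP p pT.
rewrite -size_filter; apply/perm_size/uniq_perm => //; first exact: filter_uniq.
move=> x; rewrite mem_filter; apply/andP/idP => [[px /sP[ix [_ hx]]]|].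
  by apply/sP'.
move=> /sP'[ix [px hx]]; split => //; apply/sP; split => //; split => //.
apply/asboolP; have := cT x; case: asbool => //= /eqP.
by rewrite -leqn0 leqNgt -has_count => /negP[]; apply/hasP; exists p.
Qed.

Theorem cone_ehrhart : exists phi : {poly R},
  [/\ (size phi <= e.+1)%N,
   forall t, (0 < t)%N -> exists2 s,
     enumerates (fun x => cone_on V [set: 'I_N]%SET x /\ height x = t%:R) s &
     phi.[t%:R] = (size s)%:R &
   forall t, (0 < t)%N -> exists2 s,
     enumerates (fun x => (exists2 c : 'rV_N, forall i, 0 < c 0 i & x = c *m V)
                          /\ height x = t%:R) s &
     phi.[- t%:R] = (-1) ^+ e * (size s)%:R].
Proof.
have [T [TM TK TKo]] := halfopen_decomposition Vh rankV.
have /choice[phi phiP] : forall p : 'M[R]_e.+1 * {ffun 'I_e.+1 -> bool},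
  exists phi : {poly R}, p \in T -> [/\ (size phi <= e.+1)%N,
   forall t, (0 < t)%N -> exists2 s,
     enumerates (fun x => halfopen_cone p.1 p.2 x /\ height x = t%:R) s &
     phi.[t%:R] = (size s)%:R &
   forall t, (0 < t)%N -> exists2 s,
     enumerates (fun x => halfopen_cone p.1 [ffun l => ~~ p.2 l] x
                          /\ height x = t%:R) s &
     phi.[- t%:R] = (-1) ^+ e * (size s)%:R].
  move=> p; have [pT|_] := boolP (p \in T); last by exists 0.
  have [up rp] := TM p pT.
  have intM i j : p.1 i j \is a Num.int.
    by have [k /rowP/(_ j)] := rp i; rewrite !mxE => ->.
  have Mh l : (p.1 *m h) l 0 = 1.
    have [k E] := rp l.
    have -> : (p.1 *m h) l 0 = (row l p.1 *m h) 0 0 by rewrite -row_mul [RHS]mxE.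
    by rewrite E -row_mul mxE Vh.
  by have [f Hf] := halfopen_count up intM inth Mh p.2; exists f.
exists (\sum_(p <- T) phi p); split.
- apply: (leq_trans (size_sum _ _ _)); apply/bigmax_leqP_seq => p pT _.
  by have [] := phiP p pT.
- move=> t t0; have [s sP] := @cone_slice_enumerates _ t (fun x Kx => Kx).
  exists s => //; rewrite horner_sum.
  (* The list of each cell is known only existentially; truncating the value of its polynomial
     recovers the size as a function of [p]. *)
  pose k p := Num.truncn (phi p).[t%:R].
  have kP p : p \in T -> exists2 s',
      enumerates (fun x => halfopen_cone p.1 p.2 x /\ height x = t%:R) s'
      & k p = size s'.
    move=> /phiP[_ /(_ t t0)[s' sP' E] _]; exists s' => //.
    by rewrite /k E natrK.
  rewrite (count_slices TK sP kP) natr_sum; apply: eq_big_seq => p pT.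
  by have [_ /(_ t t0)[s' sP' E] _] := phiP p pT; rewrite /k E natrK.
- move=> t t0.
  have [x [c c0 ->]|s sP] := @cone_slice_enumerates
    (fun x => exists2 c : 'rV_N, forall i, 0 < c 0 i & x = c *m V) t.
    by exists c; split => // i; [exact: ltW|rewrite inE].
  exists s => //; rewrite horner_sum.
  pose k p := Num.truncn ((-1) ^+ e * (phi p).[- t%:R]).
  have kE p s' : (phi p).[- t%:R] = (-1) ^+ e * (size s')%:R -> k p = size s'.
    move=> E; rewrite /k E mulrA -exprD addnn -mul2n exprM sqrrN expr1n.
    by rewrite expr1n mul1r natrK.
  have kP p : p \in T -> exists2 s',
      enumerates (fun x => halfopen_cone p.1 [ffun l => ~~ p.2 l] x
        /\ height x = t%:R) s' & k p = size s'.
    by move=> /phiP[_ _ /(_ t t0)[s' sP' E]]; exists s' => //; exact: kE.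
  rewrite (count_slices TKo sP kP) natr_sum mulr_sumr; apply: eq_big_seq => p pT.
  by have [_ _ /(_ t t0)[s' sP' E]] := phiP p pT; rewrite (kE _ p s').
Qed.

End ConeEhrhart.

(** * Bases of saturated lattices *)

Section LatticeBasis.
Variable R : realType.

(** Smith normal form: the rows of the unimodular right factor [G] at nonzero diagonal entries span
    the row space of [D]. The integral inverse of [G] reads off coefficients, so integral
    combinations have integral coefficients. *)
Lemma integral_basis_exists m n (D : 'M[R]_(m, n)) :
  (forall i j, D i j \is a Num.int) ->
  exists k (B : 'M[R]_(k, n)), [/\ row_free B, (B :=: D)%MS,
    forall i j, B i j \is a Num.int &
    forall c : 'rV_k, integral (c *m B) -> integral c].
Proof.
move=> intD.
have [L uL [G uG [d _ E]]] := int_Smith_normal_form (map_mx Num.floor D).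
pose toR k l (A : 'M[int]_(k, l)) : 'M[R]_(k, l) := map_mx intr A.
have DE : D = toR _ _ (map_mx Num.floor D).
  by apply/matrixP => i j; rewrite !mxE floorK.
pose Delta : 'M[int]_(m, n) := \matrix_(i, j) (d`_i *+ (i == j :> nat)).
pose J := [set j : 'I_n | (j < m)%N && (d`_j != 0)]%SET.
pose f := @enum_val _ (mem J).
have BG : rowsub f (toR _ _ G) *m colsub f (toR _ _ (invmx G)) = 1%:M.
  rewrite mul_rowsub_mx mulmx_colsub -map_mxM mulmxV // map_mx1.
  by apply/matrixP => i j; rewrite !mxE (inj_eq enum_val_inj).
have rowDG i j : (toR _ _ (Delta *m G)) i j
    = \sum_(k < n) (d`_i *+ (i == k :> nat))%:~R * (G k j)%:~R.
  by rewrite !mxE rmorph_sum; apply: eq_bigr => k _; rewrite !mxE rmorphM.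
have DEG : D = toR _ _ L *m toR _ _ (Delta *m G).
  by rewrite DE E -map_mxM mulmxA.
have uLR : toR _ _ L \in unitmx.
  by rewrite unitmxE det_map_mx rmorph_unit // -unitmxE.
have eqD : (D :=: toR _ _ (Delta *m G))%MS.
  rewrite DEG; exact: eqmxMfull (etrans (row_full_unit _) uLR).
exists #|J|, (rowsub f (toR _ _ G)); split.
- by apply/row_freeP; exists (colsub f (toR _ _ (invmx G))).
- apply: eqmx_trans (eqmx_sym eqD); apply/eqmxP/andP; split.
    apply/row_subP => k; rewrite row_rowsub.
    have := enum_valP k; rewrite -/(f k) inE => /andP[lt_m dk].
    have -> : row (f k) (toR _ _ G) =
        (d`_(f k))%:~R^-1 *: row (Ordinal lt_m) (toR _ _ (Delta *m G)).
      apply/rowP => j; rewrite [RHS]mxE [in RHS]mxE rowDG (bigD1 (f k)) //= eqxx.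
      rewrite big1 ?addr0 => [|l]; last first.
        by rewrite eq_sym -val_eqE /= => /negPf->; rewrite mul0r.
      by rewrite mulrA mulVf ?mul1r ?intr_eq0 // !mxE.
    by rewrite scalemx_sub // row_sub.
  apply/row_subP => i; have [lt_n|le_n] := ltnP i n; last first.
    suff -> : row i (toR _ _ (Delta *m G)) = 0 by exact: sub0mx.
    apply/rowP => j; rewrite [LHS]mxE rowDG big1 ?mxE // => k _.
    by rewrite gtn_eqF ?mul0r // (leq_trans (ltn_ord k)).
  have -> : row i (toR _ _ (Delta *m G)) =
      (d`_i)%:~R *: row (Ordinal lt_n) (toR _ _ G).
    apply/rowP => j; rewrite [LHS]mxE rowDG (bigD1 (Ordinal lt_n)) //= eqxx.
    rewrite big1 ?addr0 => [|l]; first by rewrite !mxE.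
    by rewrite eq_sym -val_eqE /= => /negPf->; rewrite mul0r.
  have [->|di] := eqVneq d`_i 0; first by rewrite scale0r sub0mx.
  have iJ : Ordinal lt_n \in J by rewrite inE /= ltn_ord.
  rewrite scalemx_sub // -[Ordinal lt_n](enum_rankK_in iJ iJ).
  by rewrite -(row_rowsub f) row_sub.
- by move=> i j; rewrite !mxE intr_int.
- move=> c ic; have -> : c = c *m rowsub f (toR _ _ G) *m colsub f (toR _ _ (invmx G)).
    by rewrite -mulmxA BG mulmx1.
  move=> j; rewrite mxE rpred_sum // => l _; rewrite rpredM //.
  by rewrite !mxE intr_int.
Qed.

End LatticeBasis.

Local Open Scope classical_set_scope.
Local Open Scope ring_scope.

(** * Polytopes as hulls of rows *)

Section Hull.
Variable R : realType.

Lemma lattice_count_size n (A : set 'rV[R]_n) s : enumerates A s ->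
  lattice_count A = size s.
Proof.
move=> [us sP]; rewrite /lattice_count.
have -> : A `&` @integral_points R n = [set` [fset x in s]%fset].
  apply/seteqP; split=> x /=; rewrite inE /=; first by move=> [Ax ix]; apply/sP.
  by move=> /sP[].
by rewrite set_fsetK card_fseq undup_id.
Qed.

Definition hull N n (S : 'M[R]_(N, n)) : set 'rV[R]_n :=
  [set x | exists c : 'rV_N, [/\ nonneg c, \sum_i c 0 i = 1 & x = c *m S]].

Lemma mulmx_rows N n (S : 'M[R]_(N, n)) (w : 'I_N -> R) :
  \sum_i w i *: row i S = (\row_i w i) *m S.
Proof. by rewrite mulmx_sum_row; apply: eq_bigr => i _; rewrite mxE. Qed.

Lemma sum_delta N (i : 'I_N) (f : 'I_N -> R) :
  \sum_j (delta_mx 0 i : 'rV[R]_N) 0 j * f j = f i.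
Proof.
rewrite (bigD1 i) //= mxE !eqxx mul1r big1 ?addr0 // => j /negPf ji.
by rewrite mxE ji andbF mul0r.
Qed.

Lemma sum_delta1 N (i : 'I_N) : \sum_j (delta_mx 0 i : 'rV[R]_N) 0 j = 1.
Proof.
by rewrite -[RHS](sum_delta i (fun=> 1)); apply: eq_bigr => j _; rewrite mulr1.
Qed.

Lemma hull_row N n (S : 'M[R]_(N, n)) i : hull S (row i S).
Proof.
exists (delta_mx 0 i); split; last by rewrite rowE.
  by move=> j; rewrite mxE ler0n.
exact: sum_delta1.
Qed.

Lemma hull_affine N n (S : 'M[R]_(N, n)) k (v : 'I_k -> 'rV[R]_n) :
  (forall i, hull S (v i)) -> exists C : 'M[R]_(k, N),
  [/\ forall i j, 0 <= C i j, forall i, \sum_j C i j = 1 &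
      forall w : 'I_k -> R, \sum_i w i *: v i = (\row_i w i) *m C *m S].
Proof.
move=> /choice[c cP]; exists (\matrix_i c i); split.
- by move=> i j; rewrite mxE; have [/(_ j)] := cP i.
- by move=> i; under eq_bigr do rewrite mxE; have [] := cP i.
- move=> w; rewrite -mulmxA -mulmx_rows; apply: eq_bigr => i _; congr (_ *: _).
  by have [_ _ ->] := cP i; rewrite row_mul rowK.
Qed.

Lemma sum_mul_stochastic N k (w : 'I_k -> R) (C : 'M[R]_(k, N)) :
  (forall i, \sum_j C i j = 1) ->
  \sum_j ((\row_i w i) *m C) 0 j = \sum_i w i.
Proof.
move=> C1; under eq_bigr => j _ do rewrite mxE.
rewrite exchange_big /=; apply: eq_bigr => i _.
by rewrite -mulr_sumr C1 mulr1 mxE.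
Qed.

Lemma convex_hull_rows N n (S : 'M[R]_(N, n)) :
  convex_hull [set row i S | i in setT] = hull S.
Proof.
apply/seteqP; split=> x.
  move=> [k [v [w [vS w0 w1 ->]]]].
  have [|C [C0 C1 CE]] := @hull_affine _ _ S k v.
    by move=> i; have [j _ <-] := vS i; exact: hull_row.
  exists ((\row_i w i) *m C); split; last by rewrite CE.
    move=> j; rewrite mxE; apply: sumr_ge0 => i _.
    by rewrite mxE mulr_ge0.
  by rewrite sum_mul_stochastic.
move=> [c [c0 c1 ->]]; exists N, (fun i => row i S), (fun i => c 0 i); split => //.
by rewrite mulmx_sum_row.
Qed.

Lemma polytope_hull n (P : set 'rV[R]_n) : polytope P ->
  exists N (S : 'M[R]_(N, n)), P = hull S.
Proof.
move=> [s ->]; exists (size s), (\matrix_(i < size s) s`_i).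
rewrite -convex_hull_rows; congr convex_hull; apply/seteqP; split=> x /=.
  move=> xs; have lt_i : (index x s < size s)%N by rewrite index_mem.
  by exists (Ordinal lt_i) => //; rewrite rowK /= nth_index.
by move=> [i _ <-]; rewrite rowK mem_nth.
Qed.

Lemma affine_hull_hull N n (S : 'M[R]_(N, n)) :
  affine_hull (hull S) = [set x | exists2 c : 'rV_N, \sum_i c 0 i = 1 & x = c *m S].
Proof.
apply/seteqP; split=> x.
  move=> [k [v [w [vS w1 ->]]]]; have [C [_ C1 CE]] := hull_affine vS.
  by exists ((\row_i w i) *m C); rewrite ?sum_mul_stochastic.
move=> [c c1 ->]; exists N, (fun i => row i S), (fun i => c 0 i); split => //.
  by move=> i; exact: hull_row.
by rewrite mulmx_sum_row.
Qed.

Definition edges N n (S : 'M[R]_(N, n)) (i0 : 'I_N) : 'M[R]_(N, n) :=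
  \matrix_i (row i S - row i0 S).

Lemma mul_edges N n (S : 'M[R]_(N, n)) (i0 : 'I_N) (c : 'rV[R]_N) :
  c *m edges S i0 = c *m S - (\sum_i c 0 i) *: row i0 S.
Proof.
rewrite !mulmx_sum_row scaler_suml -sumrB; apply: eq_bigr => i _.
by rewrite rowK scalerBr.
Qed.

Lemma direction_hull N n (S : 'M[R]_(N, n)) (i0 : 'I_N) :
  direction (hull S) = [set x | (x <= edges S i0)%MS].
Proof.
rewrite /direction affine_hull_hull; apply/seteqP; split=> x /=.
  move=> [_ [c c1 ->] [_ [c' c1' ->] <-]].
  apply/submxP; exists (c - c'); rewrite mul_edges mulmxBl.
  under eq_bigr do rewrite !mxE; rewrite sumrB c1 c1' subrr scale0r subr0 //.
move=> /submxP[c ->].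
exists ((c + (1 - \sum_i c 0 i) *: delta_mx 0 i0) *m S).
  exists (c + (1 - \sum_i c 0 i) *: delta_mx 0 i0) => //.
  under eq_bigr do rewrite !mxE /= -[(_ == i0)%:R]mulr1.
  rewrite big_split /= -mulr_sumr.
  have -> : \sum_(i < N) (i == i0)%:R * 1 = 1 :> R.
    rewrite -[RHS](sum_delta i0 (fun=> 1)); apply: eq_bigr => i _.
    by rewrite mxE.
  by rewrite mulr1 addrC subrK.
exists (row i0 S).
  exists (delta_mx 0 i0); last by rewrite rowE.
  exact: sum_delta1.
by rewrite mul_edges mulmxDl -scalemxAl -rowE scalerBl scale1r addrA addrAC addrK.
Qed.

Lemma has_dim_hull N n (S : 'M[R]_(N, n)) (i0 : 'I_N) p :
  has_dim (hull S) p <-> p = \rank (edges S i0).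
Proof.
split.
  move=> [_ [B freeB E]]; rewrite (direction_hull S i0) in E.
  suff H : (edges S i0 == B)%MS by rewrite (eqmx_rank H); apply/esym/eqP.
  apply/andP; split; apply/row_subP => i.
    have : [set x | (x <= edges S i0)%MS] (row i (edges S i0)) by exact: row_sub.
    by rewrite E => -[c _ <-]; exact: submxMl.
  suff : [set x | (x <= edges S i0)%MS] (row i B) by [].
  by rewrite E; exists (delta_mx 0 i); rewrite // -rowE.
move=> ->; split; first by exists (row i0 S); exact: hull_row.
exists (row_base (edges S i0)); first exact: row_base_free.
rewrite (direction_hull S i0); apply/seteqP; split=> x /=.
  by rewrite -(eq_row_base (edges S i0)) => /submxP[c ->]; exists c.
by move=> [c _ <-]; rewrite -(eq_row_base (edges S i0)) submxMl.
Qed.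

Lemma cvg_sum (I T : Type) (r : seq I) (F : set_system T) (FF : Filter F)
    (f : I -> T -> R) (l : I -> R) :
  (forall i, f i x @[x --> F] --> l i) ->
  \sum_(i <- r) f i x @[x --> F] --> \sum_(i <- r) l i.
Proof.
move=> fl; elim: r => [|i r IH].
  by rewrite big_nil; under eq_cvg do rewrite big_nil; exact: cvg_cst.
rewrite big_cons; under eq_cvg do rewrite big_cons.
exact: cvgD (fl i) IH.
Qed.

(** For the inclusion from left to right, the segment from the barycentre of the rows through [x]
    can be prolonged beyond [x] inside the hull, so [x] is a proper mixture of the barycentre and a
    point of the hull, and all its coefficients are positive. *)
Lemma relint_hull N n (S : 'M[R]_(N, n)) : relint (hull S) =
  [set x | exists c : 'rV_N,
    [/\ forall i, 0 < c 0 i, \sum_i c 0 i = 1 & x = c *m S]].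
Proof.
apply/seteqP; split=> x /=.
  move=> [[c [c0 c1 xE]] nx].
  have N0 : (0 < N)%N.
    by case: N S c c0 c1 xE nx => // S c _ + _ _; rewrite big_ord0 => /esym/eqP; rewrite oner_eq0.
  pose b : 'rV[R]_N := const_mx N%:R^-1.
  have b1 : \sum_i b 0 i = 1.
    under eq_bigr do rewrite mxE.
    by rewrite sumr_const card_ord -[LHS]mulr_natr mulVf // pnatr_eq0 -lt0n.
  pose y e := x + e *: (x - b *m S).
  have yx : y e @[e --> (0 : R)] --> x.
    rewrite -[X in _ --> X]addr0 -[X in _ + X](scale0r (x - b *m S)).
    by apply: cvgD; [exact: cvg_cst|apply: cvgZl; exact: cvg_id].
  have : \forall e \near 0^'+, hull S (y e).
    have HS : \forall e \near (0 : R), hull S (y e).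
      have H := yx _ nx; near=> e.
      have : affine_hull (hull S) (y e) -> hull S (y e) by near: e.
      apply; rewrite affine_hull_hull; exists (c + e *: (c - b)).
        under eq_bigr do rewrite !mxE; rewrite big_split /= -mulr_sumr sumrB c1.
        have -> : \sum_(i < N) N%:R^-1 = 1 :> R.
          rewrite -[RHS]b1. apply: eq_bigr => i _; by rewrite mxE.
        by rewrite subrr mulr0 addr0.
      by rewrite mulmxDl -scalemxAl mulmxBl -xE.
    by apply: cvg_within; exact: HS.
  move=> Hr.
  have [e [e0 [d [d0 d1 yE]]]] : exists e : R, 0 < e /\ hull S (y e).
    near (0 : R)^'+ => e; exists e; split; last by near: e.
    by near: e; exact: nbhs_right_gt.
  have e1 : 1 + e != 0 by rewrite gt_eqF // addr_gt0.
  exists ((1 + e)^-1 *: (d + e *: b)); split.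
  - move=> i; rewrite !mxE; apply: mulr_gt0; first by rewrite invr_gt0 addr_gt0.
    by rewrite ltr_wpDl // mulr_gt0 // invr_gt0 ltr0n.
  - under eq_bigr do rewrite 2!mxE [(e *: b) _ _]mxE.
    by rewrite -mulr_sumr big_split /= -mulr_sumr d1 b1 mulr1 mulVf.
  - rewrite -scalemxAl mulmxDl -yE -scalemxAl /y scalerBr addrA subrK.
    by rewrite -{2}[x]scale1r -scalerDl scalerA mulVf // scale1r.
move=> [c [c0 c1 xE]]; split.
  by exists c; split => // i; exact: ltW.
(* The pseudo-inverse of the homogenized rows yields a correction [g y] that is linear in [y - x]
   and represents it whenever [y] is in the affine hull. Near [x] it is too small to destroy
   positivity of the coefficients. *)
pose V := row_mx S (const_mx 1 : 'M[R]_(N, 1)).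
pose T := pinvmx V.
pose g (y : 'rV[R]_n) : 'rV[R]_N := row_mx (y - x) 0 *m T.
have gE y j : g y 0 j = \sum_k (y 0 k - x 0 k) * T (lshift 1 k) j.
  rewrite /g mxE big_split_ord /= [X in _ + X]big1 ?addr0 => [|k _].
    by apply: eq_bigr => k _; rewrite row_mxEl !mxE.
  by rewrite row_mxEr mxE mul0r.
have gc j : g y 0 j @[y --> x] --> (0 : R).
  have -> : (fun y => g y 0 j) = (fun y => \sum_k (y 0 k - x 0 k) * T (lshift 1 k) j).
    by apply/funext => y; exact: gE.
  rewrite [X in _ --> X](_ : 0 = \sum_k (x 0 k - x 0 k) * T (lshift 1 k) j); last first.
    by rewrite big1 // => k _; rewrite subrr mul0r.
  apply: (@cvg_sum _ _ _ (nbhs x) _ (fun k (y : 'rV[R]_n) => (y 0 k - x 0 k) * T (lshift 1 k) j)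
    (fun k => (x 0 k - x 0 k) * T (lshift 1 k) j)) => k.
  apply: cvgMr_tmp; apply: cvgB; last exact: cvg_cst.
  exact: coord_continuous.
have : \forall y \near x, forall j, 0 < c 0 j + g y 0 j.
  apply: (@filter_forall _ 'I_N (fun j y => 0 < c 0 j + g y 0 j) (nbhs x)) => j.
  have c0' : - c 0 j < 0 by rewrite oppr_lt0.
  by apply: filterS (cvgr_gt _ (gc j) _ c0') => y; rewrite -subr_gt0 opprK addrC.
apply: filterS => y Hy; rewrite affine_hull_hull => -[d d1 yE].
have gV : g y *m V = row_mx (y - x) 0.
  rewrite /g mulmxKpV //; apply/submxP; exists (d - c).
  rewrite mul_mx_row mulmxBl -yE -xE; congr row_mx.
  apply/rowP => i; rewrite !mxE; under eq_bigr do rewrite !mxE mulr1.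
  by rewrite sumrB d1 c1 subrr.
move: gV; rewrite mul_mx_row => /eq_row_mx[gS g1].
exists (c + g y); split.
- by move=> j; rewrite mxE ltW.
- under eq_bigr do rewrite mxE; rewrite big_split /= c1.
  suff -> : \sum_i g y 0 i = 0 by rewrite addr0.
  have /rowP/(_ 0) := g1; rewrite mxE [RHS]mxE => E; rewrite -[RHS]E.
  by apply: eq_bigr => i _; rewrite [const_mx _ _ _]mxE mulr1.
- by rewrite mulmxDl gS -xE addrC subrK.
Unshelve. all: by end_near.
Qed.

End Hull.

(** * Ehrhart polynomials of lattice polytopes *)

Section HullEhrhart.
Variable R : realType.

Lemma dilate_hull N n (S : 'M[R]_(N, n)) t : dilate t (hull S) = hull (t%:R *: S).
Proof.
apply/seteqP; split=> x.
  by move=> [_ [c [c0 c1 ->]] <-]; exists c; split => //; rewrite -scalemxAr.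
by move=> [c [c0 c1 ->]]; exists (c *m S); [exists c|rewrite -scalemxAr].
Qed.

Lemma dilate_hullP N n (S : 'M[R]_(N, n)) t x : (0 < t)%N ->
  dilate t (hull S) x <->
  exists c : 'rV_N, [/\ nonneg c, \sum_i c 0 i = t%:R & x = c *m S].
Proof.
move=> t0; have tR : 0 < t%:R :> R by rewrite ltr0n.
rewrite dilate_hull; split=> [[c [c0 c1 ->]]|[c [c0 c1 ->]]].
  exists (t%:R *: c); split; last by rewrite -scalemxAl -scalemxAr.
    by move=> i; rewrite mxE mulr_ge0 // ltW.
  by under eq_bigr do rewrite mxE; rewrite -mulr_sumr c1 mulr1.
exists (t%:R^-1 *: c); split.
- by move=> i; rewrite mxE mulr_ge0 // invr_ge0 ltW.
- by under eq_bigr do rewrite mxE; rewrite -mulr_sumr c1 mulVf // gt_eqF.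
- by rewrite -scalemxAl -scalemxAr scalerA mulVf ?gt_eqF // scale1r.
Qed.

Lemma relint_dilate_hullP N n (S : 'M[R]_(N, n)) t x : (0 < t)%N ->
  relint (dilate t (hull S)) x <->
  exists c : 'rV_N,
    [/\ forall i, 0 < c 0 i, \sum_i c 0 i = t%:R & x = c *m S].
Proof.
move=> t0; have tR : 0 < t%:R :> R by rewrite ltr0n.
rewrite dilate_hull relint_hull; split=> [[c [c0 c1 ->]]|[c [c0 c1 ->]]].
  exists (t%:R *: c); split; last by rewrite -scalemxAl -scalemxAr.
    by move=> i; rewrite mxE mulr_gt0.
  by under eq_bigr do rewrite mxE; rewrite -mulr_sumr c1 mulr1.
exists (t%:R^-1 *: c); split.
- by move=> i; rewrite mxE mulr_gt0 // invr_gt0.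
- by under eq_bigr do rewrite mxE; rewrite -mulr_sumr c1 mulVf // gt_eqF.
- by rewrite -scalemxAl -scalemxAr scalerA mulVf ?gt_eqF // scale1r.
Qed.

Definition integral_mx m n (A : 'M[R]_(m, n)) := forall i j, A i j \is a Num.int.

Lemma integral_mx_mul m n k (A : 'M[R]_(m, n)) (B : 'M[R]_(n, k)) :
  integral_mx A -> integral_mx B -> integral_mx (A *m B).
Proof. by move=> iA iB i j; rewrite mxE rpred_sum // => l _; rewrite rpredM. Qed.

Lemma integral_mx_row n (x : 'rV[R]_n) : integral_mx x <-> integral x.
Proof. by split=> H j => [|k]; rewrite ?ord1 //; apply: H. Qed.

Lemma integral_edges N n (S : 'M[R]_(N, n)) i0 :
  integral_mx S -> integral_mx (edges S i0).
Proof. by move=> iS i j; rewrite !mxE rpredB. Qed.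

Lemma lattice_basis_exists N n (S : 'M[R]_(N, n)) (i0 : 'I_N) p :
  integral_mx S -> has_dim (hull S) p ->
  exists B : 'M[R]_(p, n), lattice_basis (hull S) B.
Proof.
move=> iS /(has_dim_hull S i0) pE.
have [k [B [freeB BE iB Blat]]] := integral_basis_exists (integral_edges i0 iS).
have kp : k = p by rewrite pE -BE; apply/esym/eqP.
case: _ / kp {pE} => {p}; exists B; split => //; rewrite (direction_hull S i0).
apply/seteqP; split=> x /=.
  move=> [xE ix]; move: xE; rewrite -BE => /submxP[c xc].
  by exists c => //; apply: Blat; rewrite -xc.
move=> [c ic <-]; split; first by rewrite -BE submxMl.
apply/integral_mx_row; apply: integral_mx_mul => //.
exact/integral_mx_row.
Qed.

Section LatticeCoordinates.
Variables (N n p : nat) (S : 'M[R]_(N, n)) (i0 : 'I_N) (B : 'M[R]_(p, n)).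
Hypothesis iS : integral_mx S.
Hypothesis LB : lattice_basis (hull S) B.

Lemma lattice_basis_row_free : row_free B. Proof. by case: LB. Qed.

Lemma lattice_basisP x : (x <= edges S i0)%MS /\ integral x <->
  exists2 c, integral c & c *m B = x.
Proof.
have [_] := LB; rewrite (direction_hull S i0) => /seteqP[H1 H2].
split=> [H|H]; first by have [c ic <-] := H1 x H; exists c.
by have := H2 x H.
Qed.

Lemma lattice_basis_integral : integral_mx B.
Proof.
move=> i j; have [|_ /(_ j)] := (lattice_basisP (row i B)).2.
  exists (delta_mx 0 i); last by rewrite rowE.
  by move=> k; rewrite mxE; case: eqP.
by rewrite mxE.
Qed.

Lemma lattice_basis_eqmx : (B :=: edges S i0)%MS.
Proof.
apply/eqmxP/andP; split; apply/row_subP => i.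
  have [|+ _] := (lattice_basisP (row i B)).2; last by [].
  exists (delta_mx 0 i); last by rewrite rowE.
  by move=> k; rewrite mxE; case: eqP.
have [|c _ <-] := (lattice_basisP (row i (edges S i0))).1; last exact: submxMl.
split; first exact: row_sub.
by move=> j; rewrite mxE; exact: integral_edges.
Qed.

Lemma lattice_basis_saturated c : integral (c *m B) -> integral c.
Proof.
move=> ic; have [|c' ic' E] := (lattice_basisP (c *m B)).1.
  by split => //; rewrite -lattice_basis_eqmx submxMl.
by have := row_free_inj lattice_basis_row_free E => <-.
Qed.

Lemma lattice_coordinates : exists2 U : 'M[R]_(N, p), integral_mx U &
  edges S i0 = U *m B.
Proof.
have : (edges S i0 <= B)%MS by rewrite lattice_basis_eqmx.
move=> /submxP[U UE]; exists U => // i j.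
have : integral (row i U *m B).
  by rewrite -row_mul -UE => k; rewrite mxE; exact: integral_edges.
by move/lattice_basis_saturated/(_ j); rewrite mxE.
Qed.

Lemma lattice_coordinates_hull (U : 'M[R]_(N, p)) (c : 'rV[R]_N) (s : R) :
  edges S i0 = U *m B -> \sum_i c 0 i = s ->
  c *m S = s *: row i0 S + (c *m U) *m B.
Proof.
by move=> UE <-; rewrite -mulmxA -UE mul_edges addrC subrK.
Qed.

(** Generators of the cone over the polytope in lattice coordinates. The first coordinate is the
    height, so dilates by [t] are slices at height [t]. *)
Let V (U : 'M[R]_(N, p)) : 'M[R]_(N, p.+1) := row_mx (const_mx 1 : 'cV_N) U.
Let h : 'cV[R]_p.+1 := delta_mx 0 0.

Let heightE (x : 'rV[R]_p.+1) : (x *m h) 0 0 = x 0 0.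
Proof. by rewrite -colE mxE. Qed.

Lemma homogenize_mul U (c : 'rV[R]_N) :
  c *m V U = row_mx (\sum_i c 0 i)%:M (c *m U) :> 'rV_(1 + p).
Proof.
apply: (etrans (mul_mx_row c (const_mx 1 : 'cV_N) U)).
congr row_mx; apply/rowP => j; rewrite ord1 !mxE eqxx mulr1n.
by apply: eq_bigr => i _; rewrite mxE mulr1.
Qed.

Lemma row_mx_head k (A : 'cV[R]_k) (U : 'M[R]_(k, p)) i :
  (row_mx A U : 'M[R]_(k, p.+1)) i 0 = A i 0.
Proof.
have -> : 0 = lshift p (0 : 'I_1) :> 'I_p.+1 by exact: val_inj.
exact: (row_mxEl A U i 0).
Qed.

Lemma integral_row_mx k m (A : 'cV[R]_k) (U : 'M[R]_(k, m)) :
  integral_mx A -> integral_mx U -> integral_mx (row_mx A U : 'M[R]_(k, 1 + m)).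
Proof.
move=> iA iU i j; case: (split_ordP j) => l ->; first by rewrite row_mxEl.
by rewrite row_mxEr.
Qed.

Lemma homogenize_rank U : edges S i0 = U *m B -> \rank (V U) = p.+1.
Proof.
move=> UE; apply/eqP; rewrite -[_ == _]/(row_full (V U)) -sub1mx.
apply/row_subP => k; move: (row k _) => {k} x.
rewrite -[x](@hsubmxK _ 1 1 p); set a := lsubmx _; set u := rsubmx _.
have : (u *m B <= edges S i0)%MS by rewrite -lattice_basis_eqmx submxMl.
move=> /submxP[c cE].
have uE : u = c *m U.
  by apply: (row_free_inj lattice_basis_row_free); rewrite cE UE mulmxA.
have U0 : row i0 U = 0.
  apply: (row_free_inj lattice_basis_row_free); rewrite /= -row_mul -UE mul0mx.
  by rewrite rowK subrr.
(* Row [i0] of [U] is zero, so coefficient [i0] can adjust the sum without changing the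
   combination. *)
pose c' := c + (a 0 0 - \sum_i c 0 i) *: delta_mx 0 i0.
have c'U : c' *m U = u by rewrite mulmxDl -scalemxAl -rowE U0 scaler0 addr0.
have c'1 : (\sum_i c' 0 i)%:M = a.
  apply/rowP => j; rewrite ord1 mxE eqxx mulr1n.
  under eq_bigr do rewrite mxE [X in _ + X]mxE.
  by rewrite big_split /= -mulr_sumr sum_delta1 mulr1 addrC subrK.
by apply/submxP; exists c'; rewrite homogenize_mul c'1 c'U.
Qed.

(** The translation by the integral point [t%:R *: row i0 S] followed by [B] matches lattice points
    in both directions, since [B] is integral and saturated. The parameter [Q] covers both closed
    and open cones. *)
Lemma slice_enumerates U (Q : 'rV[R]_N -> Prop) (t : nat) s :
  integral_mx U -> edges S i0 = U *m B ->
  enumerates (fun x => (exists2 c, Q c & x = c *m V U) /\ (x *m h) 0 0 = t%:R) s ->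
  enumerates (fun y => exists c : 'rV_N, [/\ Q c, \sum_i c 0 i = t%:R & y = c *m S])
    [seq t%:R *: row i0 S + rsubmx (x : 'rV_(1 + p)) *m B | x <- s].
Proof.
move=> iU UE [us sP].
have irow (c : R) : c \is a Num.int -> integral (c *: row i0 S).
  by move=> ic j; rewrite !mxE rpredM.
split.
  rewrite map_inj_in_uniq // => x x' xs xs' /addrI.
  have [_ [_ hx]] := (sP x).1 xs; have [_ [_ hx']] := (sP x').1 xs'.
  move/(row_free_inj lattice_basis_row_free) => E.
  rewrite -[x](@hsubmxK _ 1 1 p) -[x'](@hsubmxK _ 1 1 p) E; congr row_mx.
  apply/rowP => j; rewrite ord1 !mxE.
  have -> : lshift p (0 : 'I_1) = 0 :> 'I_p.+1 by exact: val_inj.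
  by move: hx hx'; rewrite !heightE => -> ->.
move=> y; split.
  case/mapP => x xs ->; have [ix [[c Qc xE] hx]] := (sP x).1 xs.
  have cs : \sum_i c 0 i = t%:R.
    rewrite -hx xE heightE homogenize_mul.
    by rewrite row_mx_head mxE eqxx mulr1n.
  have xU : rsubmx (x : 'rV_(1 + p)) = c *m U.
    by rewrite xE homogenize_mul row_mxKr.
  split; last by exists c; split => //; rewrite xU (lattice_coordinates_hull UE cs).
  move=> j; rewrite mxE rpredD //; first exact: irow.
  apply: (integral_mx_mul _ lattice_basis_integral) => i k.
  by rewrite mxE ord1 ix.
move=> [iy [c [Qc cs yE]]]; apply/mapP; exists (c *m V U); last first.
  by rewrite yE (lattice_coordinates_hull UE cs) homogenize_mul row_mxKr.
apply/sP; split; last first.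
  split; first by exists c.
  by rewrite heightE homogenize_mul row_mx_head mxE eqxx mulr1n cs.
have icU : integral (c *m U).
  apply: lattice_basis_saturated => j.
  have -> : c *m U *m B = y - t%:R *: row i0 S.
    by rewrite yE (lattice_coordinates_hull UE cs) addrC addKr.
  by rewrite mxE rpredD // mxE rpredN; apply: irow.
apply/integral_mx_row; rewrite homogenize_mul cs; apply: integral_row_mx.
  by move=> i j; rewrite mxE rpredMn // natr_int.
exact/integral_mx_row.
Qed.

Theorem lattice_hull_ehrhart : exists phi : {poly R},
  [/\ (size phi <= p.+1)%N,
    forall t, (0 < t)%N -> phi.[t%:R] = (lattice_count (dilate t (hull S)))%:R &
    forall t, (0 < t)%N -> phi.[- t%:R] =
      (-1) ^+ p * (lattice_count (relint (dilate t (hull S))))%:R].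
Proof.
have [U iU UE] := lattice_coordinates.
have intV i j : V U i j \is a Num.int.
  by apply: integral_row_mx => // k l; rewrite mxE.
have inth j : h j 0 \is a Num.int by rewrite mxE; case: eqP.
have Vh i : (V U *m h) i 0 = 1.
  by rewrite -colE mxE row_mx_head mxE.
have [phi [sz phi1 phi2]] := cone_ehrhart intV inth Vh (homogenize_rank UE).
exists phi; split => // t t0.
  have [s sP ->] := phi1 t t0.
  have := @slice_enumerates U (@nonneg R N) t s iU UE.
  case=> [|us usP].
    split; first exact: sP.1.
    move=> x; split.
      move=> /(sP.2 x).1[ix [[c [c0 _ xE]] hx]]; split=> //; split => //; by exists c.
    move=> [ix [[c c0 xE] hx]]; apply/(sP.2 x); split=> //; split => //.
    by exists c; split => // i; rewrite inE.
  congr _%:R; rewrite -(size_map (fun x => t%:R *: row i0 S + rsubmx (x : 'rV_(1 + p)) *m B)).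
  apply/esym/lattice_count_size; split => // x; split.
    by move=> /usP[ix Hx]; split => //; apply/dilate_hullP.
  by move=> [ix /(dilate_hullP _ _ t0) Hx]; apply/usP.
have [s sP ->] := phi2 t t0; congr (_ * _).
have [us usP] := @slice_enumerates U (fun c => forall i, 0 < c 0 i) t s iU UE sP.
congr _%:R; rewrite -(size_map (fun x => t%:R *: row i0 S + rsubmx (x : 'rV_(1 + p)) *m B)).
apply/esym/lattice_count_size; split => // x; split.
  by move=> /usP[ix Hx]; split => //; apply/relint_dilate_hullP.
by move=> [ix /(relint_dilate_hullP _ _ t0) Hx]; apply/usP.
Qed.

End LatticeCoordinates.
End HullEhrhart.

(** * The leading coefficient is the volume *)

Section TopCoefficient.
Variable R : realType.

Lemma coefM_top (f g : {poly R}) a b : (size f <= a.+1)%N -> (size g <= b.+1)%N ->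
  (size (f * g)%R <= (a + b).+1)%N /\ (f * g)`_(a + b) = f`_a * g`_b.
Proof.
move=> sf sg; split.
  apply: (leq_trans (size_polyMleq _ _)); lia.
rewrite coefM (bigD1 (inord a)) //= inordK; last by lia.
rewrite addKn big1 ?addr0 // => i; rewrite -val_eqE /= inordK; last by lia.
move=> ia; have [lt_i|le_i] := ltnP i a.
  have -> : g`_(a + b - i) = 0.
    by rewrite nth_default // (leq_trans sg) // ltn_subRL ltn_add2r.
  by rewrite mulr0.
have -> : f`_i = 0.
  by rewrite nth_default // (leq_trans sf) // ltn_neqAle eq_sym ia.
by rewrite mul0r.
Qed.

Lemma coef_prod_top p (f : 'I_p -> {poly R}) : (forall j, (size (f j) <= 2)%N) ->
  (size (\prod_j f j)%R <= p.+1)%N /\ (\prod_j f j)`_p = \prod_j (f j)`_1.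
Proof.
elim: p f => [|p IH] f sf; first by rewrite !big_ord0 size_poly1 coef1.
rewrite !big_ord_recr /=.
have [sz E] := IH (fun j => f (widen_ord (leqnSn p) j)) (fun j => sf _).
by have [] := coefM_top sz (sf ord_max); rewrite addn1 E.
Qed.

Lemma coef_top_ge0 (f : {poly R}) p (T : nat) : (size f <= p.+1)%N ->
  (forall t, (T <= t)%N -> 0 <= f.[t%:R]) -> 0 <= f`_p.
Proof.
move=> sf f0; rewrite leNgt; apply/negP => fp.
case: p sf fp => [|p] sf fp.
  have := f0 T (leqnn T); rewrite (size1_polyC sf) hornerC; lra.
pose C := \sum_(i < p.+1) `|f`_i|.
have C0 : 0 <= C by apply: sumr_ge0.
(* Large enough for the hypothesis and for the negative top term to outweigh the sum of all lower
   ones. *)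
pose t := (T + (Num.truncn (C / - f`_p.+1)).+1)%N.
have t1 : 1 <= t%:R :> R by rewrite ler1n /t; lia.
have Ct : C < - f`_p.+1 * t%:R.
  rewrite mulrC -ltr_pdivrMr ?oppr_gt0 //; apply: (lt_le_trans (truncnS_gt _)).
  by rewrite ler_nat /t leq_addl.
have := f0 t (leq_addr _ _); rewrite (horner_coef_wide _ sf) big_ord_recr /=.
have : \sum_(i < p.+1) f`_i * t%:R ^+ i <= C * t%:R ^+ p.
  rewrite mulr_suml; apply: ler_sum => i _.
  apply: (le_trans (ler_norm _)); rewrite normrM ler_wpM2l //.
  by rewrite ger0_norm ?exprn_ge0 // ler_weXn2l // -ltnS.
have tp : 0 < t%:R ^+ p :> R by rewrite exprn_gt0 // (lt_le_trans ltr01).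
have : C * t%:R ^+ p < - f`_p.+1 * t%:R ^+ p.+1.
  by rewrite exprS mulrA ltr_pM2r.
lra.
Qed.

Lemma coef_top_le (f g : {poly R}) p (T : nat) : (size f <= p.+1)%N ->
  (size g <= p.+1)%N ->
  (forall t, (T <= t)%N -> f.[t%:R] <= g.[t%:R]) -> f`_p <= g`_p.
Proof.
move=> sf sg fg; rewrite -subr_ge0 -coefB; apply: (@coef_top_ge0 _ _ T).
  by apply: (leq_trans (size_polyD _ _)); rewrite size_polyN geq_max sg.
by move=> t tT; rewrite hornerD hornerN subr_ge0 fg.
Qed.

Lemma box_enumerates p (a b : 'I_p -> R) : (forall j, a j <= b j) ->
  exists2 s : seq 'rV[R]_p, enumerates (fun x => forall j, a j <= x 0 j <= b j) s
    & (size s)%:R <= \prod_j (b j - a j + 1).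
Proof.
move=> ab; pose m j := Num.truncn (b j - a j).
pose B := \sum_j (`|a j| + `|b j|).
have [x _ Hx j|s sP] := @bounded_enumerates R p
    (fun x => forall j, a j <= x 0 j <= b j) (Num.truncn B).+1.
  apply: (le_trans _ (ltW (truncnS_gt B))).
  have le_B : `|a j| + `|b j| <= B.
    by rewrite /B [leRHS](bigD1 j) //= lerDl sumr_ge0 // => k _; rewrite addr_ge0.
  apply: (le_trans _ le_B); have /andP[h1 h2] := Hx j.
  have := ler_norm (b j); have := ler_norm (- a j); rewrite normrN => h3 h4.
  by rewrite ler_norml; have := normr_ge0 (a j); have := normr_ge0 (b j); lra.
exists s => //.
pose F := {dffun forall j : 'I_p, 'I_(m j).+1}.
pose r := [seq \row_j ((Num.ceil (a j))%:~R + ((g : F) j : nat)%:R) | g <- enum F] : seq 'rV[R]_p.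
have /uniq_leq_size : uniq s by case: sP.
move=> /(_ r) le_s.
have : (size s <= size r)%N.
  apply: le_s => x /(sP.2 x)[ix Hx].
  have Hk j : exists k : 'I_(m j).+1, x 0 j = (Num.ceil (a j))%:~R + k%:R.
    have /andP[ax xb] := Hx j.
    have ca : (Num.ceil (a j))%:~R <= x 0 j.
      by rewrite -(floorK (ix j)) ler_int ceil_le_int floorK.
    have /natrP[k Ek] : x 0 j - (Num.ceil (a j))%:~R \is a Num.nat.
      by rewrite natrEint rpredB ?ix ?intr_int //= subr_ge0.
    have lt_k : (k < (m j).+1)%N.
      rewrite ltnS truncn_ge_nat ?subr_ge0 // -Ek lerB //.
      exact: ceil_ge.
    by exists (Ordinal lt_k); rewrite /= -Ek addrC subrK.
  apply/mapP; exists ([ffun j => projT1 (cid (Hk j))] : F); first by rewrite mem_enum.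
  by apply/rowP => j; rewrite mxE ffunE; exact: projT2 (cid (Hk j)).
rewrite size_map -cardE card_dep_ffun foldrE big_map big_enum /= => le_sr.
rewrite -(ler_nat R) natr_prod in le_sr; apply: (le_trans le_sr).
apply: ler_prod => j _; rewrite ler0n card_ord -natr1 lerD2r /=.
by rewrite truncn_le subr_ge0.
Qed.

End TopCoefficient.

Section Volume.
Variable R : realType.

Lemma dilate_hull_enumerates N n (S : 'M[R]_(N, n)) t : (0 < t)%N ->
  exists s, enumerates (dilate t (hull S)) s.
Proof.
move=> t0; apply: (combinations_enumerates (V := S) (t := t%:R)) => x.
by move/(dilate_hullP _ _ t0).
Qed.

Lemma dilate_hull_add N n (S : 'M[R]_(N, n)) t t' x y : (0 < t)%N -> (0 < t')%N ->
  dilate t (hull S) x -> dilate t' (hull S) y -> dilate (t + t') (hull S) (x + y).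
Proof.
move=> t0 t'0 /(dilate_hullP _ _ t0)[c [c0 ct ->]].
move=> /(dilate_hullP _ _ t'0)[d [d0 dt ->]].
apply/dilate_hullP; first by rewrite addn_gt0 t0.
exists (c + d); split; last by rewrite mulmxDl.
  by move=> i; rewrite mxE addr_ge0.
by under eq_bigr do rewrite mxE; rewrite big_split /= ct dt natrD.
Qed.

Section FullDimensional.
Variables (N p : nat) (U : 'M[R]_(N, p)) (i0 : 'I_N) (phi : {poly R}).
Variable c0 : 'rV[R]_p.
Hypothesis iU : integral_mx U.
Hypothesis fullU : \rank (edges U i0) = p.
Hypothesis size_phi : (size phi <= p.+1)%N.
Hypothesis phiE : forall t, (0 < t)%N ->
  phi.[t%:R] = (lattice_count (dilate t (hull U)))%:R.
(** The shift [c0] accounts for the base point that [lattice_volume] picks in the face, which may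
    fail to be integral. *)
Let A := [set c | hull U (c0 + c)].

(* Some dilate of a full-dimensional polytope contains a unit cube around an
   integral point. *)
Lemma unit_cube_in_dilate : exists M (a : 'rV[R]_p), [/\ (0 < M)%N, integral a &
  forall x : 'rV_p, (forall j, `|x 0 j| <= 1) -> dilate M (hull U) (a + x)].
Proof.
pose T := pinvmx (edges U i0); pose C := \sum_i \sum_k `|T k i|.
have C0 : 0 <= C by apply: sumr_ge0 => i _; exact: sumr_ge0.
(* Every generator receives weight [m]. Moving by [x] and restoring the sum of the weights changes
   each of them by at most [2 * C], so they stay positive. *)
pose m := (Num.truncn (2 * C)).+1.
have N0 : (0 < N)%N by case: (N) (i0) => // -[].
have M0 : (0 < m * N)%N by rewrite muln_gt0 N0.
exists (m * N)%N, (const_mx m%:R *m U); split => //.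
  apply/integral_mx_row; apply: integral_mx_mul => // i j.
  by rewrite mxE natr_int.
move=> x x1; apply/dilate_hullP => //.
pose d := x *m T.
have dE : d *m edges U i0 = x.
  by rewrite mulmxKpV // submx_full // /row_full fullU.
have dC i : `|d 0 i| <= \sum_k `|T k i|.
  rewrite mxE; apply: (le_trans (ler_norm_sum _ _ _)); apply: ler_sum => k _.
  by rewrite normrM ler_piMl.
have dC' i : `|d 0 i| <= C.
  apply: (le_trans (dC i)); rewrite /C [leRHS](bigD1 i) //= lerDl.
  by apply: sumr_ge0 => k _; exact: sumr_ge0.
clearbody d; pose s := \sum_i d 0 i.
have sC : `|s| <= C.
  by apply: (le_trans (ler_norm_sum _ _ _)); apply: ler_sum => i _; exact: dC.
exists (const_mx m%:R + (d - s *: delta_mx 0 i0)); split.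
- move=> i; rewrite !mxE /=.
  have m2 : 2 * C < m%:R by exact: truncnS_gt.
  have := dC' i; have := sC; rewrite !ler_norml => /andP[s1 s2] /andP[d1 d2].
  by case: (i == i0); rewrite ?mulr1 ?mulr0; lra.
- under eq_bigr do rewrite !mxE /=.
  rewrite big_split /= sumr_const card_ord natrM mulr_natr sumrB -mulr_sumr.
  have -> : \sum_(i < N) (i == i0)%:R = 1 :> R.
    by rewrite -[RHS](sum_delta1 R i0); apply: eq_bigr => i _; rewrite mxE.
  by rewrite mulr1 subrr addr0.
- by rewrite mulmxDl mulmxBl -scalemxAl -rowE -mul_edges dE.
Qed.

(* The cubes of side [1/t] needed to cover the polytope are indexed by lattice
   points of its dilate by [t + M]. *)
Lemma lebesgue_volume_upper : exists M, forall t, (0 < t)%N ->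
  (lebesgue_volume A <= (phi.[(t + M)%:R] / t%:R ^+ p)%:E)%E.
Proof.
have [M [a [M0 ia aM]]] := unit_cube_in_dilate.
exists M => t t0; have tM0 : (0 < t + M)%N by rewrite addn_gt0 t0.
have tR : 0 < t%:R :> R by rewrite ltr0n.
have [s sP] := dilate_hull_enumerates U tM0.
rewrite phiE // (lattice_count_size sP).
pose lo k : 'rV[R]_p := t%:R^-1 *: (nth 0 s k - a) - c0.
pose up k : 'rV[R]_p := lo k + const_mx t%:R^-1.
apply: ereal_inf_lbound; exists `I_(size s), lo, up; split.
- by move=> k j; rewrite /up [leRHS]mxE lerDl mxE invr_ge0 ltW.
- move=> c Ac; pose y : 'rV[R]_p := t%:R *: (c0 + c).
  (* Rounding down moves each coordinate by at most 1, and this error fits into the unit cube around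
     [a] in the dilate by [M]. *)
  pose u : 'rV[R]_p := \row_j (Num.floor (y 0 j))%:~R.
  have us : u + a \in s.
    apply/(sP.2 _); split.
      by move=> j; rewrite !mxE rpredD ?intr_int ?ia.
    have -> : u + a = y + (a + (u - y)) by rewrite addrCA [y + _]addrC subrK addrC.
    apply: dilate_hull_add => //; first by exists (c0 + c).
    apply: aM => j; rewrite !mxE; have := floor_itv (t%:R * (c0 0 j + c 0 j)).
    by rewrite intrD => /andP[h1 h2]; rewrite ler_norml; lra.
  exists (index (u + a) s); first by rewrite /= index_mem.
  move=> j; rewrite /up !mxE nth_index // !mxE.
  have /andP[] := floor_itv (t%:R * (c0 0 j + c 0 j)); rewrite intrD.
  set f := (Num.floor _)%:~R => h1 h2.
  have e1 : t%:R^-1 * (f + a 0 j - a 0 j) - c0 0 j <= c 0 j.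
    by rewrite addrK lerBlDr addrC mulrC ler_pdivrMr // mulrC.
  have e2 : c 0 j <= t%:R^-1 * (f + a 0 j - a 0 j) - c0 0 j + t%:R^-1.
    rewrite addrK addrAC -[X in _ + X - _]mulr1 -mulrDr lerBrDr addrC mulrC.
    by rewrite ler_pdivlMr // mulrC ltW.
  by rewrite e1 e2.
- rewrite esum_fset; [|exact: finite_II|]; last first.
    move=> k _; rewrite lee_fin prodr_ge0 // => j _.
    by rewrite !mxE addrAC subrr add0r invr_ge0 ltW.
  rewrite -fsbig_ord (eq_bigr (fun=> (t%:R ^- p)%:E)).
    by rewrite sumEFin sumr_const card_ord mulr_natl.
  move=> k _; congr EFin; rewrite (eq_bigr (fun=> t%:R^-1)).
    by rewrite prodr_const card_ord exprVn.
  by move=> j _; rewrite !mxE addrAC subrr add0r.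
Qed.

Lemma uniq_sum_le (s : seq nat) n (f : nat -> R) : uniq s ->
  (forall k, k \in s -> (k < n)%N) -> (forall k, 0 <= f k) ->
  \sum_(k <- s) f k <= \sum_(0 <= k < n) f k.
Proof.
move=> us sn f0; rewrite [leRHS](bigID (mem s)) /=.
suff -> : \sum_(0 <= k < n | k \in s) f k = \sum_(k <- s) f k.
  by rewrite lerDl sumr_ge0.
rewrite -big_filter; apply: perm_big; rewrite uniq_perm ?filter_uniq ?iota_uniq //.
move=> k; rewrite mem_filter mem_index_iota /=.
by case: (boolP (k \in s)) => //= /sn ->.
Qed.

Lemma sum_half_powers_lt1 (s : seq nat) : uniq s ->
  \sum_(k <- s) (2 ^- k.+1 : R) <= 1.
Proof.
move=> us; pose n := (\max_(k <- s) k).+1.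
apply: (le_trans (@uniq_sum_le s n _ us _ _)).
- by move=> k ks; rewrite ltnS leq_bigmax_seq.
- by move=> k; rewrite invr_ge0 exprn_ge0.
have E m : \sum_(0 <= k < m) (2 ^- k.+1 : R) = 1 - 2 ^- m.
  elim: m => [|m IH]; first by rewrite big_nil expr0 invr1 subrr.
  rewrite big_nat_recr //= IH exprS invfM.
  have : (2 : R)^-1 + 2^-1 = 1 by lra.
  set x := 2 ^- m; nra.
by rewrite E lerBlDr lerDl invr_ge0 exprn_ge0.
Qed.

Lemma cvg_prod (I T : Type) (r : seq I) (F : set_system T) (FF : Filter F)
    (f : I -> T -> R) (l : I -> R) :
  (forall i, f i x @[x --> F] --> l i) ->
  \prod_(i <- r) f i x @[x --> F] --> \prod_(i <- r) l i.
Proof.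
move=> fl; elim: r => [|i r IH].
  by rewrite big_nil; under eq_cvg do rewrite big_nil; exact: cvg_cst.
rewrite big_cons; under eq_cvg do rewrite big_cons.
exact: cvgM (fl i) IH.
Qed.

Lemma enlarge_box (l : 'I_p -> R) (e : R) : 0 < e ->
  exists2 d, 0 < d & \prod_j (l j + 2 * d) <= \prod_j l j + e.
Proof.
move=> e0.
have H : \prod_j (l j + 2 * d) @[d --> (0 : R)] --> \prod_j (l j + 2 * 0).
  apply: (@cvg_prod _ _ _ (nbhs (0 : R)) _ (fun j d => l j + 2 * d)) => j.
  by apply: cvgD; [exact: cvg_cst|apply: cvgM; [exact: cvg_cst|exact: cvg_id]].
have {H} : \forall d \near (0 : R), \prod_j (l j + 2 * d) < \prod_j l j + e.
  apply: (cvgr_lt _ H); under eq_bigr do rewrite mulr0 addr0.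
  by rewrite ltrDl.
move=> H; have : \forall d \near 0^'+, \prod_j (l j + 2 * d) < \prod_j l j + e.
  by apply: cvg_within; exact: H.
move=> Hr; near (0 : R)^'+ => d; exists d; last by apply/ltW; near: d.
by near: d; exact: nbhs_right_gt.
Unshelve. all: by end_near.
Qed.

(** Compactness is applied to the coefficient vectors, to which the covering of the polytope by
    enlarged open boxes is pulled back. *)
Lemma compact_simplex : compact [set w : 'rV[R]_N | nonneg w /\ \sum_i w 0 i = 1].
Proof.
have cube : compact [set w : 'rV[R]_N | forall i, `[0, 1]%classic (w ord0 i)].
  by apply: (@rV_compact R N (fun=> `[0, 1]%classic)) => _; exact: segment_compact.
have cs : continuous (fun w : 'rV[R]_N => \sum_i w 0 i).
  by move=> w; apply: (@cvg_sum _ _ _ _ (nbhs w) _ (fun i (w : 'rV[R]_N) => w 0 i)) => i;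
    exact: coord_continuous.
have cl (i : 'I_N) : closed [set w : 'rV[R]_N | 0 <= w 0 i].
  apply: (@closed_comp _ _ (fun w : 'rV[R]_N => w 0 i) [set x | 0 <= x]).
    by move=> w _; exact: coord_continuous.
  exact: closed_ge.
apply: subclosed_compact cube _.
  have -> : [set w : 'rV[R]_N | nonneg w /\ \sum_i w 0 i = 1] =
    (\bigcap_(i in [set: 'I_N]) [set w : 'rV[R]_N | 0 <= w 0 i]) `&`
    ((fun w : 'rV[R]_N => \sum_i w 0 i) @^-1` [set x | x = 1]).
    apply/seteqP; split => w /=; first by move=> [w0 w1]; split => // i _; exact: w0.
    by move=> [w0 w1]; split => // i; exact: (w0 i I).
  apply: closedI; first by apply: closed_bigI => i _.
  by apply: closed_comp => [w _|]; [exact: cs|exact: closed_eq].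
move=> w [w0 w1] i /=; rewrite in_itv /= w0 -w1 (bigD1 i) //= lerDl.
by rewrite sumr_ge0.
Qed.

Lemma open_box_preimage (l u : 'I_p -> R) :
  open [set w : 'rV[R]_N | forall j, l j < (w *m U) 0 j - c0 0 j < u j].
Proof.
have cf j (w : 'rV[R]_N) :
    (v *m U) 0 j - c0 0 j @[v --> w] --> (w *m U) 0 j - c0 0 j.
  have H : \sum_i v 0 i * U i j @[v --> w] --> \sum_i w 0 i * U i j.
    apply: (@cvg_sum _ _ _ _ (nbhs w) _ (fun i (v : 'rV[R]_N) => v 0 i * U i j)
      (fun i => w 0 i * U i j)) => i.
    by apply: cvgMr_tmp; exact: coord_continuous.
  have E (v : 'rV[R]_N) : (v *m U) 0 j - c0 0 j = \sum_i v 0 i * U i j + - c0 0 j.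
    by rewrite mxE.
  rewrite E; have -> : (fun v : 'rV[R]_N => (v *m U) 0 j - c0 0 j)
    = (fun v => \sum_i v 0 i * U i j + - c0 0 j) by apply/funext => v; rewrite E.
  by apply: (@cvgD _ _ _ (nbhs w) _ _ (fun=> - c0 0 j) _ _ H); exact: cvg_cst.
rewrite openE => w /= Hw.
apply: (@filter_forall _ 'I_p (fun j v => l j < (v *m U) 0 j - c0 0 j < u j) (nbhs w)) => j.
have /andP[h1 h2] := Hw j.
have H1 : \forall v \near w, l j < (v *m U) 0 j - c0 0 j.
  exact: cvgr_gt (cf j w) _ h1.
have H2 : \forall v \near w, (v *m U) 0 j - c0 0 j < u j.
  exact: cvgr_lt (cf j w) _ h2.
move: (@filterI _ (nbhs w) (nbhs_filter w) _ _ H1 H2).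
by apply: (@filterS _ (nbhs w) (nbhs_filter w)) => v [h h']; apply/andP.
Qed.

Lemma count_le_boxes (I : eqType) (D : seq I) (l u : I -> 'I_p -> R) t :
  (0 < t)%N -> (forall k j, l k j <= u k j) ->
  (forall c, A c -> exists2 k, k \in D & forall j, l k j <= c 0 j <= u k j) ->
  phi.[t%:R] <= \sum_(k <- D) \prod_j (t%:R * (u k j - l k j) + 1).
Proof.
move=> t0 lu cov; have tR : 0 < t%:R :> R by rewrite ltr0n.
have [s sP] := dilate_hull_enumerates U t0.
rewrite phiE // (lattice_count_size sP).
have /choice[r rP] : forall k, exists r : seq 'rV[R]_p,
    enumerates (fun x => forall j, t%:R * (l k j + c0 0 j) <= x 0 j
                                     <= t%:R * (u k j + c0 0 j)) r
    /\ (size r)%:R <= \prod_j (t%:R * (u k j - l k j) + 1).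
  move=> k.
  have [j|r r1 r2] := @box_enumerates R p (fun j => t%:R * (l k j + c0 0 j))
    (fun j => t%:R * (u k j + c0 0 j)).
    by rewrite ler_pM2l // lerD2r.
  exists r; split => //; apply: (le_trans r2); rewrite le_eqVlt; apply/orP; left.
  by apply/eqP; apply: eq_bigr => j _; ring.
have : (size s <= size (flatten [seq r k | k <- D]))%N.
  apply: uniq_leq_size; first by case: sP.
  move=> x /(sP.2 x)[ix [y Ky xE]].
  have Ac : A (y - c0) by rewrite /A /= addrC subrK.
  have [k kD Hk] := cov _ Ac.
  apply/flattenP; exists (r k); first exact: map_f.
  apply/((rP k).1.2 x); split => // j; rewrite -xE mxE !ler_pM2l //.
  by have := Hk j; rewrite !mxE lerBrDr lerBlDr.
rewrite size_flatten sumnE /shape -map_comp big_map -(ler_nat R) natr_sum => H.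
apply: (le_trans H); apply: ler_sum => k _; exact: (rP k).2.
Qed.

(* Finitely many slightly enlarged boxes cover the polytope; compare the growth of
   the numbers of lattice points of the dilates of both sides. *)
Lemma lebesgue_volume_lower (D : set nat) (a b : nat -> 'rV[R]_p) :
  (forall k j, a k 0 j <= b k 0 j) ->
  A `<=` \bigcup_(k in D) box (a k) (b k) ->
  ((phi`_p)%:E <= \esum_(k in D) (\prod_j (b k 0 j - a k 0 j))%:E)%E.
Proof.
move=> ab cov; apply/lee_addgt0Pr => e e0.
(* Box [k] may gain at most [e * 2 ^- k.+1] in volume, so any finite selection of boxes gains at
   most [e]. *)
have /choice[d dP] : forall k, exists d, 0 < d /\
    \prod_j (b k 0 j - a k 0 j + 2 * d) <= \prod_j (b k 0 j - a k 0 j) + e * 2 ^- k.+1.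
  move=> k; have [|d d0 dP] := @enlarge_box (fun j => b k 0 j - a k 0 j) (e * 2 ^- k.+1).
    by rewrite mulr_gt0 // invr_gt0 exprn_gt0.
  by exists d.
pose l k j := a k 0 j - d k; pose u k j := b k 0 j + d k.
have lu k j : l k j <= u k j.
  by rewrite /l /u; have := ab k j; have [+ _] := dP k; lra.
have := compact_simplex; rewrite compact_cover.
move=> /(_ nat D (fun k => [set w : 'rV[R]_N | forall j,
  l k j < (w *m U) 0 j - c0 0 j < u k j])).
case=> [k _||D' D'D covD'].
- exact: open_box_preimage.
- move=> w [w0 w1]; have [|k Dk Hk] := cov (w *m U - c0).
    by rewrite /A /= addrC subrK; exists w.
  exists k => // j; have := Hk j; rewrite !mxE /l /u => /andP[h1 h2].
  by have [d0 _] := dP k; apply/andP; split; lra.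
have le_phi : phi`_p <= \sum_(k <- D') \prod_j (u k j - l k j).
  (* At [t] this polynomial bounds the number of lattice points in the dilated boxes, and its top
     coefficient is their total volume. *)
  pose q : {poly R} := \sum_(k <- D') \prod_j ((u k j - l k j) *: 'X + 1).
  have sq2 k j : (size ((u k j - l k j) *: 'X + 1)%R <= 2)%N.
    apply: (leq_trans (size_polyD _ _)); rewrite size_poly1 geq_max andbT.
    by apply: (leq_trans (size_scale_leq _ _)); rewrite size_polyX.
  have sq : (size q <= p.+1)%N.
    apply: (leq_trans (size_sum _ _ _)); apply/bigmax_leqP_seq => k _ _.
    by have [] := coef_prod_top (sq2 k).
  have -> : \sum_(k <- D') \prod_j (u k j - l k j) = q`_p.
    rewrite coef_sum; apply: eq_bigr => k _; have [_ ->] := coef_prod_top (sq2 k).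
    by apply: eq_bigr => j _; rewrite coefD coefZ coefX coef1 mulr1 addr0.
  apply: (@coef_top_le _ _ _ _ 1 size_phi sq) => t t0.
  rewrite horner_sum.
  apply: le_trans (@count_le_boxes _ D' l u t t0 lu _) _.
    move=> c [w [w0 w1 cE]]; have [k kD' Hk] := covD' w (conj w0 w1).
    exists k => // j; have := Hk j; rewrite -cE mxE addrAC subrr add0r.
    by move=> /andP[/ltW-> /ltW->].
  apply: ler_sum => k _; rewrite horner_prod; apply: ler_prod => j _.
  rewrite !hornerE mulrC lexx andbT addr_ge0 // mulr_ge0 ?subr_ge0 //.
have le_e : phi`_p <= \sum_(k <- D') \prod_j (b k 0 j - a k 0 j) + e.
  apply: (le_trans le_phi).
  apply: (@le_trans _ _ (\sum_(k <- D')
      (\prod_j (b k 0 j - a k 0 j) + e * 2 ^- k.+1))).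
    apply: ler_sum => k _; have [_ H] := dP k; apply: le_trans H.
    rewrite le_eqVlt; apply/orP; left; apply/eqP; apply: eq_bigr => j _.
    by rewrite /u /l; ring.
  rewrite big_split /= lerD2l -mulr_sumr ler_piMr //; first exact: ltW.
  exact: (sum_half_powers_lt1 (fset_uniq D')).
apply: (@le_trans _ _ ((\sum_(k <- D') \prod_j (b k 0 j - a k 0 j))%:E + e%:E)%E).
  by rewrite -EFinD lee_fin.
apply: leeD2r; apply: esum_ge; exists [set` D'].
  by split; [exact: finite_fset|move=> k /D'D; rewrite inE].
by rewrite -fsbig_seq ?fset_uniq // sumEFin.
Qed.

Theorem lebesgue_volume_hull : lebesgue_volume A = (phi`_p)%:E.
Proof.
have [M upM] := lebesgue_volume_upper.
have lowA : ((phi`_p)%:E <= lebesgue_volume A)%E.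
  by apply: le_ereal_inf_tmp => _ [D [a [b [ab cov ->]]]]; exact: lebesgue_volume_lower.
have finA : lebesgue_volume A \is a fin_num.
  have := upM 1 isT; move: lowA; case: (lebesgue_volume A) => //.
apply/eqP; rewrite eq_le lowA andbT -(fineK finA) lee_fin.
set r := fine _.
have rM t : (0 < t)%N -> r * t%:R ^+ p <= phi.[(t + M)%:R].
  move=> t0; have := upM t t0; rewrite -(fineK finA) lee_fin.
  by rewrite ler_pdivlMr // exprn_gt0 // ltr0n.
(* The upper bound taken at [t - M] says that [f] is at most [phi] at large integers [t], and the
   top coefficient of [f] is the volume [r]. *)
pose f : {poly R} := r *: \prod_(j < p) ('X - M%:R%:P).
have sf2 (j : 'I_p) : (size ('X - M%:R%:P : {poly R})%R <= 2)%N by rewrite size_XsubC.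
have [sf cf] := coef_prod_top sf2.
have <- : f`_p = r.
  rewrite coefZ cf big1 ?mulr1 // => j _.
  by rewrite coefB coefX coefC subr0.
apply: (@coef_top_le _ _ _ _ M.+1 _ size_phi).
  exact: (leq_trans (size_scale_leq _ _)).
move=> t tM; rewrite hornerZ horner_prod.
have -> : \prod_(j < p) ('X - M%:R%:P).[t%:R] = (t - M)%:R ^+ p :> R.
  rewrite (eq_bigr (fun=> (t - M)%:R)) ?prodr_const ?card_ord // => j _.
  by rewrite !hornerE natrB // ltnW.
apply: (le_trans (rM _ _)); first by rewrite subn_gt0.
by rewrite subnK // ltnW.
Qed.

End FullDimensional.
End Volume.

(** * Lattice volume in lattice coordinates *)

Section LatticeVolume.
Variables (R : realType) (N n p : nat) (S : 'M[R]_(N, n)) (i0 : 'I_N).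
Hypothesis iS : integral_mx S.

Section Coordinates.
Variables (B : 'M[R]_(p, n)) (U : 'M[R]_(N, p)).
Hypothesis LB : lattice_basis (hull S) B.
Hypothesis iU : integral_mx U.
Hypothesis UE : edges S i0 = U *m B.

Let freeB : row_free B := lattice_basis_row_free LB.

Lemma coordinates_base : row i0 U = 0.
Proof.
apply: (row_free_inj freeB); rewrite /= -row_mul -UE mul0mx.
by rewrite rowK subrr.
Qed.

Lemma coordinates_full : \rank (edges U i0) = p.
Proof.
have -> : edges U i0 = U.
  by apply/row_matrixP => i; rewrite rowK coordinates_base subr0.
rewrite -(mxrankMfree U freeB) -UE -(lattice_basis_eqmx i0 iS LB).
exact/eqP.
Qed.

Lemma hull_coordinates c : hull S (row i0 S + c *m B) <-> hull U c.
Proof.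
split=> [[w [w0 w1 E]]|[w [w0 w1 ->]]]; exists w; split => //.
  apply: (row_free_inj freeB); apply: (addrI (row i0 S)).
  by rewrite /= E (lattice_coordinates_hull UE w1) scale1r.
by rewrite (lattice_coordinates_hull UE w1) scale1r.
Qed.

Lemma lattice_count_coordinates t : (0 < t)%N ->
  lattice_count (dilate t (hull S)) = lattice_count (dilate t (hull U)).
Proof.
move=> t0; have [s [us sP]] := dilate_hull_enumerates U t0.
have iB := lattice_basis_integral i0 LB.
rewrite (lattice_count_size (conj us sP)).
rewrite -(size_map (fun u => t%:R *: row i0 S + u *m B)).
have irow : integral (t%:R *: row i0 S) by move=> j; rewrite !mxE rpredM ?natr_int.
apply: lattice_count_size; split.
  by rewrite map_inj_uniq // => u u' /addrI /(row_free_inj freeB).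
move=> y; split.
  case/mapP => u /sP[iu /(dilate_hullP _ _ t0)[c [c0 ct uE]]] ->; split.
    move=> j; rewrite mxE rpredD //.
    by apply: (integral_mx_mul _ iB) => i k; rewrite ord1.
  by apply/dilate_hullP => //; exists c; split; rewrite // (lattice_coordinates_hull UE ct) uE.
move=> [iy /(dilate_hullP _ _ t0)[c [c0 ct yE]]].
apply/mapP; exists (c *m U); last by rewrite yE (lattice_coordinates_hull UE ct).
apply/sP; split; last by apply/dilate_hullP => //; exists c.
apply: (lattice_basis_saturated i0 iS LB) => j.
have -> : c *m U *m B = y - t%:R *: row i0 S.
  by rewrite yE (lattice_coordinates_hull UE ct) addrC addKr.
by rewrite mxE rpredD // mxE rpredN; apply: irow.
Qed.

End Coordinates.

Theorem hull_ehrhart : has_dim (hull S) p -> exists phi : {poly R},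
  [/\ (size phi <= p.+1)%N,
    forall t, (0 < t)%N -> phi.[t%:R] = (lattice_count (dilate t (hull S)))%:R,
    forall t, (0 < t)%N -> phi.[- t%:R] =
      (-1) ^+ p * (lattice_count (relint (dilate t (hull S))))%:R &
    lattice_volume p (hull S) = p`!%:R * phi`_p].
Proof.
move=> dimS; have exB := lattice_basis_exists i0 iS dimS.
(* The very basis selected in the definition of [lattice_volume], so that its coordinates can be
   used directly. *)
pose B := xget 0 [set B : 'M[R]_(p, n) | lattice_basis (hull S) B].
have LB : lattice_basis (hull S) B := xgetPex 0 exB.
have [phi [sz phi1 phi2]] := lattice_hull_ehrhart i0 iS LB.
exists phi; split => //; rewrite /lattice_volume -/B.
have Fx0 : hull S (xget 0 (hull S)).
  by apply: (@xgetPex _ 0 (hull S)); exists (row i0 S); exact: hull_row.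
have [U iU UE] := lattice_coordinates i0 iS LB.
move: Fx0; set x0 := xget 0 _ => -[w [w0 w1 x0E]].
have phiU t : (0 < t)%N -> phi.[t%:R] = (lattice_count (dilate t (hull U)))%:R.
  by move=> t0; rewrite phi1 // (lattice_count_coordinates LB UE).
congr (_ * _).
have -> : [set c : 'rV[R]_p | hull S (x0 + c *m B)] = [set c | hull U (w *m U + c)].
  have E c : x0 + c *m B = row i0 S + (w *m U + c) *m B.
    by rewrite x0E (lattice_coordinates_hull UE w1) scale1r mulmxDl addrA.
  by apply/seteqP; split=> c /=; rewrite E => /(hull_coordinates LB UE).
by rewrite (lebesgue_volume_hull (w *m U) iU (coordinates_full LB UE) sz phiU).
Qed.

End LatticeVolume.

(** * Faces *)

Section Faces.
Variable R : realType.

Lemma faceP n (P F : set 'rV[R]_n) : face P F <->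
  exists (a : 'cV[R]_n) (b : R), (forall x, P x -> (x *m a) 0 0 <= b) /\
    F = [set x | P x /\ (x *m a) 0 0 = b].
Proof.
split=> [[a [b [Pb ->]]]|[a [b [Pb ->]]]].
  have E (x : 'rV[R]_n) : (x *m a^T) 0 0 = \sum_j a 0 j * x 0 j.
    by rewrite row_mul_colE; apply: eq_bigr => j _; rewrite mxE mulrC.
  exists a^T, b; split; first by move=> x Px; rewrite E; exact: Pb.
  by apply/seteqP; split=> x /=; rewrite E.
have E (x : 'rV[R]_n) : \sum_j a^T 0 j * x 0 j = (x *m a) 0 0.
  by rewrite row_mul_colE; apply: eq_bigr => j _; rewrite mxE mulrC.
exists a^T, b; split; first by move=> x Px; rewrite E; exact: Pb.
by apply/seteqP; split=> x /=; rewrite E.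
Qed.

Definition hull_on N n (S : 'M[R]_(N, n)) (J : {set 'I_N}) : set 'rV[R]_n :=
  [set x | exists w : 'rV_N,
    [/\ nonneg w, supported J w, \sum_i w 0 i = 1 & x = w *m S]].

Lemma supported_enum N n (S : 'M[R]_(N, n)) (J : {set 'I_N}) (w : 'rV[R]_N) :
  supported J w ->
  w *m S = colsub (@enum_val _ (mem J)) w *m rowsub (@enum_val _ (mem J)) S /\
  \sum_i w 0 i = \sum_k colsub (@enum_val _ (mem J)) w 0 k.
Proof.
move=> wJ.
have E (V : nmodType) (F : 'I_N -> V) : (forall i, i \notin J -> F i = 0) ->
    \sum_i F i = \sum_(k < #|J|) F (enum_val k).
  move=> F0; rewrite (bigID (mem J)) /= [X in _ + X]big1 ?addr0 //.
  by rewrite big_enum_val.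
split.
  rewrite !mulmx_sum_row E => [|i iJ]; last by rewrite wJ // scale0r.
  by apply: eq_bigr => k _; rewrite row_rowsub mxE.
by rewrite E //; apply: eq_bigr => k _; rewrite mxE.
Qed.

Lemma extend_enum N (J : {set 'I_N}) (u : 'rV[R]_#|J|) :
  exists2 w : 'rV[R]_N, supported J w & colsub (@enum_val _ (mem J)) w = u.
Proof.
exists (u *m rowsub (@enum_val _ (mem J)) 1%:M).
  move=> i iJ; rewrite mxE big1 // => k _; rewrite !mxE.
  case: eqP => [ki|]; rewrite ?mulr0 //.
  by rewrite -ki enum_valP in iJ.
apply/rowP => k; rewrite !mxE (bigD1 k) //= !mxE eqxx mulr1 big1 ?addr0 // => l lk.
by rewrite !mxE (inj_eq enum_val_inj) (negPf lk) mulr0.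
Qed.

Lemma hull_onE N n (S : 'M[R]_(N, n)) (J : {set 'I_N}) :
  hull_on S J = hull (rowsub (@enum_val _ (mem J)) S).
Proof.
apply/seteqP; split=> x.
  move=> [w [w0 wJ w1 ->]]; have [E1 E2] := supported_enum S wJ.
  exists (colsub (@enum_val _ (mem J)) w); split; rewrite -?E2 //.
  by move=> k; rewrite mxE.
move=> [u [u0 u1 ->]]; have [w wJ wu] := extend_enum u.
have [E1 E2] := supported_enum S wJ.
exists w; split => //; last by rewrite E1 wu.
  move=> i; have [iJ|/wJ->//] := boolP (i \in J).
  by have := u0 (enum_rank_in iJ i); rewrite -wu mxE enum_rankK_in.
by rewrite E2 wu.
Qed.

Lemma relint_hull_on N n (S : 'M[R]_(N, n)) (J : {set 'I_N}) :
  relint (hull_on S J) = [set x | exists w : 'rV_N,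
    [/\ forall i, i \in J -> 0 < w 0 i, supported J w, \sum_i w 0 i = 1
      & x = w *m S]].
Proof.
rewrite hull_onE relint_hull; apply/seteqP; split=> x.
  move=> [u [u0 u1 ->]]; have [w wJ wu] := extend_enum u.
  have [E1 E2] := supported_enum S wJ.
  exists w; split => //; [|by rewrite E2 wu|by rewrite E1 wu].
  by move=> i iJ; have := u0 (enum_rank_in iJ i); rewrite -wu mxE enum_rankK_in.
move=> [w [w0 wJ w1 ->]]; have [E1 E2] := supported_enum S wJ.
exists (colsub (@enum_val _ (mem J)) w); split; rewrite -?E2 //.
by move=> k; rewrite mxE; apply: w0; exact: enum_valP.
Qed.

Definition face_index N n (S : 'M[R]_(N, n)) (F : set 'rV[R]_n) : {set 'I_N} :=
  [set i | `[< F (row i S) >]]%SET.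

Lemma mem_face_index N n (S : 'M[R]_(N, n)) F i :
  i \in face_index S F <-> F (row i S).
Proof. by rewrite inE; split=> /asboolP. Qed.

(** For a point of the face, the weighted slacks of the supporting inequality at the generators are
    nonnegative with sum 0, so every generator with positive weight is tight. *)
Lemma face_hull_on N n (S : 'M[R]_(N, n)) F : face (hull S) F ->
  F = hull_on S (face_index S F).
Proof.
move=> /faceP[a [b [Pb ->]]]; set J := face_index S _.
have Sb i : (S *m a) i 0 <= b.
  by have := Pb _ (hull_row S i); rewrite -row_mul mxE.
apply/seteqP; split=> x /=.
  move=> [[w [w0 w1 xE]] xb]; exists w; split => // i iJ; apply/eqP.
  apply: contraNT iJ => wi; apply/mem_face_index; split; first exact: hull_row.
  rewrite -row_mul mxE.
  have Hs : \sum_i w 0 i * (b - (S *m a) i 0) = 0.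
    under eq_bigr do rewrite mulrBr.
    by rewrite sumrB -mulr_suml w1 mul1r -row_mul_colE mulmxA -xE xb subrr.
  have Hn j : true -> 0 <= w 0 j * (b - (S *m a) j 0).
    by rewrite mulr_ge0 ?subr_ge0.
  have /eqP := psumr_eq0P Hn Hs (i := i) isT.
  by rewrite mulf_eq0 (negPf wi) /= subr_eq0 => /eqP.
move=> [w [w0 wJ w1 ->]]; split; first by exists w.
rewrite (supported_mul _ _ wJ).
transitivity (\sum_(i in J) w 0 i * b).
  apply: eq_bigr => i /mem_face_index[_]; rewrite -row_mul mxE => ->.
  by [].
rewrite -mulr_suml -[RHS]mul1r -w1 (bigID (mem J) xpredT) /=.
by rewrite [X in _ + X]big1 ?addr0 // => i /wJ.
Qed.

Lemma face_index_exists N n (S : 'M[R]_(N, n)) F : face (hull S) F ->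
  F !=set0 -> exists i, i \in face_index S F.
Proof.
move=> fF; rewrite {1}(face_hull_on fF) => -[_ [w [_ wJ w1 _]]].
apply: contrapT => /forallNP H; move: w1; rewrite big1 => [/esym/eqP|i _].
  by rewrite oner_eq0.
by apply: wJ; apply/negP/H.
Qed.

Lemma finite_faces N n (S : 'M[R]_(N, n)) : finite_set [set F | face (hull S) F].
Proof.
apply: (@sub_finite_set _ _ [set hull_on S J | J in [set: {set 'I_N}]]).
  by move=> F /face_hull_on->; exists (face_index S F).
by apply: finite_image; exact: finite_finset.
Qed.

(** The point carries positive weight on every generator of [F]. If it attains the maximum that
    defines [G], then so does each of these generators. *)
Lemma relint_face_sub N n (S : 'M[R]_(N, n)) F G x :
  face (hull S) F -> face (hull S) G -> relint F x -> (G x <-> F `<=` G).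
Proof.
move=> fF fG xF; split=> [Gx|]; last by apply; case: xF.
have FE := face_hull_on fF; move: xF; rewrite {1}FE relint_hull_on.
move=> [w [w0 wJ w1 xE]]; have /faceP[a [b [Pb GE]]] := fG.
move: Gx; rewrite GE => -[_ xb].
have Sb i : (S *m a) i 0 <= b.
  by have := Pb _ (hull_row S i); rewrite -row_mul mxE.
have Jb i : i \in face_index S F -> (S *m a) i 0 = b.
  move=> iJ.
  have Hs : \sum_i w 0 i * (b - (S *m a) i 0) = 0.
    under eq_bigr do rewrite mulrBr.
    by rewrite sumrB -mulr_suml w1 mul1r -row_mul_colE mulmxA -xE xb subrr.
  have Hn j : true -> 0 <= w 0 j * (b - (S *m a) j 0).
    rewrite mulr_ge0 ?subr_ge0 //.
    by have [/w0/ltW|/wJ->] := boolP (j \in face_index S F).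
  have /eqP := psumr_eq0P Hn Hs (i := i) isT.
  by rewrite mulf_eq0 gt_eqF ?w0 //= subr_eq0 => /eqP.
rewrite {1}FE => y [u [u0 uJ u1 ->]]; split; first by exists u.
rewrite (supported_mul _ _ uJ).
transitivity (\sum_(i in face_index S F) u 0 i * b).
  by apply: eq_bigr => i /Jb->.
rewrite -mulr_suml -[RHS]mul1r -u1 (bigID (mem (face_index S F)) xpredT) /=.
by rewrite [X in _ + X]big1 ?addr0 // => i /uJ.
Qed.

(** The extra coordinate 1 turns affine relations and hyperplanes into linear ones, to which the
    results on cones apply. *)
Definition homog N n (S : 'M[R]_(N, n)) : 'M[R]_(N, n + 1) := row_mx S (const_mx 1).

Lemma homog_mul N n (S : 'M[R]_(N, n)) (a : 'cV[R]_(n + 1)) i :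
  (homog S *m a) i 0 = (row i S *m usubmx a) 0 0 + dsubmx a 0 0.
Proof.
rewrite -{1}[a]vsubmxK mul_row_col mxE; congr (_ + _).
  by rewrite -row_mul [RHS]mxE.
by rewrite mxE big_ord1 mxE mul1r.
Qed.

Lemma homog_combination N n (S : 'M[R]_(N, n)) (c d : 'rV[R]_N) :
  c *m homog S = d *m homog S <-> c *m S = d *m S /\ \sum_i c 0 i = \sum_i d 0 i.
Proof.
have E (e : 'rV[R]_N) : e *m (const_mx 1 : 'cV_N) = (\sum_i e 0 i)%:M.
  apply/rowP => j; rewrite ord1 !mxE eqxx mulr1n.
  by apply: eq_bigr => i _; rewrite mxE mulr1.
rewrite !mul_mx_row !E; split=> [/eq_row_mx[-> /rowP/(_ 0)]|[-> ->]//].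
by rewrite !mxE eqxx !mulr1n.
Qed.

(* Take a representation of [x] with maximal support [J]: by Gordan's
   alternative some supporting hyperplane meets the generators exactly in [J]. *)
Lemma relint_face_exists N n (S : 'M[R]_(N, n)) x : hull S x ->
  exists F, face (hull S) F /\ relint F x.
Proof.
move=> [w0 [w00 w01 xE0]].
pose Q (J : {set 'I_N}) := `[< exists w : 'rV[R]_N,
  [/\ forall i, i \in J -> 0 < w 0 i, supported J w, \sum_i w 0 i = 1
    & x = w *m S] >].
pose J0 := [set i | 0 < w0 0 i]%SET.
have QJ0 : Q J0.
  apply/asboolP; exists w0; split => //; first by move=> i; rewrite inE.
  by move=> i; rewrite inE -leNgt => H; apply/eqP; rewrite eq_le H w00.
have [J maxJ _] := maxset_exists QJ0.
have /asboolP[w [wpos wJ w1 xE]] := maxsetp maxJ.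
(* In the second alternative, moving [w] a little along [c - d] keeps the point and makes further
   coefficients positive, against the maximality of [J]. *)
case: (gordan_set (homog S) (~: J)%SET J) => [[a a0 aneg]|]; last first.
  move=> [c [d [c0 cJ c1 dJ /homog_combination[cS csum]]]].
  have f0 i : 0 < (if i \in J then w 0 i else 1).
    by case: ifP => [/wpos|_].
  have [e e0 He] := @small_perturbation R 'I_N _ (fun i => - d 0 i) f0.
  pose J' := (J :|: [set i | c 0 i != 0])%SET.
  have QJ' : Q J'.
    apply/asboolP; exists (w + e *: (c - d)); split.
    - move=> i; rewrite !inE !mxE mulrBr addrCA; have [iJ _|iJ /= ci] := boolP (i \in J).
        have := He e; rewrite lexx ltW // => /(_ isT i); rewrite iJ mulrN => H.
        by rewrite ltr_wpDl // mulr_ge0 // ltW.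
      by rewrite wJ // dJ // mulr0 subr0 addr0 mulr_gt0 // lt_def ci c0.
    - move=> i; rewrite !inE negb_or negbK => /andP[iJ /eqP ci].
      by rewrite !mxE wJ // ci dJ // subr0 mulr0 addr0.
    - under eq_bigr do rewrite !mxE.
      by rewrite big_split /= -mulr_sumr sumrB csum subrr mulr0 addr0.
    - by rewrite mulmxDl -scalemxAl mulmxBl cS subrr scaler0 addr0.
  have JJ' := maxsetsup maxJ QJ' (finset.subsetUl _ _).
  case/rV0Pn: c1 => i ci; have : i \in J' by rewrite !inE ci orbT.
  by rewrite JJ' => iJ; have := cJ i; rewrite inE iJ => /(_ isT) /eqP; rewrite (negPf ci).
pose b := - dsubmx a 0 0.
have Sa i : (row i S *m usubmx a) 0 0 = (homog S *m a) i 0 + b.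
  by rewrite homog_mul /b addrK.
have le_b i : (row i S *m usubmx a) 0 0 <= b.
  rewrite Sa -[leRHS]add0r lerD2r; have [/a0->//|iJ] := boolP (i \in J).
  by apply/ltW/aneg; rewrite inE.
pose F := [set y | hull S y /\ (y *m usubmx a) 0 0 = b].
have fF : face (hull S) F.
  apply/faceP; exists (usubmx a), b; split => // _ [u [u0 u1 ->]].
  rewrite -mulmxA row_mul_colE -[leRHS]mul1r -u1 mulr_suml.
  by apply: ler_sum => i _; rewrite ler_wpM2l //; have := le_b i; rewrite -row_mul mxE.
exists F; split => //; rewrite (face_hull_on fF) relint_hull_on.
have -> : face_index S F = J.
  apply/setP => i; apply/idP/idP => [/mem_face_index[_]|iJ].
    rewrite Sa => /eqP; rewrite -subr_eq0 addrK => H.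
    by apply: contraTT H => iJ; rewrite lt_eqF // aneg // inE.
  apply/mem_face_index; split; first exact: hull_row.
  by rewrite Sa a0 // add0r.
by exists w.
Qed.

Lemma face_has_dim N n (S : 'M[R]_(N, n)) F : face (hull S) F -> F !=set0 ->
  exists2 p, (p <= n)%N & has_dim F p.
Proof.
move=> fF F0; have [i iJ] := face_index_exists fF F0.
rewrite (face_hull_on fF) hull_onE; set S' := rowsub _ S.
exists (\rank (edges S' (enum_rank_in iJ i))); first exact: rank_leq_col.
exact/(has_dim_hull S' (enum_rank_in iJ i)).
Qed.

Lemma has_dim_face_uniq N n (S : 'M[R]_(N, n)) F p q :
  face (hull S) F -> has_dim F p -> has_dim F q -> p = q.
Proof.
move=> fF dp dq; have [i iJ] := face_index_exists fF dp.1.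
move: dp dq; rewrite (face_hull_on fF) hull_onE; set S' := rowsub _ S.
move=> /(has_dim_hull S' (enum_rank_in iJ i)) ->.
by move=> /(has_dim_hull S' (enum_rank_in iJ i)) ->.
Qed.

End Faces.

(** * Vertex figures *)

Section Minkowski.
Variable R : realType.

Lemma cone_on_combination N n (G : 'M[R]_(N, n)) (I J : {set 'I_N}) c :
  (forall j, j \in J -> cone_on G I (row j G)) ->
  nonneg c -> supported J c -> cone_on G I (c *m G).
Proof.
move=> gI c0 cJ.
have /choice[C CP] : forall j, exists d : 'rV[R]_N, j \in J ->
    [/\ nonneg d, supported I d & row j G = d *m G].
  move=> j; have [/gI[d dP]|_] := boolP (j \in J); last by exists 0.
  by exists d.
exists (\sum_(j in J) c 0 j *: C j); split.
- move=> i; rewrite summxE sumr_ge0 // => j jJ; rewrite mxE mulr_ge0 //.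
  by have [] := CP j jJ.
- move=> i iI; rewrite summxE big1 // => j jJ; rewrite mxE.
  by have [_ -> //] := CP j jJ; rewrite mulr0.
- rewrite mulmx_suml mulmx_sum_row (bigID (mem J)) /= [X in _ + X]big1 ?addr0.
    by apply: eq_bigr => j jJ; rewrite -scalemxAl; have [_ _ <-] := CP j jJ.
  by move=> j /cJ->; rewrite scale0r.
Qed.

(** A minimal generating set of the cone over the polytope has a form exposing each generator. Read
    as an affine inequality, this form shows that the generator is a vertex and differs from the
    others. *)
Lemma polytope_vertices n (P : set 'rV[R]_n) : polytope P ->
  exists N (S : 'M[R]_(N, n)), [/\ P = hull S, forall i, vertex P (row i S) &
    injective (fun i => row i S)].
Proof.
move=> /polytope_hull[N [S PE]].
pose h : 'cV[R]_(n + 1) := col_mx 0 1%:M.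
have hS i : (homog S *m h) i 0 = 1.
  by rewrite homog_mul col_mxKu col_mxKd mulmx0 !mxE add0r.
have [i _|I [_ gI expI]] := @minimal_generators R _ _ (homog S) [set: 'I_N]%SET h.
  by rewrite hS ltr01.
have hullI x : hull S x -> hull_on S I x.
  move=> [c [c0 c1 ->]].
  have [d [d0 dI /homog_combination[E1 E2]]] :
      cone_on (homog S) I (c *m homog S).
    by apply: (cone_on_combination gI) => // i; rewrite inE.
  by exists d; split => //; rewrite -E2.
have hullE : hull S = hull_on S I.
  by apply/seteqP; split => // x [w [w0 _ w1 wE]]; exists w.
have expo i : i \in I -> exists (a : 'cV[R]_n) (b : R),
    (row i S *m a) 0 0 = b /\ forall j, j \in I -> j != i -> (row j S *m a) 0 0 < b.
  move=> /expI[a a0 aneg]; exists (usubmx a), (- dsubmx a 0 0); split.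
    by move: a0; rewrite homog_mul => /eqP; rewrite addr_eq0 => /eqP.
  by move=> j jI ji; have := aneg j jI ji; rewrite homog_mul; lra.
exists #|I|, (rowsub (@enum_val _ (mem I)) S); split.
- by rewrite PE hullE hull_onE.
- move=> k; rewrite row_rowsub; set i := enum_val k.
  have iI : i \in I by exact: enum_valP.
  have [a [b [ab altb]]] := expo i iI.
  have le_b j : j \in I -> (row j S *m a) 0 0 <= b.
    by move=> jI; have [->|/(altb j jI)/ltW//] := eqVneq j i; rewrite ab.
  have sumb w : supported I w -> \sum_i w 0 i = 1 ->
      b - (w *m S *m a) 0 0 = \sum_(j in I) w 0 j * (b - (row j S *m a) 0 0).
    move=> wI w1; rewrite (supported_mul _ _ wI).
    under [RHS]eq_bigr do rewrite mulrBr -row_mul [(row _ _) 0 0]mxE.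
    rewrite sumrB -mulr_suml; congr (_ - _).
    rewrite -[LHS]mul1r -w1 (bigID (mem I) xpredT) /=.
    by rewrite [X in _ + X]big1 ?addr0 // => j /wI.
  apply/faceP; exists a, b; split.
    move=> x; rewrite PE hullE => -[w [w0 wI w1 ->]].
    rewrite -subr_ge0 sumb //; apply: sumr_ge0 => j jI.
    by rewrite mulr_ge0 // subr_ge0 le_b.
  rewrite PE; apply/seteqP; split=> x /=.
    by move=> ->; split; [exact: hull_row|].
  rewrite hullE => -[[w [w0 wI w1 xE]] xb].
  have /psumr_eq0P H : \sum_(j in I) w 0 j * (b - (row j S *m a) 0 0) = 0.
    by rewrite -sumb // -xE xb subrr.
  have wi j : j != i -> w 0 j = 0.
    move=> ji; have [jI|/wI//] := boolP (j \in I).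
    have H' l : l \in I -> 0 <= w 0 l * (b - (row l S *m a) 0 0).
      by move=> lI; rewrite mulr_ge0 // subr_ge0 le_b.
    have /eqP := H H' j jI; rewrite mulf_eq0 subr_eq0.
    by rewrite [b == _]gt_eqF ?altb // orbF => /eqP.
  have wi1 : supported [set i] w by move=> j; rewrite inE => /wi.
  rewrite xE (supported_row1 _ wi1).
  move: w1; rewrite (bigD1 i) //= big1 ?addr0 => [->|j ji]; first by rewrite scale1r.
  exact: wi.
- move=> k l; rewrite !row_rowsub => E; apply/enum_val_inj/eqP.
  have [a [b [ab altb]]] := expo _ (enum_valP l).
  apply: contraT => kl; have := altb _ (enum_valP k) kl.
  by rewrite E ab ltxx.
Qed.

End Minkowski.

Section VertexFigure.
Variables (R : realType) (N n : nat) (S : 'M[R]_(N, n)) (i0 : 'I_N).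
Variable I : {set 'I_N}.
Let E := edges S i0.
Let P := hull S.
Hypothesis gI : forall j, cone_on E I (row j E).

(** The points of [P] seen from the vertex within the cone of the directions in [J]. Only the
    directions are constrained, so faces at the vertex become faces of a cone. *)
Definition vertex_face (J : {set 'I_N}) : set 'rV[R]_n :=
  [set x | P x /\ cone_on E J (x - row i0 S)].

Lemma hull_vertex_cone x : P x -> cone_on E I (x - row i0 S).
Proof.
move=> [w [w0 w1 ->]].
have -> : w *m S - row i0 S = w *m E by rewrite mul_edges w1 scale1r.
by apply: (@cone_on_combination _ _ _ _ _ [set: 'I_N]%SET) => // i; rewrite inE.
Qed.

Definition exposes (a : 'cV[R]_n) (J : {set 'I_N}) :=
  (forall i, i \in J -> (E *m a) i 0 = 0) /\
  (forall i, i \in I -> i \notin J -> (E *m a) i 0 < 0).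

Lemma exposes_cone a (J : {set 'I_N}) y : J \subset I -> exposes a J ->
  cone_on E I y -> (y *m a) 0 0 <= 0 /\ ((y *m a) 0 0 = 0 <-> cone_on E J y).
Proof.
move=> JI [a0 aneg] [c [c0 cI yE]].
have le0 i : i \in I -> c 0 i * (E *m a) i 0 <= 0.
  move=> iI; have [/a0->|iJ] := boolP (i \in J); first by rewrite mulr0.
  by rewrite mulr_ge0_le0 // ltW // aneg.
have ya : (y *m a) 0 0 = \sum_(i in I) c 0 i * (E *m a) i 0.
  by rewrite yE (supported_mul _ _ cI).
split; first by rewrite ya; exact: sumr_le0.
split=> [y0|[d [d0 dJ ->]]]; last first.
  by rewrite (supported_mul _ _ dJ) big1 // => i /a0->; rewrite mulr0.
exists c; split => // i iJ; have [iI|/cI//] := boolP (i \in I).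
have H : \sum_(i in I) - (c 0 i * (E *m a) i 0) = 0.
  by rewrite sumrN -ya y0 oppr0.
have Hn j : j \in I -> 0 <= - (c 0 j * (E *m a) j 0).
  by move=> jI; rewrite oppr_ge0 le0.
have /eqP := psumr_eq0P Hn H iI.
by rewrite oppr_eq0 mulf_eq0 [(E *m a) i 0 == 0]lt_eqF ?aneg // orbF => /eqP.
Qed.

Lemma vertex_face_exposed a (J : {set 'I_N}) : J \subset I -> exposes a J ->
  face P (vertex_face J) /\
  vertex_face J = [set x | P x /\ (x *m a) 0 0 = (row i0 S *m a) 0 0].
Proof.
move=> JI aJ; have le x : P x -> ((x - row i0 S) *m a) 0 0 <= 0 /\
    (((x - row i0 S) *m a) 0 0 = 0 <-> cone_on E J (x - row i0 S)).
  by move=> /hull_vertex_cone; exact: exposes_cone.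
have sub (x : 'rV[R]_n) : ((x - row i0 S) *m a) 0 0 = (x *m a) 0 0 - (row i0 S *m a) 0 0.
  by rewrite mulmxBl mxE [X in _ + X]mxE.
have FE : vertex_face J = [set x | P x /\ (x *m a) 0 0 = (row i0 S *m a) 0 0].
  apply/seteqP; split=> x /= [Px]; have [_] := le x Px; rewrite sub => H.
    by move=> /H/eqP; rewrite subr_eq0 => /eqP.
  by move=> xa; split => //; apply/H; rewrite xa subrr.
split => //; rewrite FE; apply/faceP; exists a, ((row i0 S *m a) 0 0); split => //.
by move=> x /le[+ _]; rewrite sub subr_le0.
Qed.

Lemma vertex_face_vertex (J : {set 'I_N}) : vertex_face J (row i0 S).
Proof.
split; first exact: hull_row.
exists 0; split; [by move=> i; rewrite mxE|by move=> i _; rewrite mxE|].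
by rewrite subrr mul0mx.
Qed.

Lemma edge_row j : row j S - row i0 S = row j E. Proof. by rewrite rowK. Qed.

Lemma vertex_face_row a (J : {set 'I_N}) l : J \subset I -> exposes a J ->
  l \in I -> vertex_face J (row l S) <-> l \in J.
Proof.
move=> JI [a0 aneg] lI; split=> [[_]|lJ].
  rewrite edge_row => -[c [_ cJ cE]]; apply: contraT => lJ.
  have := aneg l lI lJ; suff -> : (E *m a) l 0 = 0 by rewrite ltxx.
  have -> : (E *m a) l 0 = (row l E *m a) 0 0 by rewrite -row_mul [RHS]mxE.
  by rewrite cE (supported_mul _ _ cJ) big1 // => i /a0->; rewrite mulr0.
split; first exact: hull_row.
exists (delta_mx 0 l); split; last by rewrite edge_row rowE.
  by move=> i; rewrite mxE ler0n.
by move=> i iJ; rewrite mxE /=; case: eqP => // il; rewrite il lJ in iJ.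
Qed.

Lemma vertex_face_dim a (J : {set 'I_N}) : J \subset I -> exposes a J ->
  has_dim (vertex_face J) (\rank (mask R J *m E)).
Proof.
move=> JI aJ; have [fF _] := vertex_face_exposed JI aJ.
have i0F : i0 \in face_index S (vertex_face J).
  by apply/mem_face_index; exact: vertex_face_vertex.
rewrite (face_hull_on fF) hull_onE; set K := face_index S _ in i0F *.
apply/(has_dim_hull _ (enum_rank_in i0F i0)).
have -> : edges (rowsub (@enum_val _ (mem K)) S) (enum_rank_in i0F i0)
    = rowsub (@enum_val _ (mem K)) E.
  apply/row_matrixP => k; rewrite rowK !row_rowsub enum_rankK_in //.
  by rewrite edge_row.
apply/esym/eqmx_rank/andP; split; apply/row_subP => k.
  rewrite row_rowsub; have /mem_face_index[_] := enum_valP k.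
  rewrite edge_row => -[c [_ cJ ->]].
  by apply/submx_maskP; exists c.
have [kJ|kJ] := boolP (k \in J); last first.
  suff -> : row k (mask R J *m E) = 0 by exact: sub0mx.
  by apply/rowP => j; rewrite mxE mask_mul (negPf kJ) mul0r mxE.
have kK : k \in K.
  by apply/mem_face_index/(vertex_face_row JI aJ) => //; exact: (fintype.subsetP JI).
have <- : row (enum_rank_in kK k) (rowsub (@enum_val _ (mem K)) E) = row k (mask R J *m E).
  apply/rowP => j; rewrite row_rowsub enum_rankK_in // [RHS]mxE mask_mul kJ mul1r.
  by rewrite mxE.
exact: row_sub.
Qed.

(** The supporting form of [F], with its maximum at the vertex, is nonpositive on the generating
    directions and zero exactly on those leading to points of [F]. *)
Lemma face_at_vertex F : face P F -> F (row i0 S) ->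
  let J := (I :&: face_index S F)%SET in F = vertex_face J /\ exists a, exposes a J.
Proof.
move=> /faceP[a [b [Pb FE]]] F0 J.
have b0 : (row i0 S *m a) 0 0 = b by move: F0; rewrite FE => -[].
have Ea i : (E *m a) i 0 = (row i S *m a) 0 0 - b.
  have -> : (E *m a) i 0 = (row i E *m a) 0 0 by rewrite -row_mul [RHS]mxE.
  by rewrite rowK mulmxBl mxE [X in _ + X]mxE b0.
have aJ : exposes a J.
  split=> i.
    rewrite inE => /andP[_ /mem_face_index]; rewrite FE => -[_ E0].
    by rewrite Ea E0 subrr.
  move=> iI; rewrite inE iI /= => iF; rewrite Ea lt_neqAle subr_eq0 subr_le0.
  rewrite Pb ?andbT; last exact: hull_row.
  apply: contra iF => /eqP E0; apply/mem_face_index; rewrite FE; split => //.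
  exact: hull_row.
have JI : J \subset I by exact: finset.subsetIl.
split; last by exists a.
by have [_ ->] := vertex_face_exposed JI aJ; rewrite FE b0.
Qed.

End VertexFigure.

(** * Faces of simple polytopes *)

Lemma card_intermediate_sets (T : finType) (A B : {set T}) p : A \subset B ->
  #|[set J : {set T} | [&& A \subset J, J \subset B & #|J| == p]]%SET|
  = if (#|A| <= p)%N then 'C(#|B| - #|A|, p - #|A|) else 0%N.
Proof.
move=> AB; case: leqP => [le_p|lt_p]; last first.
  apply/eqP; rewrite cards_eq0; apply/eqP/setP => J; rewrite !inE.
  apply/negbTE/negP => /and3P[AJ _ /eqP cJ].
  by have := subset_leq_card AJ; rewrite cJ leqNgt lt_p.
have cBA : #|B :\: A| = (#|B| - #|A|)%N by rewrite cardsD (finset.setIidPr AB).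
rewrite -cBA -cards_draws -[RHS](card_in_imset (f := fun J => A :|: J)).
  apply/eq_card => J; rewrite inE; apply/and3P/imsetP.
    move=> [AJ JB /eqP cJ]; exists (J :\: A).
      by rewrite inE finset.setSD //= cardsD (finset.setIidPr AJ) cJ.
    by rewrite -[LHS](finset.setID J A) (finset.setIidPr AJ).
  move=> [J' + ->]; rewrite inE subsetD => /andP[/andP[J'B dis] /eqP cJ'].
  split; [exact: finset.subsetUl|by rewrite finset.subUset AB|].
  rewrite cardsU (_ : A :&: J' = finset.set0) ?cards0 ?subn0 ?cJ' ?subnKC //.
  by apply/eqP; rewrite setI_eq0 disjoint_sym.
move=> J J'; rewrite !inE !subsetD => /andP[/andP[_ dJ] _] /andP[/andP[_ dJ'] _].
move=> /(congr1 (fun X => X :\: A)); rewrite !finset.setDUl !finset.setDv !finset.set0U.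
by move/finset.setDidPl: dJ => ->; move/finset.setDidPl: dJ' => ->.
Qed.

Section SimpleVertex.
Variables (R : realType) (N n : nat) (S : 'M[R]_(N, n)) (i0 : 'I_N).
Let E := edges S i0.
Let P := hull S.
Hypothesis vS : forall i, vertex P (row i S).
Hypothesis injS : injective (fun i => row i S).
Hypothesis dimP : has_dim P n.

(** The negated supporting form of the vertex is positive on the vectors to all other vertices, so
    the cone at the vertex is pointed and has a minimal set of generators. *)
Lemma vertex_generators : exists I : {set 'I_N}, [/\ i0 \notin I,
  forall j, cone_on E I (row j E) &
  forall i, i \in I -> exists a, exposes S i0 I a [set i]].
Proof.
have /faceP[c [b [Pb vE]]] := vS i0.
have b0 : (row i0 S *m c) 0 0 = b.
  have : [set row i0 S] (row i0 S) by [].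
  by rewrite vE => -[].
have Ec i : (E *m - c) i 0 = b - (row i S *m c) 0 0.
  have -> : (E *m - c) i 0 = - (row i E *m c) 0 0.
    by rewrite -row_mul mulmxN mxE [in RHS]mxE.
  by rewrite rowK mulmxBl mxE [X in _ + X]mxE b0 opprB.
have [i|I [ID gI expI]] := @minimal_generators R _ _ E (~: [set i0]) (- c).
  rewrite !inE => ii0; rewrite Ec subr_gt0 lt_neqAle Pb ?andbT; last exact: hull_row.
  apply: contra ii0 => /eqP ib; apply/eqP/injS.
  have : [set row i0 S] (row i S) by rewrite vE; split => //; exact: hull_row.
  by [].
exists I; split.
- by apply/negP => /(fintype.subsetP ID); rewrite !inE eqxx.
- move=> j; have [->|ji] := eqVneq j i0; last by apply: gI; rewrite !inE.
  exists 0; split; [by move=> i; rewrite mxE|by move=> i _; rewrite mxE|].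
  by rewrite rowK subrr mul0mx.
- move=> i /[dup] iI /expI[a a0 aneg]; exists a; split=> j.
    by rewrite inE => /eqP->.
  by move=> jI; rewrite inE; exact: aneg.
Qed.

Variable I : {set 'I_N}.
Hypothesis i0I : i0 \notin I.
Hypothesis gI : forall j, cone_on E I (row j E).
Hypothesis expI : forall i, i \in I -> exists a, exposes S i0 I a [set i].
Hypothesis simpleP : simple_polytope P.

Lemma rank_generators : \rank (mask R I *m E) = n.
Proof.
have rE : \rank E = n by apply/esym/(has_dim_hull S i0).
apply/eqP; rewrite eqn_leq rank_leq_col -[X in (X <= _)%N]rE mxrankS //.
apply/row_subP => j; have [c [_ cI ->]] := gI j.
by apply/submx_maskP; exists c.
Qed.

Lemma edge_face i : i \in I -> faces P 1 (vertex_face S i0 [set i]).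
Proof.
move=> iI; have [a ai] := expI iI; have si : [set i]%SET \subset I by rewrite finset.sub1set.
split; first by have [] := vertex_face_exposed gI si ai.
have := vertex_face_dim gI si ai; rewrite -/E.
suff -> : \rank (mask R [set i] *m E) = 1%N by [].
apply/eqP; rewrite eqn_leq.
have := rank_mask_leq E [set i]; rewrite cards1 => -> /=.
rewrite lt0n mxrank_eq0; apply/eqP => H; case/negP: i0I.
suff -> : i0 = i by [].
apply: injS; apply/esym/eqP; rewrite -subr_eq0; apply/eqP.
rewrite (edge_row S i0); apply/rowP => j; have /matrixP/(_ i j) := H.
rewrite mask_mul inE eqxx mul1r [in RHS]mxE => Hij.
by rewrite [LHS]mxE Hij [RHS]mxE.
Qed.

(* Distinct generators span distinct edges through the vertex. *)
Lemma card_generators : #|I| = n.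
Proof.
apply/eqP; rewrite eqn_leq -{2}rank_generators rank_mask_leq andbT.
have cE := simpleP (vS i0).
have finE : finite_set [set F | faces P 1 F /\ F (row i0 S)] by exists n.
rewrite -(card_fset_set cE) cardE -(size_map (fun i => vertex_face S i0 [set i]%SET)).
apply: uniq_leq_size.
  rewrite map_inj_in_uniq ?enum_uniq // => i j; rewrite !mem_enum => iI jI Eij.
  have [a ai] := expI iI; have si : [set i]%SET \subset I by rewrite finset.sub1set.
  have [b bj] := expI jI; have sj : [set j]%SET \subset I by rewrite finset.sub1set.
  have : vertex_face S i0 [set i] (row i S).
    by apply/(vertex_face_row si ai iI); rewrite inE.
  by rewrite Eij => /(vertex_face_row sj bj iI); rewrite inE => /eqP.
move=> _ /mapP[i + ->]; rewrite mem_enum => iI.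
rewrite in_fset_set // inE; split; first exact: edge_face.
exact: vertex_face_vertex.
Qed.

Lemma rank_subset (J : {set 'I_N}) : J \subset I -> \rank (mask R J *m E) = #|J|.
Proof.
move=> JI; apply/eqP; rewrite eqn_leq rank_mask_leq /=.
have : (\rank (mask R I *m E) <= \rank (mask R J *m E) + \rank (mask R (I :\: J) *m E))%N.
  have -> : mask R I = mask R J + mask R (I :\: J).
    apply/matrixP => i j; rewrite !mxE !inE -mulrnDl; congr (_ *+ _).
    have [iJ|iJ] := boolP (i \in J); first by rewrite (fintype.subsetP JI) //= addr0.
    by rewrite add0r.
  by rewrite mulmxDl; exact: mxrank_add.
rewrite rank_generators => H0.
have {H0}H : (#|I| <= \rank (mask R J *m E) + \rank (mask R (I :\: J) *m E))%N.
  by rewrite card_generators.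
have := rank_mask_leq E (I :\: J); rewrite cardsD (finset.setIidPr JI) => H2.
rewrite -(leq_add2r (#|I| - #|J|)) subnKC ?subset_leq_card //.
by apply: (leq_trans H); rewrite leq_add2l.
Qed.

(** The generators are a basis, so a linear form can be prescribed on them: 0 on [J] and -1
    elsewhere. Hence every subset gives a face. *)
Lemma exposes_exists (J : {set 'I_N}) : J \subset I -> exists a, exposes S i0 I a J.
Proof.
move=> JI; have [f [injf imf uf]] := rank_basis card_generators rank_generators.
pose a := invmx (rowsub f E) *m (\col_l (if f l \in J then 0 else -1)).
have fa l : (E *m a) (f l) 0 = if f l \in J then 0 else -1.
  have : rowsub f E *m a = \col_l (if f l \in J then 0 else -1) by rewrite mulKVmx.
  by rewrite mul_rowsub_mx => /matrixP/(_ l 0); rewrite !mxE.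
have im i : i \in I -> exists l, i = f l.
  by rewrite -imf => /imsetP[l _ ->]; exists l.
exists a; split=> i.
  move=> iJ; have [l il] := im i (fintype.subsetP JI _ iJ).
  by rewrite il fa -il iJ.
by move=> /im[l il] iJ; rewrite il fa -il (negPf iJ) ltrN10.
Qed.

Lemma vertex_face_faces (J : {set 'I_N}) : J \subset I ->
  faces P #|J| (vertex_face S i0 J).
Proof.
move=> JI; have [a aJ] := exposes_exists JI; split.
  by have [] := vertex_face_exposed gI JI aJ.
by have := vertex_face_dim gI JI aJ; rewrite rank_subset.
Qed.

Lemma vertex_face_index (J : {set 'I_N}) : J \subset I ->
  (I :&: face_index S (vertex_face S i0 J))%SET = J.
Proof.
move=> JI; have [a aJ] := exposes_exists JI; apply/setP => l; rewrite inE.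
have [lI|lI] := boolP (l \in I); last first.
  by apply/esym/negbTE; apply: contra lI; exact: (fintype.subsetP JI).
apply/idP/idP => [/mem_face_index|lJ]; first by move/(vertex_face_row JI aJ lI).
by apply/mem_face_index/(vertex_face_row JI aJ lI).
Qed.

Lemma vertex_faceS (J J' : {set 'I_N}) : J \subset J' ->
  vertex_face S i0 J `<=` vertex_face S i0 J'.
Proof.
move=> JJ' x [Px [c [c0 cJ cE]]]; split => //; exists c; split => // i iJ'.
by apply: cJ; apply: contra iJ'; exact: (fintype.subsetP JJ').
Qed.

Lemma face_vertex_index F p : faces P p F -> F (row i0 S) ->
  F = vertex_face S i0 (I :&: face_index S F)%SET /\
  #|(I :&: face_index S F)%SET| = p.
Proof.
move=> [fF dF] F0; have [FE _] := face_at_vertex gI fF F0; split => //.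
have [fJ dJ] := vertex_face_faces (finset.subsetIl I (face_index S F)).
by rewrite -FE in dJ; apply: (has_dim_face_uniq fF).
Qed.

(** Faces through the vertex correspond to subsets of [I], with dimension as cardinality and
    inclusion preserved, so the sum counts the sets of size [p] between [JG] and [I]. *)
Lemma count_faces_above G k p : faces P k G -> G (row i0 S) ->
  (\sum_(F <- fset_set (faces P p)) `[< G `<=` F >] =
     if (k <= p)%N then 'C(n - k, p - k) else 0)%N.
Proof.
move=> fG G0; have [GE cG] := face_vertex_index fG G0.
set JG := (I :&: face_index S G)%SET in GE cG.
have JGI : JG \subset I by exact: finset.subsetIl.
have finF : finite_set (faces P p).
  by apply: sub_finite_set (finite_faces S) => F [].
transitivity (if (k <= p)%N then 'C(#|I| - k, p - k) else 0%N); last first.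
  by rewrite card_generators.
rewrite -cG -(card_intermediate_sets p JGI).
rewrite -big_mkcond /= sum1_count -size_filter cardE.
rewrite -(size_map (fun J => vertex_face S i0 J)).
apply/perm_size/uniq_perm.
- by rewrite filter_uniq // fset_uniq.
- rewrite map_inj_in_uniq ?enum_uniq // => J J'; rewrite !mem_enum !inE.
  move=> /and3P[_ JI _] /and3P[_ JI' _] EJ.
  by rewrite -(vertex_face_index JI) EJ vertex_face_index.
move=> F; rewrite mem_filter in_fset_set //.
apply/andP/mapP => [[/asboolP GF]|[J HJ ->]].
  rewrite inE => fF; have [FE cF] := face_vertex_index fF (GF _ G0).
  exists (I :&: face_index S F)%SET => //.
  rewrite mem_enum inE finset.subsetIl cF eqxx !andbT.
  apply: finset.setIS; apply/fintype.subsetP => i /mem_face_index Gi.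
  by apply/mem_face_index/GF.
move: HJ; rewrite mem_enum !inE => /and3P[JGJ JI /eqP cJ]; split.
  by rewrite GE; do 2?apply/asboolP; exact: (vertex_faceS JGJ).
by rewrite -cJ; exact: vertex_face_faces.
Qed.

End SimpleVertex.

Theorem count_faces_containing (R : realType) n (P G : set 'rV[R]_n) k p :
  polytope P -> has_dim P n -> simple_polytope P -> faces P k G ->
  (\sum_(F <- fset_set (faces P p)) `[< G `<=` F >] =
     if (k <= p)%N then 'C(n - k, p - k) else 0)%N.
Proof.
move=> /polytope_vertices[N [S [-> vS injS]]] dimP simpleP fG.
have [i0 Gi0] : exists i, G (row i S).
  have [fG' [G0 _]] := fG; have [i iG] := face_index_exists fG' G0.
  by exists i; apply/mem_face_index.
have [I [i0I gI expI]] := vertex_generators i0 vS injS.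
exact: (count_faces_above vS injS dimP i0I gI expI simpleP).
Qed.

(** * Finite differences and leading coefficients *)

Section FiniteDifferences.
Variable R : comNzRingType.

(** Both sides are the coefficient of [x ^ r] in [(1 + x) ^ K] times the [N]-th power of
    [1 - (1 + x)]. The lower index [N + K - r] also gives 0 for [r < N]. The proof is Pascal's rule
    in [N]. *)
Lemma alternating_binomial_sum (N K r : nat) : (r <= N + K)%N ->
  \sum_(q < N.+1) (-1) ^+ q * 'C(N, q)%:R * 'C(q + K, r)%:R
    = (-1) ^+ N * 'C(K, N + K - r)%:R :> R.
Proof.
pose S N K r := \sum_(q < N.+1) (-1) ^+ q * 'C(N, q)%:R * 'C(q + K, r)%:R : R.
have S0 M L s : (M + L < s)%N -> S M L s = 0.
  move=> lt_s; apply: big1 => q _; rewrite ['C(q + L, s)]bin_small ?mulr0n ?mulr0 //.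
  by have := ltn_ord q; lia.
have Srec M L s : S M.+1 L s = S M L s - S M L.+1 s.
  rewrite /S big_ord_recl /= bin0 expr0 !mul1r add0n.
  under eq_bigr => i _ do rewrite /bump /= add1n binS natrD mulrDr mulrDl.
  rewrite big_split /= addrA; congr (_ + _).
    rewrite big_ord_recr /= ['C(M, M.+1)]bin_small // mulr0 mul0r addr0.
    by rewrite [RHS]big_ord_recl /= bin0 expr0 !mul1r add0n.
  rewrite -sumrN; apply: eq_bigr => i _.
  by rewrite exprS addSnnS !mulN1r !mulNr.
rewrite -/(S N K r); elim: N K r => [|N IH] K r le_r.
  rewrite /S big_ord1 /= bin0 !expr0 !mul1r add0n in le_r *.
  by rewrite bin_sub.
rewrite Srec [S N K.+1 r]IH; last by lia.
have [le_r'|lt_r] := leqP r (N + K); last first.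
  have -> : r = (N + K).+1 by lia.
  rewrite S0 ?ltnSn // !addnS addSn subnn !bin0 !mulr1 exprS; ring.
rewrite IH // addSn addnS subSn // binS natrD exprS; ring.
Qed.

Lemma alternating_binomial_row (q : nat) :
  \sum_(j < q.+1) (-1) ^+ (q - j) * 'C(q, j)%:R = (q == 0)%:R :> R.
Proof.
have := exprDn (-1 : R) 1 q; rewrite addNr expr0n => ->.
by apply: eq_bigr => i _; rewrite expr1n mulr1 mulr_natr.
Qed.

(** Splitting off one factor [x + j] and absorbing [j] into the binomial lowers both [k] and [q] and
    shifts [x] by 1, hence the induction with [x] general. *)
Lemma finite_difference_monomial (k q : nat) (x : R) : (k <= q)%N ->
  \sum_(j < q.+1) (-1) ^+ (q - j) * 'C(q, j)%:R * (x + j%:R) ^+ k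
    = (q`! * (k == q))%:R :> R.
Proof.
elim: k q x => [|k IH] q x le_kq.
  under eq_bigr => i _ do rewrite expr0 mulr1.
  rewrite alternating_binomial_row; case: q {le_kq} => [|q] //.
  by rewrite muln0.
case: q le_kq => // q; rewrite ltnS => le_kq.
under eq_bigr => i _ do rewrite exprSr mulrA mulrDr.
rewrite big_split /= -mulr_suml IH; last exact: leqW.
rewrite (ltn_eqF (_ : k < q.+1)%N) // muln0 mul0r add0r.
rewrite big_ord_recl /= mulr0 add0r.
have E (i : 'I_q.+1) : (-1) ^+ (q.+1 - bump 0 i) * 'C(q.+1, bump 0 i)%:R
    * (x + (bump 0 i)%:R) ^+ k * (bump 0 i)%:R =
    q.+1%:R * ((-1) ^+ (q - i) * 'C(q, i)%:R * (x + 1 + i%:R) ^+ k) :> R.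
  rewrite /bump /= add1n subSS.
  have H : (q.+1)%:R * 'C(q, i)%:R = i.+1%:R * 'C(q.+1, i.+1)%:R :> R.
    by rewrite -!natrM mul_bin_diag.
  have -> : x + 1 + i%:R = x + i.+1%:R by rewrite -[i.+1]add1n natrD addrA.
  by rewrite [RHS]mulrA [q.+1%:R * (_ * _)]mulrCA H [i.+1%:R * _]mulrC mulrA [RHS]mulrAC.
rewrite (eq_bigr _ (fun i _ => E i)) -mulr_sumr IH //.
by rewrite eqSS [q.+1`!]factS -mulnA [RHS]natrM.
Qed.

Lemma finite_difference (f : {poly R}) (q : nat) (x : R) : (size f <= q.+1)%N ->
  \sum_(j < q.+1) (-1) ^+ (q - j) * 'C(q, j)%:R * f.[x + j%:R]
    = q`!%:R * f`_q.
Proof.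
move=> le_f.
under eq_bigr => j _ do rewrite (horner_coef_wide _ le_f) mulr_sumr.
rewrite exchange_big /=.
under eq_bigr => i _.
  under eq_bigr => j _ do rewrite mulrCA.
  rewrite -mulr_sumr (finite_difference_monomial _ (leq_ord i)).
  over.
rewrite (bigD1 ord_max) //= eqxx muln1 big1 ?addr0 1?mulrC // => i.
by rewrite -val_eqE /= => /negPf->; rewrite muln0 mulr0.
Qed.

End FiniteDifferences.

(** * The alternating sum of leading coefficients *)

Section LeadingCoefficients.
Variable R : realFieldType.

(** The nodes descend from [a], and the range may be any [K > q] because the surplus binomials
    vanish; this gives all [p] a common range later. *)
Lemma finite_difference_rev (f : {poly R}) (q K : nat) (a : R) :
  (size f <= q.+1)%N -> (q < K)%N ->
  \sum_(s < K) (-1) ^+ s * 'C(q, s)%:R * f.[a - s%:R] = q`!%:R * f`_q.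
Proof.
move=> sf lt_q; rewrite -(finite_difference (a - q%:R) sf).
have {lt_q} -> : K = (q.+1 + (K - q.+1))%N by lia.
rewrite big_split_ord /= [X in _ + X]big1 ?addr0 => [|s _]; last first.
  by rewrite bin_small ?mulr0 ?mul0r //= ltnS leq_addr.
rewrite [RHS](reindex_inj rev_ord_inj) /=; apply: eq_bigr => s _.
have le_s : (s <= q)%N by rewrite -ltnS.
rewrite subSS subKn // bin_sub // natrB //; congr (_ * _.[_]); ring.
Qed.

Lemma sum_ord_truncate (a m : nat) (F : nat -> R) : (a <= m)%N ->
  (forall i, (a <= i)%N -> F i = 0) -> \sum_(i < m) F i = \sum_(i < a) F i.
Proof.
move=> /subnKC <- F0; rewrite big_split_ord /= [X in _ + X]big1 ?addr0 // => i _.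
by rewrite F0 ?leq_addr.
Qed.

Variables (n : nat) (E : nat -> {poly R}) (I : nat -> nat -> R).
Hypothesis sizeE : forall p, (p <= n)%N -> (size (E p) <= p.+1)%N.
Hypothesis E_neg : forall p i, (p <= n)%N -> (0 < i)%N ->
  (E p).[- i%:R] = (-1) ^+ p * I p i.
Hypothesis E_pos : forall p i, (p <= n)%N -> (0 < i)%N ->
  (E p).[i%:R] = \sum_(k < n.+1)
    (if (k <= p)%N then 'C(n - k, p - k) else 0%N)%:R * I k i.

(** The factor ['X] makes the difference have order [p + 1], which matches the weight [p + 1] in
    [c_invariant]. It also kills the node 0, about which neither [E_neg] nor [E_pos] says
    anything. *)
Let f p := 'X * E p.

(** With [p = k + q] this is [alternating_binomial_sum] for [N = n - k] and [K = k + 1]; it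
    collapses the contribution of the positive nodes. *)
Lemma sum_alternating_faces (k r : nat) : (k <= n)%N -> (r <= n.+1)%N ->
  \sum_(p < n.+1) (-1) ^+ (n - p) * 'C(p.+1, r)%:R
     * (if (k <= p)%N then 'C(n - k, p - k) else 0%N)%:R
  = 'C(k.+1, n.+1 - r)%:R :> R.
Proof.
move=> le_k le_r.
have En : n.+1 = (k + (n - k).+1)%N by lia.
rewrite [in LHS]En big_split_ord /= big1 ?add0r => [|p _]; last first.
  by rewrite leqNgt ltn_ord mulr0.
have H := alternating_binomial_sum R (_ : r <= n - k + k.+1)%N.
transitivity ((-1) ^+ (n - k) * ((-1) ^+ (n - k) * 'C(k.+1, n - k + k.+1 - r)%:R) : R).
  rewrite -H; last by lia.
  rewrite mulr_sumr; apply: eq_bigr => q _.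
  have lt_q := ltn_ord q.
  rewrite leq_addr addKn [((k + q).+1)%N](_ : _ = q + k.+1)%N; last by lia.
  have -> : (-1) ^+ (n - k) = (-1) ^+ (n - (k + q)) * (-1) ^+ q :> R.
    by rewrite -exprD; congr (_ ^+ _); lia.
  have ss : (-1) ^+ q * (-1) ^+ q = 1 :> R by rewrite -expr2 sqrr_sign.
  rewrite -[LHS]mulr1 -[X in _ * X = _]ss.
  move: ((-1) ^+ (n - (k + q)) : R) ((-1) ^+ q : R) => x y; ring.
rewrite mulrA -expr2 sqrr_sign mul1r; congr ('C(_, _)%:R); lia.
Qed.

(** The node [a - s] is positive for [s < a] and equals [- i] for [s = a + i]. The range [n + 2]
    suffices for every [p <= n]. *)
Lemma leading_term_expansion p a : (p <= n)%N ->
  p.+1`!%:R * (E p)`_p =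
    \sum_(s < a) (-1) ^+ s * 'C(p.+1, s)%:R * ((a - s)%:R * (E p).[(a - s)%:R])
    + \sum_(i < n.+2) (-1) ^+ (a + i) * 'C(p.+1, a + i)%:R
        * (- i%:R * ((-1) ^+ p * I p i)).
Proof.
move=> le_p; have sf : (size (f p) <= p.+2)%N.
  by apply: (leq_trans (size_polyMleq _ _)); rewrite size_polyX /= ltnS sizeE.
have := @finite_difference_rev (f p) p.+1 (a + n.+2) a%:R sf _.
rewrite coefXM /= => <-; last by lia.
rewrite big_split_ord /=; congr (_ + _); apply: eq_bigr => s _; congr (_ * _).
  by rewrite -natrB ?hornerM ?hornerX // ltnW.
rewrite natrD opprD addrA subrr add0r hornerM hornerX.
by case: (nat_of_ord s) => [|i]; rewrite ?oppr0 ?mul0r // E_neg.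
Qed.

(** The number [a] of positive nodes is left free. Nodes [- i] give the lower index [a + i] and
    nodes [i] give [n + 1 - a + i]; the choice of [a] near the middle brings the two together. *)
Lemma leading_coefficients (a : nat) : (a <= n.+1)%N ->
  \sum_(p < n.+1) (-1) ^+ (n - p) * (p.+1`!%:R * (E p)`_p) =
  \sum_(k < n.+1) \sum_(i < n.+2)
    ((-1) ^+ (n.+1 + a + i) * 'C(k.+1, a + i)%:R
     + (-1) ^+ (a + i) * 'C(k.+1, n.+1 - a + i)%:R) * i%:R * I k i.
Proof.
move=> le_a.
under eq_bigr => p _ do rewrite (leading_term_expansion a (leq_ord p)) mulrDr.
under [RHS]eq_bigr => k _.
  under eq_bigr => i _ do rewrite !mulrDl.
  rewrite big_split /=.
  over.
rewrite !big_split /= addrC; congr (_ + _).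
  apply: eq_bigr => p _; rewrite mulr_sumr; apply: eq_bigr => i _.
  have -> : (-1) ^+ (n.+1 + a + i) = - ((-1) ^+ (n - p) * (-1) ^+ p * (-1) ^+ (a + i)) :> R.
    by rewrite -!exprD subnK ?leq_ord // -addnA addSn exprS mulN1r addnA.
  ring.
pose g k s : R := (-1) ^+ s * 'C(k.+1, n.+1 - s)%:R * ((a - s)%:R * I k (a - s)%N).
transitivity (\sum_(k < n.+1) \sum_(s < a) g k s).
  under eq_bigr => p _.
    rewrite mulr_sumr.
    under eq_bigr => s _.
      rewrite E_pos ?leq_ord ?subn_gt0 // !mulr_sumr.
      over.
    rewrite exchange_big /=.
    over.
  rewrite exchange_big /=; apply: eq_bigr => k _.
  rewrite exchange_big /=; apply: eq_bigr => s _.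
  rewrite /g -(sum_alternating_faces (leq_ord k) (r := s)); last first.
    by apply: ltnW; apply: (leq_trans (ltn_ord s)).
  rewrite mulr_sumr mulr_suml; apply: eq_bigr => p _.
  ring.
apply: eq_bigr => k _; rewrite [RHS]big_ord_recl /= mulr0 mul0r add0r.
(* Beyond [i = a] the lower index exceeds [n + 1], hence [k + 1]. On the remaining range the node is
   [i = a - s], so the order of summation is reversed. *)
rewrite (@sum_ord_truncate a n.+1 (fun i => (-1) ^+ (a + bump 0 i)
  * 'C(k.+1, n.+1 - a + bump 0 i)%:R * (bump 0 i)%:R * I k (bump 0 i))) // => [|i le_i].
  2: by rewrite bin_small ?mulr0 ?mul0r // /bump /=; have := ltn_ord k; lia.
rewrite (reindex_inj rev_ord_inj) /=; apply: eq_bigr => s _; rewrite /g.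
have lt_s := ltn_ord s.
rewrite /bump /= add1n subKn // -!mulrA; congr (_ * _).
  rewrite -signr_odd -[RHS]signr_odd; congr ((-1) ^+ _).
  by rewrite oddB // oddD /=; case: (odd a); case: (odd s).
congr (_ * _); congr ('C(_, _)%:R); lia.
Qed.

End LeadingCoefficients.

(** * Lattice points of faces *)

Section LatticePolytopeFaces.
Variables (R : realType) (n : nat) (P : set 'rV[R]_n).
Hypothesis polyP : polytope P.

Lemma finite_faces_dim p : finite_set (faces P p).
Proof.
have [N [S PE]] := polytope_hull polyP.
by apply: (sub_finite_set _ (finite_faces S)) => F []; rewrite PE.
Qed.

Lemma face_subset F : face P F -> F `<=` P.
Proof. by move=> [a [b [_ ->]]] x []. Qed.

Lemma face_hull p F : faces P p F ->
  exists N (S : 'M[R]_(N, n)) (i0 : 'I_N), F = hull S.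
Proof.
have [N [S PE]] := polytope_hull polyP; rewrite PE => -[fF [F0 _]].
have [i iJ] := face_index_exists fF F0.
exists #|face_index S F|, (rowsub (@enum_val _ (mem (face_index S F))) S).
by exists (enum_rank_in iJ i); rewrite -hull_onE -(face_hull_on fF).
Qed.

Lemma relint_dilate p F t x : faces P p F -> (0 < t)%N ->
  relint (dilate t F) (t%:R *: x) <-> relint F x.
Proof.
move=> /face_hull[N [S [_ ->]]] t0; have tR : 0 < t%:R :> R by rewrite ltr0n.
rewrite relint_hull; split.
  move=> /(relint_dilate_hullP _ _ t0)[c [c0 ct cE]].
  exists (t%:R^-1 *: c); split.
  - by move=> i; rewrite mxE mulr_gt0 // invr_gt0.
  - by under eq_bigr do rewrite mxE; rewrite -mulr_sumr ct mulVf // gt_eqF.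
  - by rewrite -scalemxAl -cE scalerA mulVf ?scale1r // gt_eqF.
move=> [c [c0 c1 ->]]; apply/relint_dilate_hullP => //; exists (t%:R *: c); split.
- by move=> i; rewrite mxE mulr_gt0.
- by under eq_bigr do rewrite mxE; rewrite -mulr_sumr c1 mulr1.
- by rewrite -scalemxAl.
Qed.

Lemma dilate_mem t (F : set 'rV[R]_n) x : (0 < t)%N ->
  dilate t F (t%:R *: x) <-> F x.
Proof.
move=> t0; have tR : t%:R != 0 :> R by rewrite pnatr_eq0 -lt0n.
split=> [[y Fy E]|Fx]; last by exists x.
by have <- : y = x by apply: (scalerI tR).
Qed.

(** The relative interiors of the faces partition [P]: two faces sharing such a point contain each
    other. *)
Lemma count_relint_faces x : P x -> exists k G, [/\ (k <= n)%N, faces P k G,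
  relint G x & forall k',
  (\sum_(F <- fset_set (faces P k')) `[< relint F x >])%N = (k' == k)].
Proof.
have [N [S PE]] := polytope_hull polyP; rewrite PE => Px.
have [G [fG Gx]] := relint_face_exists Px.
have [|k le_k dG] := face_has_dim fG; first by exists x; case: Gx.
exists k, G; split => // k'.
have U F : face (hull S) F -> relint F x -> F = G.
  move=> fF Fx; apply/seteqP; split.
    by apply/(relint_face_sub fF fG Fx); case: Gx.
  by apply/(relint_face_sub fG fF Gx); case: Fx.
have finF : finite_set (faces (hull S) k') by rewrite -PE; exact: finite_faces_dim.
have [->|kk'] := eqVneq k' k; last first.
  rewrite big_seq big1 // => F; rewrite in_fset_set // inE => -[fF dF].
  have [Fx|nFx] := pselect (relint F x); last by rewrite asboolF.
  by case/eqP: kk'; apply: (has_dim_face_uniq (S := S) fG) => //; rewrite -(U F).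
have finF' : finite_set (faces (hull S) k) by rewrite -PE; exact: finite_faces_dim.
have mG : G \in fset_set (faces (hull S) k) by rewrite in_fset_set // inE; split.
rewrite (big_rem _ mG) /= asboolT // big_seq big1 ?addn0 // => F.
rewrite mem_rem_uniq ?fset_uniq // inE => /andP[FG].
rewrite in_fset_set // inE => -[fF _]; rewrite asboolF // => Fx.
by case/eqP: FG; exact: U.
Qed.

Lemma lattice_count_sub (A B : set 'rV[R]_n) s : A `<=` B -> enumerates B s ->
  lattice_count A = (\sum_(y <- s) `[< A y >])%N.
Proof.
move=> AB [us sP]; rewrite -big_mkcond /= sum1_count -size_filter.
apply: lattice_count_size; split; first exact: filter_uniq.
move=> y; rewrite mem_filter; split=> [/andP[/asboolP Ay /sP[iy _]]//|[iy Ay]].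
by apply/andP; split; [exact/asboolP|apply/sP; split => //; exact: AB].
Qed.

Hypothesis dimP : has_dim P n.
Hypothesis simpleP : simple_polytope P.

(** Double counting over lattice points [t%:R *: x] of the dilate: the faces whose dilates contain
    the point are those containing the unique face [G] with [x] in its relative interior, and
    simplicity counts them. *)
Lemma closed_count_sum p t : (0 < t)%N ->
  (\sum_(F <- fset_set (faces P p)) lattice_count (dilate t F) =
   \sum_(k < n.+1) (if (k <= p)%N then 'C(n - k, p - k) else 0)
                   * interior_count P k t)%N.
Proof.
move=> t0; have [N [S PE]] := polytope_hull polyP.
have [s sP] := dilate_hull_enumerates S t0; rewrite -PE in sP.
have sub k F : F \in fset_set (faces P k) -> face P F.
  by rewrite in_fset_set ?inE; [case|exact: finite_faces_dim].
have sub' k F : F \in fset_set (faces P k) -> faces P k F.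
  by rewrite in_fset_set ?inE //; exact: finite_faces_dim.
transitivity (\sum_(y <- s) \sum_(F <- fset_set (faces P p)) `[< dilate t F y >])%N.
  rewrite exchange_big /=; apply: eq_big_seq => F /sub fF.
  by apply: lattice_count_sub sP => _ [x Fx <-]; exists x => //; exact: face_subset fF _ Fx.
have intE k : interior_count P k t =
    (\sum_(y <- s) \sum_(F <- fset_set (faces P k)) `[< relint (dilate t F) y >])%N.
  rewrite /interior_count fsbig_finite /=; last exact: finite_faces_dim.
  rewrite exchange_big /=; apply: eq_big_seq => F /sub fF.
  apply: lattice_count_sub sP => _ [[x Fx <-] _]; exists x => //.
  exact: face_subset fF _ Fx.
under [RHS]eq_bigr => k _ do rewrite intE big_distrr /=.
rewrite [RHS]exchange_big /=; apply: eq_big_seq => y /(sP.2 y)[_ [x Px <-]].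
have [k [G [le_k fG Gx cnt]]] := count_relint_faces Px.
have -> : (\sum_(F <- fset_set (faces P p)) `[< dilate t F (t%:R *: x) >] =
    \sum_(F <- fset_set (faces P p)) `[< G `<=` F >])%N.
  apply: eq_big_seq => F /sub fF; congr nat_of_bool; apply/asboolP/asboolP.
    move=> /(dilate_mem _ _ t0) Fx.
    by move: fF fG; rewrite PE => fF [fG _]; apply/(relint_face_sub fG fF Gx).
  by move=> GF; apply/(dilate_mem _ _ t0)/GF; case: Gx.
rewrite (count_faces_containing p polyP dimP simpleP fG).
have kn : (k < n.+1)%N by [].
rewrite (bigD1 (Ordinal kn)) //= [X in (_ + X)%N]big1 ?addn0 => [|k' kk'].
  rewrite -[LHS]muln1; congr (_ * _)%N.
  transitivity (nat_of_bool (k == k)); first by rewrite eqxx.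
  rewrite -cnt.
  apply: eq_big_seq => F /sub' fF; congr nat_of_bool; apply/asboolP/asboolP => H.
    by apply/(relint_dilate _ fF).
  by apply/(relint_dilate _ fF t0).
rewrite big_seq big1 ?muln0 // => F /[dup] FF /sub' fF.
apply/eqP; rewrite eqb0; apply/asboolPn => /(relint_dilate _ fF t0) Fx.
have := cnt k'; rewrite (negPf (_ : nat_of_ord k' != k)); last by [].
by rewrite (big_rem _ FF) /= asboolT.
Qed.

End LatticePolytopeFaces.

(** * The identity in both parities *)

Theorem theorem3p1 (R : realType) (n : nat) (P : set 'rV[R]_n)
    (P_lattice : lattice_polytope P)
    (P_dim : has_dim P n)
    (P_simple : simple_polytope P) :
  (odd n ->
    let m := ((n + 1) %/ 2)%N in
    c_invariant P =
      \sum_(m <= p < n.+1) \sum_(1 <= i < (p + 1 - m).+1)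
        (-1) ^ (m%:Z - i%:Z) * 'C(p + 1, m + i)%:R
          * 2 * i%:R * (interior_count P p i)%:R) /\
  (~~ odd n ->
    let m := (n %/ 2)%N in
    c_invariant P =
      \sum_(m <= p < n.+1) \sum_(1 <= i < (p + 1 - m).+1)
        (-1) ^ (m%:Z + 1 - i%:Z)
          * ('C(p + 1, m + i)%:R - 'C(p + 1, m + i + 1)%:R)
          * i%:R * (interior_count P p i)%:R).
Proof.
have [polyP latP] := P_lattice.
have [N0 [S0 [PE vS _]]] := polytope_vertices polyP.
have face_ehrhart p F : exists phi : {poly R}, faces P p F ->
  [/\ (size phi <= p.+1)%N,
    forall t, (0 < t)%N -> phi.[t%:R] = (lattice_count (dilate t F))%:R,
    forall t, (0 < t)%N -> phi.[- t%:R] =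
      (-1) ^+ p * (lattice_count (relint (dilate t F)))%:R &
    lattice_volume p F = p`!%:R * phi`_p].
  have [fF|nF] := pselect (faces P p F); last by exists 0.
  have iS0 : integral_mx S0.
    by move=> i j; have := latP _ (vS i) j; rewrite mxE.
  have [fF' dF] := fF; rewrite PE in fF'.
  have FE := face_hull_on fF'; rewrite hull_onE in FE.
  have [i iJ] := face_index_exists fF' dF.1; pose i0 := enum_rank_in iJ i.
  move: FE; set S := rowsub _ S0 => FE.
  have iS : integral_mx S by move=> k j; rewrite mxE.
  rewrite FE in dF; have [phi Hphi] := hull_ehrhart i0 iS dF.
  by exists phi => _; rewrite FE.
have /choice[phi phiP] : forall pF : nat * set 'rV[R]_n, exists phi : {poly R},
  faces P pF.1 pF.2 -> [/\ (size phi <= pF.1.+1)%N,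
    forall t, (0 < t)%N -> phi.[t%:R] = (lattice_count (dilate t pF.2))%:R,
    forall t, (0 < t)%N -> phi.[- t%:R] =
      (-1) ^+ pF.1 * (lattice_count (relint (dilate t pF.2)))%:R &
    lattice_volume pF.1 pF.2 = pF.1`!%:R * phi`_pF.1].
  by move=> [p F]; exact: face_ehrhart.
have finP p : finite_set (faces P p) by exact: finite_faces_dim.
have mem p F : F \in fset_set (faces P p) -> faces P p F.
  by rewrite in_fset_set // inE.
pose E p := \sum_(F <- fset_set (faces P p)) phi (p, F).
pose I p i : R := (interior_count P p i)%:R.
have sizeE p : (p <= n)%N -> (size (E p) <= p.+1)%N.
  move=> _; apply: (leq_trans (size_sum _ _ _)); apply/bigmax_leqP_seq => F FP _.
  by have [] := phiP (p, F) (mem p F FP).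
have E_neg p i : (p <= n)%N -> (0 < i)%N -> (E p).[- i%:R] = (-1) ^+ p * I p i.
  move=> _ i0; rewrite /I /interior_count fsbig_finite //= natr_sum mulr_sumr.
  rewrite horner_sum; apply: eq_big_seq => F FP.
  by have [_ _ ->] := phiP (p, F) (mem p F FP).
have E_pos p i : (p <= n)%N -> (0 < i)%N -> (E p).[i%:R] = \sum_(k < n.+1)
    (if (k <= p)%N then 'C(n - k, p - k) else 0%N)%:R * I k i.
  move=> _ i0; under [RHS]eq_bigr do rewrite -natrM.
  rewrite -natr_sum -(closed_count_sum polyP P_dim P_simple) // natr_sum.
  rewrite horner_sum; apply: eq_big_seq => F FP.
  by have [_ -> ] := phiP (p, F) (mem p F FP).
have cE : c_invariant P = \sum_(p < n.+1) (-1) ^+ (n - p) * (p.+1`!%:R * (E p)`_p).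
  rewrite /c_invariant big_mkord; apply: eq_bigr => p _.
  rewrite -mulrA; congr (_ * _); rewrite fsbig_finite //= coef_sum !mulr_sumr.
  apply: eq_big_seq => F FP; have [_ _ _ ->] := phiP (nat_of_ord p, F) (mem p F FP).
  by rewrite mulrA -natrM addn1 factS.
have lead a := @leading_coefficients R n E I sizeE E_neg E_pos a.
(* The exponent in the statement is an integer and may be negative; only its parity matters, and it
   is that of [a + b]. *)
have signE (a b : nat) : (-1 : R) ^ (a%:Z - b%:Z) = (-1) ^+ (a + b).
  rewrite expfzDr ?oppr_eq0 ?oner_eq0 // -exprnN exprD; congr (_ * _).
  by rewrite -exprVn invrN invr1.
(* The terms outside the stated ranges vanish, either through the factor [i] or through binomials
   with lower index above [p + 1]. *)
have restrict (m : nat) (F : nat -> nat -> R) : (m <= n)%N ->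
    (forall p i, (i == 0%N) || (p.+1 < m + i)%N -> F p i = 0) ->
    \sum_(p < n.+1) \sum_(i < n.+2) F p i =
    \sum_(m <= p < n.+1) \sum_(1 <= i < (p + 1 - m).+1) F p i.
  move=> le_m F0; rewrite -(big_mkord xpredT (fun p => \sum_(i < n.+2) F p i)).
  rewrite (big_cat_nat _ (n := m)) //= ?(leqW le_m) //.
  rewrite [X in X + _]big_nat big1 ?add0r => [|p /andP[_ lt_p]]; last first.
    apply: big1 => i _; apply: F0; apply/orP.
    by case: (nat_of_ord i) => [|j]; [left|right; lia].
  rewrite [LHS]big_nat [RHS]big_nat; apply: eq_bigr => p /andP[le_p lt_p].
  rewrite -(big_mkord xpredT (fun i => F p i)) big_ltn // F0 // add0r.
  rewrite (big_cat_nat _ (n := (p + 1 - m).+1)) //=; last by lia.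
  rewrite [X in _ + X]big_nat [X in _ + X]big1 ?addr0 // => i /andP[lt_i _].
  by apply: F0; apply/orP; right; lia.
split=> n_parity m.
  (* Here [n + 1 - m = m], so both binomials and their signs agree: this is the factor 2. *)
  have nm : n.+1 = (m + m)%N by rewrite /m; lia.
  rewrite cE (lead m); last by lia.
  rewrite (@restrict m (fun p i => ((-1) ^+ (n.+1 + m + i) * 'C(p.+1, m + i)%:R +
      (-1) ^+ (m + i) * 'C(p.+1, n.+1 - m + i)%:R) * i%:R * I p i)); last first.
  - move=> p i /orP[/eqP->|lt_i]; first by rewrite mulr0 mul0r.
    by rewrite nm addnK bin_small // !mulr0 addr0 !mul0r.
  - by lia.
  apply: eq_bigr => p _; apply: eq_bigr => i _; rewrite signE addn1 nm addnK.
  have -> : (-1) ^+ (m + m + m + i) = (-1) ^+ (m + i) :> R.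
    by rewrite -addnA exprD addnn -mul2n exprM sqrrN expr1n expr1n mul1r.
  by rewrite /I; ring.
have nm : n = (m + m)%N by rewrite /m; lia.
rewrite cE (lead m); last by lia.
(* Here the second lower index is one larger and the signs are opposite, which produces the
   difference of consecutive binomials. *)
have nmm : (n.+1 - m = m.+1)%N by lia.
rewrite (@restrict m (fun p i => ((-1) ^+ (n.+1 + m + i) * 'C(p.+1, m + i)%:R +
    (-1) ^+ (m + i) * 'C(p.+1, n.+1 - m + i)%:R) * i%:R * I p i)); last first.
- move=> p i /orP[/eqP->|lt_i]; first by rewrite mulr0 mul0r.
  by rewrite nmm !bin_small ?mulr0 ?addr0 ?mul0r //; lia.
- by lia.
apply: eq_bigr => p _; apply: eq_bigr => i _; rewrite nmm.
have -> : (-1) ^ (m%:Z + 1 - i%:Z) = - (-1) ^+ (m + i) :> R.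
  by rewrite -[m%:Z + 1]/((m + 1)%N : int) signE addn1 addSn exprS mulN1r.
have -> : (-1) ^+ (n.+1 + m + i) = - (-1) ^+ (m + i) :> R.
  by rewrite nm !addSn -addnA exprS mulN1r exprD addnn -mul2n exprM sqrrN expr1n expr1n mul1r.
rewrite !addn1 addSn /I; ring.
Qed.
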